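(* Let $\mathbf{F}$ be a finite field of odd cardinality $q$, let $(G,\mathbf{V})$ be the infinite orthogonal group over $\mathbf{F}$, and let $\Theta(G;\mathbf{V})$ be its universal measure ring relative to $\mathbf{V}$. Let $\phi^{\rm even},\phi^{\rm odd}\colon\Theta(G;\mathbf{V})\to\mathbb{Z}[1/q][t]$ be the counting measures defined in the context. Then the map $$\phi^{\rm even}\times\phi^{\rm odd}\colon\Theta(G;\mathbf{V})[1/2q]\to\mathbb{Z}[1/2q][t]\times\mathbb{Z}[1/2q][t]$$ is an injection, and its image consists of the pairs $(f,g)$ such that $f(0)=g(0)$. In particular, there is a ring isomorphism $$\Theta(G;\mathbf{V})[1/2q]\cong\mathbb{Z}[1/2q][t,t']/(tt').$$
   Context: A quadratic space is an $\mathbf{F}$-vector space with a symmetric bilinear form; an embedding is an injective linear map preserving forms. $\mathbf{V}$ has basis $\{e_i,f_i\}_{i\ge1}$ and form $\langle e_i,e_j\rangle=\langle f_i,f_j\rangle=0$, $\langle e_i,f_j\rangle=\delta_{i,j}$; $G$ is its group of form-preserving linear automorphisms. The modified discriminant of a quadratic space of dimension $2r$ or $2r+1$ is $(-1)^r$ times its discriminant. $V_{m,\delta}$ is the non-degenerate quadratic space of dimension $m$ and modified discriminant $\delta\in\mathbf{F}^\times/(\mathbf{F}^\times)^2$ ($\delta$ is irrelevant if $m=0$); $V_{m,\delta,n}$ is the orthogonal sum of $V_{m,\delta}$ and an $n$-dimensional space with zero form. $X_{m,\delta,n}$ is the set of embeddings $V_{m,\delta,n}\to\mathbf{V}$, with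 its transitive $G$-action. A transitive $G$-set is $\mathbf{V}$-smooth if its stabilizers are pointwise stabilizers $G(A)$ of finite subsets $A\subset\mathbf{V}$; these are exactly the $X_{m,\delta,n}$ up to isomorphism. $\Theta(G;\mathbf{V})$ is the commutative ring generated by symbols $[f]$, for $f\colon Y\to X$ a map of transitive $\mathbf{V}$-smooth $G$-sets, modulo the relations: (a) $[f]=1$ if $f$ is an isomorphism; (b) $[f\circ g]=[f][g]$ for composable maps; (c) $[f]=\sum_i[f'_i]$ whenever $X'\to X$ is a map of transitive $\mathbf{V}$-smooth $G$-sets, $Y\times_XX'=\bigsqcup_iY'_i$ is the orbit decomposition, and $f'_i\colon Y'_i\to X'$ is the projection. For a transitive $\mathbf{V}$-smooth $G$-set $X$, $[X]:=[X\to\mathrm{pt}]$. Every map $f\colon X(W)\to X(V)$ of transitive $\mathbf{V}$-smooth $G$-sets (where $X(V)$ is the set of embeddings $V\to\mathbf{V}$) is restriction along an embedding $V\to W$. For $\ast=$ even put $E_r=V_{2r,1}$; for $\ast=$ odd put $E_r=V_{2r+1,1}$. For $r$ large let $\nu^{\ast}_r(f)$ be the number of extensions of an embedding $V\to E_r$ to an embedding $W\to E_r$ (independent of the chosen embedding). $\phi^{\ast}\colon\Theta(G;\mathbf{V})\to\mathbb{Z}[1/q][t]$ is the ring homomorphism for which $\phi^{\ast}([f])$ is the unique polynomial whose value at $t=q^r$ is $\nu_r^{\ast}(f)$ for all sufficiently large $r$. In particular $\phi^{\ast}([X_{a,\epsilon,b}])=P^{\ast}_{a,\epsilon,b}(t)$,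 the polynomial whose value at $q^r$ is the number of embeddings $V_{a,\epsilon,b}\to E_r$. *)

(* Defs.v *)
From HB Require Import structures.
From mathcomp Require Import all_boot all_order all_algebra generic_quotient.
From mathcomp Require Import ring_quotient boolp monalg ring.

Set Implicit Arguments.
Unset Strict Implicit.
Unset Printing Implicit Defensive.

Import GRing.Theory Num.Theory.
Local Open Scope ring_scope.
Local Open Scope quotient_scope.

(* The quotient of a commutative, possibly zero, ring by the ideal generated
   by a set S. The ring quotients of ring_quotient require a proper ideal, and
   for a ring given by generators and relations this is not known a priori. *)
Section RingQuot.
Variables (R : comPzRingType) (S : R -> Prop).

Definition ideal_gen : {pred R} := fun x =>
  `[< exists (n : nat) (c s : 'I_n -> R),
        (forall i, S (s i)) /\ x = \sum_i c i * s i >].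

Lemma ideal_genM (a x : R) : x \in ideal_gen -> a * x \in ideal_gen.
Proof.
move/asboolP => [n [c [s [Ss ->]]]]; apply/asboolP.
exists n, (fun i => a * c i), s; split=> //.
by rewrite mulr_sumr; apply: eq_bigr => i _; rewrite mulrA.
Qed.

Lemma ideal_gen_zmod : zmod_closed ideal_gen.
Proof.
split=> [|x y xI yI].
  apply/asboolP; exists 0%N, (fun=> 0), (fun=> 0).
  by split=> [[]|] //; rewrite big_ord0.
have := ideal_genM (-1) yI; rewrite mulN1r => /asboolP [m [d [t [St ->]]]].
move/asboolP: xI => [n [c [s [Ss ->]]]]; apply/asboolP; exists (n + m)%N.
exists (fun i => match split i with inl j => c j | inr j => d j end).
exists (fun i => match split i with inl j => s j | inr j => t j end).
split=> [i|]; first by case: (split i).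
rewrite big_split_ord /=; congr (_ + _); apply: eq_bigr => i _.
  by have -> : split (lshift m i) = inl i by exact: (unsplitK (inl i)).
by have -> : split (rshift n i) = inr i by exact: (unsplitK (inr i)).
Qed.

HB.instance Definition _ := GRing.isZmodClosed.Build R ideal_gen ideal_gen_zmod.

Definition ring_quot : Type := (Quotient.quot ideal_gen).
HB.instance Definition _ := GRing.Zmodule.on ring_quot.

Definition rq (x : R) : ring_quot := \pi_(Quotient.quot ideal_gen) x.
Local Notation rep := (@repr _ (Quotient.quot ideal_gen)).
Definition rq_mul (x y : ring_quot) : ring_quot := rq (rep x * rep y).

Lemma rqP (x y : R) : rq x = rq y <-> x - y \in ideal_gen.
Proof. by rewrite Quotient.idealrBE; split=> /eqP. Qed.

Lemma rq_surj (x : ring_quot) : exists a, rq a = x.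
Proof. by exists (rep x); exact: reprK. Qed.

Lemma rqB : {morph rq : x y / x - y}. Proof. by move=> x y; exact: raddfB. Qed.
Lemma rqD : {morph rq : x y / x + y}. Proof. by move=> x y; exact: raddfD. Qed.

Lemma rqM (x y : R) : rq (x * y) = rq_mul (rq x) (rq y).
Proof.
have Hr a : a - rep (rq a) \in ideal_gen by apply/rqP; rewrite /rq reprK.
apply/rqP; set x' := rep _; set y' := rep _.
have -> : x * y - x' * y' = y * (x - x') + x' * (y - y').
  by rewrite !mulrBr (mulrC y x) (mulrC y x') addrA subrK.
by rewrite rpredD // ideal_genM ?Hr.
Qed.

Lemma rq_mulA : associative rq_mul.
Proof.
move=> x y z; have [a <-] := rq_surj x; have [b <-] := rq_surj y.
by have [c <-] := rq_surj z; rewrite -!rqM mulrA.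
Qed.
Lemma rq_mulC : commutative rq_mul.
Proof.
move=> x y; have [a <-] := rq_surj x; have [b <-] := rq_surj y.
by rewrite -!rqM mulrC.
Qed.
Lemma rq_mul1 : left_id (rq 1) rq_mul.
Proof. by move=> x; have [a <-] := rq_surj x; rewrite -!rqM mul1r. Qed.
Lemma rq_mul1r : right_id (rq 1) rq_mul.
Proof. by move=> x; rewrite rq_mulC rq_mul1. Qed.
Lemma rq_mulDl : left_distributive rq_mul +%R.
Proof.
move=> x y z; have [a <-] := rq_surj x; have [b <-] := rq_surj y.
by have [c <-] := rq_surj z; rewrite -!rqM -!rqD -rqM mulrDl.
Qed.
Lemma rq_mulDr : right_distributive rq_mul +%R.
Proof. by move=> x y z; rewrite !(rq_mulC x) rq_mulDl. Qed.

HB.instance Definition _ := GRing.Zmodule_isPzRing.Build ring_quot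
  rq_mulA rq_mul1 rq_mul1r rq_mulDl rq_mulDr.
HB.instance Definition _ :=
  GRing.PzRing_hasCommutativeMul.Build ring_quot rq_mulC.

HB.instance Definition _ := GRing.isZmodMorphism.Build R ring_quot rq rqB.
HB.instance Definition _ :=
  GRing.isMonoidMorphism.Build R ring_quot rq (conj erefl rqM).

End RingQuot.

(* The localization R[1/s] of a commutative ring at the powers of s: the class
   frac a n of (a, n) is the fraction a / s ^+ n. *)
Section Localization.
Variables (R : comPzRingType) (s : R).

Definition loc_eqv (x y : R * nat) : bool :=
  `[< exists k, s ^+ k * (x.1 * s ^+ y.2) = s ^+ k * (y.1 * s ^+ x.2) >].

Lemma loc_eqv_refl : reflexive loc_eqv.
Proof. by move=> x; apply/asboolP; exists 0%N. Qed.

Lemma loc_eqv_sym : symmetric loc_eqv.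
Proof. by move=> x y; apply/asboolP/asboolP => -[k Hk]; exists k. Qed.

Lemma loc_eqv_trans : transitive loc_eqv.
Proof.
move=> [b n] [a m] [c p] /asboolP/= [k Hk] /asboolP/= [l Hl].
apply/asboolP; exists (k + l + n)%N => /=; rewrite !exprD.
transitivity (s ^+ l * s ^+ p * (s ^+ k * (a * s ^+ n))); first by ring.
rewrite Hk; transitivity (s ^+ k * s ^+ m * (s ^+ l * (b * s ^+ p))).
  by ring.
by rewrite Hl; ring.
Qed.

Canonical loc_equiv := EquivRel loc_eqv loc_eqv_refl loc_eqv_sym loc_eqv_trans.

Definition loc : Type := {eq_quot loc_eqv}.
HB.instance Definition _ := Choice.on loc.

Definition frac (a : R) (n : nat) : loc := \pi_{eq_quot loc_eqv} (a, n).
Local Notation rep := (@repr _ {eq_quot loc_eqv}).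

Lemma fracP (a b : R) (m n : nat) :
  frac a m = frac b n <->
  exists k, s ^+ k * (a * s ^+ n) = s ^+ k * (b * s ^+ m).
Proof.
split=> [/eqmodP/asboolP //|H]; apply/eqmodP; exact/asboolP.
Qed.

Lemma frac_rep (x : loc) : frac (rep x).1 (rep x).2 = x.
Proof. by rewrite /frac -surjective_pairing; exact: reprK. Qed.

Lemma frac_surj (x : loc) : exists a n, frac a n = x.
Proof. by exists (rep x).1, (rep x).2; exact: frac_rep. Qed.

Definition loc_opp (x : loc) : loc := frac (- (rep x).1) (rep x).2.
Definition loc_add (x y : loc) : loc :=
  frac ((rep x).1 * s ^+ (rep y).2 + (rep y).1 * s ^+ (rep x).2)
       ((rep x).2 + (rep y).2).
Definition loc_mul (x y : loc) : loc :=
  frac ((rep x).1 * (rep y).1) ((rep x).2 + (rep y).2).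

Lemma fracN a n : loc_opp (frac a n) = frac (- a) n.
Proof.
have /fracP [k /= Hk] := frac_rep (frac a n); apply/fracP; exists k.
by rewrite !mulNr !mulrN Hk.
Qed.

Lemma fracD a m b n :
  loc_add (frac a m) (frac b n) = frac (a * s ^+ n + b * s ^+ m) (m + n).
Proof.
have /fracP [k /= Hk] := frac_rep (frac a m).
have /fracP [l /= Hl] := frac_rep (frac b n).
rewrite /loc_add.
move: (rep (frac a m)) (rep (frac b n)) Hk Hl => -[a' m'] [b' n'] /= Hk Hl.
apply/fracP; exists (k + l)%N; rewrite !exprD.
transitivity (s ^+ l * s ^+ n * s ^+ n' * (s ^+ k * (a' * s ^+ m)) +
              s ^+ k * s ^+ m * s ^+ m' * (s ^+ l * (b' * s ^+ n))).
  by ring.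
by rewrite Hk Hl; ring.
Qed.

Lemma fracM a m b n :
  loc_mul (frac a m) (frac b n) = frac (a * b) (m + n).
Proof.
have /fracP [k /= Hk] := frac_rep (frac a m).
have /fracP [l /= Hl] := frac_rep (frac b n).
rewrite /loc_mul.
move: (rep (frac a m)) (rep (frac b n)) Hk Hl => -[a' m'] [b' n'] /= Hk Hl.
apply/fracP; exists (k + l)%N; rewrite !exprD.
transitivity ((s ^+ k * (a' * s ^+ m)) * (s ^+ l * (b' * s ^+ n))).
  by ring.
by rewrite Hk Hl; ring.
Qed.

Lemma frac_eq a m b n : a * s ^+ n = b * s ^+ m -> frac a m = frac b n.
Proof. by move=> H; apply/fracP; exists 0%N; rewrite H. Qed.

Lemma loc_addA : associative loc_add.
Proof.
move=> x y z; have [a [m <-]] := frac_surj x; have [b [n <-]] := frac_surj y.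
have [c [p <-]] := frac_surj z; rewrite !fracD.
by apply: frac_eq; rewrite !exprD; ring.
Qed.
Lemma loc_addC : commutative loc_add.
Proof.
move=> x y; have [a [m <-]] := frac_surj x; have [b [n <-]] := frac_surj y.
by rewrite !fracD; apply: frac_eq; rewrite !exprD; ring.
Qed.
Lemma loc_add0 : left_id (frac 0 0) loc_add.
Proof.
move=> x; have [a [m <-]] := frac_surj x; rewrite fracD.
by apply: frac_eq; rewrite add0n expr0; ring.
Qed.
Lemma loc_addN : left_inverse (frac 0 0) loc_opp loc_add.
Proof.
move=> x; have [a [m <-]] := frac_surj x; rewrite fracN fracD.
by apply: frac_eq; rewrite expr0; ring.
Qed.

HB.instance Definition _ := GRing.isZmodule.Build loc
  loc_addA loc_addC loc_add0 loc_addN.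

Lemma loc_mulA : associative loc_mul.
Proof.
move=> x y z; have [a [m <-]] := frac_surj x; have [b [n <-]] := frac_surj y.
have [c [p <-]] := frac_surj z; rewrite !fracM.
by apply: frac_eq; rewrite !exprD; ring.
Qed.
Lemma loc_mulC : commutative loc_mul.
Proof.
move=> x y; have [a [m <-]] := frac_surj x; have [b [n <-]] := frac_surj y.
by rewrite !fracM; apply: frac_eq; rewrite !exprD; ring.
Qed.
Lemma loc_mul1 : left_id (frac 1 0) loc_mul.
Proof.
move=> x; have [a [m <-]] := frac_surj x; rewrite fracM.
by apply: frac_eq; rewrite add0n; ring.
Qed.
Lemma loc_mul1r : right_id (frac 1 0) loc_mul.
Proof. by move=> x; rewrite loc_mulC loc_mul1. Qed.
Lemma loc_mulDl : left_distributive loc_mul loc_add.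
Proof.
move=> x y z; have [a [m <-]] := frac_surj x; have [b [n <-]] := frac_surj y.
have [c [p <-]] := frac_surj z; rewrite !(fracM, fracD).
by apply: frac_eq; rewrite !exprD; ring.
Qed.
Lemma loc_mulDr : right_distributive loc_mul loc_add.
Proof. by move=> x y z; rewrite !(loc_mulC x) loc_mulDl. Qed.

HB.instance Definition _ := GRing.Zmodule_isPzRing.Build loc
  loc_mulA loc_mul1 loc_mul1r loc_mulDl loc_mulDr.
HB.instance Definition _ := GRing.PzRing_hasCommutativeMul.Build loc loc_mulC.

Definition to_loc (a : R) : loc := frac a 0.

Lemma to_locB : {morph to_loc : x y / x - y}.
Proof.
move=> x y; rewrite /to_loc.
have -> : - frac y 0 = frac (- y) 0 by exact: fracN.
have -> : frac x 0 + frac (- y) 0 = frac (x * s ^+ 0 + - y * s ^+ 0) (0 + 0).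
  exact: fracD.
by rewrite expr0 !mulr1.
Qed.

Lemma to_locM : {morph to_loc : x y / x * y}.
Proof. by move=> x y; apply/esym; exact: fracM. Qed.

HB.instance Definition _ := GRing.isZmodMorphism.Build R loc to_loc to_locB.
HB.instance Definition _ :=
  GRing.isMonoidMorphism.Build R loc to_loc (conj erefl to_locM).

Section Lift.
Variables (S : comPzRingType) (f : {rmorphism R -> S}) (u : S).

Definition loc_lift of f s * u = 1 : loc -> S :=
  fun x => f (rep x).1 * u ^+ (rep x).2.

Hypothesis fsu : f s * u = 1.

Lemma loc_lift_frac (a : R) (n : nat) : loc_lift fsu (frac a n) = f a * u ^+ n.
Proof.
have /fracP [k /= Hk] := frac_rep (frac a n); rewrite /loc_lift.
move: (rep (frac a n)) Hk => -[a' n'] /= Hk.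
have fu p : f s ^+ p * u ^+ p = 1 by rewrite -exprMn fsu expr1n.
have := congr1 f Hk; rewrite !rmorphM !rmorphXn /= => Hf.
transitivity (f s ^+ k * (f a' * f s ^+ n) * u ^+ k * u ^+ n * u ^+ n').
  transitivity ((f s ^+ k * u ^+ k) * (f s ^+ n * u ^+ n) * (f a' * u ^+ n')).
    by rewrite !fu !mul1r.
  by ring.
rewrite Hf.
transitivity ((f s ^+ k * u ^+ k) * (f s ^+ n' * u ^+ n') * (f a * u ^+ n)).
  by ring.
by rewrite !fu !mul1r.
Qed.

Lemma loc_lift_to_loc (a : R) : loc_lift fsu (to_loc a) = f a.
Proof. by rewrite loc_lift_frac mulr1. Qed.

Lemma loc_liftB : {morph loc_lift fsu : x y / x - y}.
Proof.
move=> x y; have [a [m <-]] := frac_surj x; have [b [n <-]] := frac_surj y.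
have -> : - frac b n = frac (- b) n by exact: fracN.
have -> : frac a m + frac (- b) n = frac (a * s ^+ n + - b * s ^+ m) (m + n).
  exact: fracD.
rewrite !loc_lift_frac rmorphD !rmorphM rmorphN !rmorphXn exprD /=.
have fu p : f s ^+ p * u ^+ p = 1 by rewrite -exprMn fsu expr1n.
transitivity ((f s ^+ n * u ^+ n) * (f a * u ^+ m) -
              (f s ^+ m * u ^+ m) * (f b * u ^+ n)); first by ring.
by rewrite !fu !mul1r.
Qed.

Lemma loc_liftM : monoid_morphism (loc_lift fsu).
Proof.
split=> [|x y]; first by rewrite -[1]/(to_loc 1) loc_lift_to_loc rmorph1.
have [a [m <-]] := frac_surj x; have [b [n <-]] := frac_surj y.
have -> : frac a m * frac b n = frac (a * b) (m + n) by exact: fracM.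
by rewrite !loc_lift_frac rmorphM exprD /=; ring.
Qed.

HB.instance Definition _ :=
  GRing.isZmodMorphism.Build loc S (loc_lift fsu) loc_liftB.
HB.instance Definition _ :=
  GRing.isMonoidMorphism.Build loc S (loc_lift fsu) loc_liftM.

End Lift.
End Localization.

(* The ring Z[1/n], as a subring of the rationals (for n > 0). *)
Section Zinv.
Variable n : nat.

Definition Zinv_pred : {pred rat} :=
  fun x => `[< exists k : nat, x * n%:R ^+ k \is a Num.int >].

Lemma Zinv_subring : subring_closed Zinv_pred.
Proof.
split=> [|x y /asboolP [k Hk] /asboolP [l Hl]|x y /asboolP [k Hk] /asboolP [l Hl]];
  apply/asboolP.
- by exists 0%N; rewrite mulr1 rpred1.
- exists (k + l)%N; rewrite exprD.
  have -> : (x - y) * (n%:R ^+ k * n%:R ^+ l) =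
    (x * n%:R ^+ k) * n%:R ^+ l - (y * n%:R ^+ l) * n%:R ^+ k by ring.
  by rewrite rpredB // rpredM // rpredX // rpred_nat.
exists (k + l)%N; rewrite exprD.
have -> : x * y * (n%:R ^+ k * n%:R ^+ l) =
  (x * n%:R ^+ k) * (y * n%:R ^+ l) by ring.
exact: rpredM.
Qed.

HB.instance Definition _ := GRing.isSubringClosed.Build rat Zinv_pred Zinv_subring.

Record Zinv : Type := MkZinv { Zinv_val : rat; _ : Zinv_val \in Zinv_pred }.
HB.instance Definition _ := [isSub for Zinv_val].
HB.instance Definition _ := [Choice of Zinv by <:].
HB.instance Definition _ := [SubChoice_isSubComNzRing of Zinv by <:].

Lemma Zinv_inv_subproof : (n%:R)^-1 \in Zinv_pred.
Proof.
apply/asboolP; exists 1%N; rewrite expr1.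
have [->|n0] := eqVneq n 0%N; first by rewrite mulr0 rpred0.
by rewrite mulVf ?rpred1 // pnatr_eq0.
Qed.

Definition Zinv_inv : Zinv := MkZinv Zinv_inv_subproof.

Lemma Zinv_mulV : (0 < n)%N -> n%:R * Zinv_inv = 1.
Proof.
move=> n0; apply: val_inj; rewrite rmorphM rmorph_nat /= divff ?pnatr_eq0 //.
by rewrite -lt0n.
Qed.

End Zinv.

Section ZinvIncl.
Variables m n : nat.

Lemma Zinv_incl_subproof (x : Zinv n) : val x \in Zinv_pred (m * n).
Proof.
case: x => x /= /asboolP [k Hk]; apply/asboolP; exists k.
have -> : x * (m * n)%:R ^+ k = (x * n%:R ^+ k) * m%:R ^+ k.
  by rewrite natrM exprMn; ring.
by rewrite rpredM // rpredX // rpred_nat.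
Qed.

Definition Zinv_incl (x : Zinv n) : Zinv (m * n) := MkZinv (Zinv_incl_subproof x).

Lemma Zinv_inclB : {morph Zinv_incl : x y / x - y}.
Proof. by move=> x y; exact: val_inj. Qed.

Lemma Zinv_inclM : monoid_morphism Zinv_incl.
Proof. by split=> [|x y]; exact: val_inj. Qed.

HB.instance Definition _ :=
  GRing.isZmodMorphism.Build (Zinv n) (Zinv (m * n)) Zinv_incl Zinv_inclB.
HB.instance Definition _ :=
  GRing.isMonoidMorphism.Build (Zinv n) (Zinv (m * n)) Zinv_incl Zinv_inclM.

End ZinvIncl.

(* Bilinear form with Gram matrix B on row vectors. *)
Definition mxform (F : fieldType) (n : nat) (B : 'M[F]_n) (x y : 'rV[F]_n) : F :=
  (x *m B *m y^T) 0 0.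

Definition embedding (F : fieldType) (U V : lmodType F)
    (bU : U -> U -> F) (bV : V -> V -> F) (f : U -> V) : Prop :=
  [/\ linear f, injective f & forall x y, bV (f x) (f y) = bU x y].

(* Two polynomials a, b stand for the vector
   \sum_i (a`_i e_(i+1) + b`_i f_(i+1)). *)
Definition Vinf (F : finFieldType) : Type := ({poly F} * {poly F})%type.
HB.instance Definition _ (F : finFieldType) := GRing.Lmodule.on (Vinf F).

Section InfiniteOrthogonal.
Variable F : finFieldType.

Definition Vinf_form (x y : Vinf F) : F :=
  \sum_(i < maxn (size x.1) (size x.2)) (x.1`_i * y.2`_i + x.2`_i * y.1`_i).

Definition e_ (i : nat) : Vinf F := ('X^i, 0).
Definition f_ (i : nat) : Vinf F := (0, 'X^i).

Lemma Vinf_form_ee i j : Vinf_form (e_ i) (e_ j) = 0.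
Proof. by apply: big1 => k _; rewrite /= !coef0 mulr0 mul0r addr0. Qed.

Lemma Vinf_form_ff i j : Vinf_form (f_ i) (f_ j) = 0.
Proof. by apply: big1 => k _; rewrite /= !coef0 mulr0 mul0r addr0. Qed.

Lemma Vinf_form_ef i j : Vinf_form (e_ i) (f_ j) = (i == j)%:R.
Proof.
rewrite /Vinf_form /= size_polyXn size_poly0 maxn0 big_ord_recr /= big1.
  by rewrite !coefXn eqxx !coef0 mul1r mul0r addr0 add0r eq_sym.
move=> k _; rewrite !coefXn !coef0 !mul0r addr0.
by rewrite (_ : (k == i :> nat) = false) ?mul0r // ltn_eqF.
Qed.

(* The group G of form-preserving linear automorphisms. *)
Record Orth : Type := MkOrth {
  Orth_fun :> Vinf F -> Vinf F;
  Orth_linear : linear Orth_fun;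
  Orth_bij : bijective Orth_fun;
  Orth_form : forall x y, Vinf_form (Orth_fun x) (Orth_fun y) = Vinf_form x y
}.

Lemma Orth_ext (g h : Orth) : g =1 h -> g = h.
Proof.
case: g h => [g lg bg fg] [h lh bh fh] /= /funext gh.
by subst h; congr MkOrth; exact: Prop_irrelevance.
Qed.

HB.instance Definition _ := gen_eqMixin Orth.
HB.instance Definition _ := gen_choiceMixin Orth.

Definition Orth_one : Orth :=
  MkOrth (fun _ _ _ => erefl) (Bijective (frefl id) (frefl id))
    (fun _ _ => erefl).

Lemma Orth_mul_linear (g h : Orth) : linear (g \o h).
Proof. by move=> a x y; rewrite /= (Orth_linear h) (Orth_linear g). Qed.

Lemma Orth_mul_form (g h : Orth) x y :
  Vinf_form ((g \o h) x) ((g \o h) y) = Vinf_form x y.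
Proof. by rewrite /= !Orth_form. Qed.

Definition Orth_mul (g h : Orth) : Orth :=
  MkOrth (Orth_mul_linear g h) (bij_comp (Orth_bij g) (Orth_bij h))
    (Orth_mul_form g h).

Lemma Orth_inv_ex (g : Orth) :
  exists h : Orth, (forall x, h (g x) = x) /\ (forall x, g (h x) = x).
Proof.
have [h gK hK] := Orth_bij g.
have lh : linear h.
  by move=> a x y; apply: (bij_inj (Orth_bij g)); rewrite (Orth_linear g) !hK.
have fh x y : Vinf_form (h x) (h y) = Vinf_form x y.
  by rewrite -(Orth_form g) !hK.
by exists (MkOrth lh (Bijective hK gK) fh).
Qed.

Definition Orth_inv (g : Orth) : Orth := projT1 (cid (Orth_inv_ex g)).
Lemma Orth_invK (g : Orth) x : Orth_inv g (g x) = x.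
Proof. by rewrite /Orth_inv; case: cid => h []. Qed.
Lemma Orth_invKV (g : Orth) x : g (Orth_inv g x) = x.
Proof. by rewrite /Orth_inv; case: cid => h []. Qed.

Lemma Orth_mulA : associative Orth_mul.
Proof. by move=> g h k; apply: Orth_ext. Qed.
Lemma Orth_mul1 : left_id Orth_one Orth_mul.
Proof. by move=> g; apply: Orth_ext. Qed.
Lemma Orth_mul1r : right_id Orth_one Orth_mul.
Proof. by move=> g; apply: Orth_ext. Qed.
Lemma Orth_mulV : left_inverse Orth_one Orth_inv Orth_mul.
Proof. by move=> g; apply: Orth_ext => x /=; rewrite Orth_invK. Qed.
Lemma Orth_mulVr : right_inverse Orth_one Orth_inv Orth_mul.
Proof. by move=> g; apply: Orth_ext => x /=; rewrite Orth_invKV. Qed.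

HB.instance Definition _ := isGroup.Build Orth
  Orth_mulA Orth_mul1 Orth_mul1r Orth_mulV Orth_mulVr.

(* Carriers are taken in Set, so that all these G-sets form a type and the ring
   they generate is a small one. Transitive V-smooth G-sets are countable, hence
   each of them has an isomorphic copy with carrier in Set. *)
Record gset : Type := MkGset {
  gset_car :> Set;
  gact : Orth -> gset_car -> gset_car;
  gact1 : forall x, gact 1%g x = x;
  gactM : forall g h x, gact (g * h)%g x = gact g (gact h x)
}.

Definition gtransitive (X : gset) : Prop :=
  exists x : X, forall y : X, exists g, gact g x = y.

Definition Vsmooth (X : gset) : Prop :=
  forall x : X, exists A : seq (Vinf F),
    forall g, gact g x = x <-> (forall v, v \in A -> g v = v).

Record tsset : Type := MkTsset {
  tsset_gset :> gset;
  tsset_trans : gtransitive tsset_gset;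
  tsset_smooth : Vsmooth tsset_gset
}.

Record gmap (Y X : gset) : Type := MkGmap {
  gmap_fun :> Y -> X;
  gmapP : forall g y, gmap_fun (gact g y) = gact g (gmap_fun y)
}.

Lemma gmap_compP (Z Y X : gset) (f : gmap Y X) (g : gmap Z Y) h z :
  (f \o g) (gact h z) = gact h ((f \o g) z).
Proof. by rewrite /= !gmapP. Qed.

Definition gmap_comp (Z Y X : gset) (f : gmap Y X) (g : gmap Z Y) : gmap Z X :=
  MkGmap (gmap_compP f g).

(* The maps (p i, f' i) identify the disjoint union of the transitive G-sets
   Y' i with the fibre product of f and h: the Y' i are its orbits. *)
Definition orbit_decomposition (Y X X' : tsset) (f : gmap Y X) (h : gmap X' X)
    (n : nat) (Y' : 'I_n -> tsset) (p : forall i, gmap (Y' i) Y)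
    (f' : forall i, gmap (Y' i) X') : Prop :=
  (forall i z, f (p i z) = h (f' i z)) /\
  (forall y x', f y = h x' ->
     exists! iz : {i : 'I_n & Y' i},
       p (tag iz) (tagged iz) = y /\ f' (tag iz) (tagged iz) = x').

Record symbol : Type := MkSymbol {
  sym_dom : tsset;
  sym_cod : tsset;
  sym_map : gmap sym_dom sym_cod
}.
HB.instance Definition _ := gen_eqMixin symbol.
HB.instance Definition _ := gen_choiceMixin symbol.

Definition free_symbols : comNzRingType := {malg int[{cmonom symbol}]}.

Definition symb (Y X : tsset) (f : gmap Y X) : free_symbols :=
  << ucm (MkSymbol f) >>.

Inductive Theta_rel : free_symbols -> Prop :=
| Theta_rel_iso (Y X : tsset) (f : gmap Y X) :
    bijective f -> Theta_rel (symb f - 1)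
| Theta_rel_comp (Z Y X : tsset) (f : gmap Y X) (g : gmap Z Y) :
    Theta_rel (symb (gmap_comp f g) - symb f * symb g)
| Theta_rel_base_change (Y X X' : tsset) (f : gmap Y X) (h : gmap X' X)
    (n : nat) (Y' : 'I_n -> tsset) (p : forall i, gmap (Y' i) Y)
    (f' : forall i, gmap (Y' i) X') :
    orbit_decomposition f h p f' ->
    Theta_rel (symb f - \sum_(i < n) symb (f' i)).

Definition Theta : comPzRingType := ring_quot Theta_rel.

Definition Tclass (Y X : tsset) (f : gmap Y X) : Theta :=
  rq Theta_rel (symb f).

(* a identifies the G-set X with the set of embeddings into Vinf of the
   quadratic space with Gram matrix B. *)
Definition models (k : nat) (B : 'M[F]_k) (X : gset)
    (a : X -> 'rV[F]_k -> Vinf F) : Prop :=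
  [/\ injective a,
      forall h, embedding (mxform B) Vinf_form h <-> exists x, a x = h
    & forall g x, a (gact g x) = g \o a x].

(* f is isomorphic to the restriction map X(W) -> X(V) along i : V -> W, for V
   and W with Gram matrices BV and BW. *)
Definition restriction_along (k m : nat) (BV : 'M[F]_k) (BW : 'M[F]_m)
    (i : 'M[F]_(k, m)) (Y X : gset) (f : gmap Y X) : Prop :=
  exists (b : Y -> 'rV[F]_m -> Vinf F) (a : X -> 'rV[F]_k -> Vinf F),
    [/\ models BW b, models BV a & forall y, a (f y) = b y \o mulmxr i].

Definition mdisc (n : nat) (B : 'M[F]_n) : F := (-1) ^+ n./2 * \det B.

(* B is a Gram matrix of the space V_{n,delta}. *)
Definition nondegenerate_space (n : nat) (delta : F) (B : 'M[F]_n) : Prop :=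
  [/\ B^T = B, B \in unitmx & exists2 c : F, c != 0 & mdisc B = delta * c ^+ 2].

(* The number of extensions along i : V -> W of an embedding j : V -> E to an
   embedding W -> E. *)
Definition extension_count (k m n : nat) (BW : 'M[F]_m) (BE : 'M[F]_n)
    (i : 'M[F]_(k, m)) (j : 'M[F]_(k, n)) : nat :=
  #|[set M : 'M[F]_(m, n) |
      `[< embedding (mxform BW) (mxform BE) (mulmxr M) >] && (i *m M == j)]|.

(* phi is the counting measure phi^even (par = false) or phi^odd (par = true):
   E_r, with Gram matrix BE, has dimension 2r or 2r + 1 accordingly. *)
Definition counting_measure (par : bool)
    (phi : {rmorphism Theta -> {poly Zinv #|F|}}) : Prop :=
  forall (Y X : tsset) (f : gmap Y X)
    (k m : nat) (BV : 'M[F]_k) (BW : 'M[F]_m) (i : 'M[F]_(k, m)),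
    BV^T = BV -> BW^T = BW ->
    embedding (mxform BV) (mxform BW) (mulmxr i) ->
    restriction_along BV BW i f ->
    exists r0 : nat, forall r : nat, (r0 <= r)%N ->
      forall (BE : 'M[F]_(r.*2 + par)) (j : 'M[F]_(k, r.*2 + par)),
        nondegenerate_space 1 BE ->
        embedding (mxform BV) (mxform BE) (mulmxr j) ->
        (phi (Tclass f)).[#|F|%:R ^+ r] = (extension_count BW BE i j)%:R.

Definition counting_coeff : comNzRingType := Zinv (2 * #|F|).

Definition counting_pair (phi_e phi_o : {rmorphism Theta -> {poly Zinv #|F|}})
    (x : Theta) : {poly counting_coeff} * {poly counting_coeff} :=
  (map_poly (@Zinv_incl 2 #|F|) (phi_e x), map_poly (@Zinv_incl 2 #|F|) (phi_o x)).

Section CountingPair.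
Variables phi_e phi_o : {rmorphism Theta -> {poly Zinv #|F|}}.

Lemma counting_pairB :
  {morph counting_pair phi_e phi_o : x y / x - y >-> x - y}.
Proof. by move=> x y; rewrite /counting_pair !rmorphB. Qed.

Lemma counting_pairM : monoid_morphism (counting_pair phi_e phi_o).
Proof. by split=> [|x y]; rewrite /counting_pair ?rmorph1 ?rmorphM. Qed.

HB.instance Definition _ := GRing.isZmodMorphism.Build Theta
  ({poly counting_coeff} * {poly counting_coeff})%type
  (counting_pair phi_e phi_o) counting_pairB.
HB.instance Definition _ := GRing.isMonoidMorphism.Build Theta
  ({poly counting_coeff} * {poly counting_coeff})%type
  (counting_pair phi_e phi_o) counting_pairM.

Lemma counting_pair_unit :
  counting_pair phi_e phi_o (2 * #|F|)%:R *
    ((Zinv_inv (2 * #|F|))%:P, (Zinv_inv (2 * #|F|))%:P) = 1.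
Proof.
have n0 : (0 < 2 * #|F|)%N by rewrite muln_gt0 /=; apply/card_gt0P; exists 0.
rewrite rmorph_nat; apply: injective_projections => /=.
  by rewrite -[_.1]/(fst _) (rmorph_nat fst) -polyC_natr -polyCM Zinv_mulV.
by rewrite -[_.2]/(snd _) (rmorph_nat snd) -polyC_natr -polyCM Zinv_mulV.
Qed.

(* The map phi^even x phi^odd on Theta[1/2q]. *)
Definition counting_loc :
    loc ((2 * #|F|)%:R : Theta) -> {poly counting_coeff} * {poly counting_coeff} :=
  loc_lift counting_pair_unit.

HB.instance Definition _ := GRing.RMorphism.on counting_loc.

End CountingPair.

(* Z[1/2q][t, t'] / (t t'), with t' = 'X and t = 'X%:P. *)
Definition node_ring : comPzRingType :=
  ring_quot (fun x : {poly {poly counting_coeff}} => x = 'X * ('X)%:P).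

End InfiniteOrthogonal.

(* Main.v *)
From HB Require Import structures.
From mathcomp Require Import all_boot all_order all_algebra finfield finmap.
From mathcomp Require Import boolp monalg ring zify.
Require Import Defs.

(** Write q for the cardinality of F, G(A) for the pointwise stabiliser of a
    finite tuple A of vectors, H_n for the span of the first n hyperbolic
    pairs of the basis, and x_d for the class of the set of nonzero vectors of
    norm d ([nzvecs 0 d]). The proof exhibits two elements of Theta which have
    product 0 and generate Theta[1/2q] over Z[1/2q], and follows them through
    the two counting measures.

    Upper bound on Theta. A transitive smooth G-set is an orbit G/G(A), so every
    class is a product of classes of one-vector extensions
    G/G(b :: A) -> G/G(A) ([Tclass_tau], [tau_comp]). By Witt extension
    ([witt_full]), a G(A)-orbit of a vector outside the span of A is described
    by its norm and its pairings with A. Pulling a one-vector extension back to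
    G/G(H_n), with A in H_n, therefore splits it according to the projection u
    of the new vector to H_n; what remains is a vector of prescribed norm
    orthogonal to H_n ([tau_step]). The norm is almost equidistributed on H_n
    ([hyp_sum]), and this lets the classes of vectors orthogonal to H_n be
    solved in terms of the x_d, at the cost of a power of q ([vecs_inv]). Hence
    the x_d generate Theta up to division by q ([Theta_generated]). Since x_d
    depends on d only up to squares, three generators are left: x_0, x_1 and
    x_eps for a nonsquare eps. Building a plane from either of two basis vectors
    yields relations between them ([Phi_rel]). Put s = (x_1 + x_eps) / 2,
    o = (x_1 - x_eps) / 2 and e = x_0 + 1 - s. Evaluating quadratic character
    sums, three well chosen planes give e o = 0 and
    q s = e^2 - e + q o^2 ([node_rels]). Every element of Theta[1/2q] is thus,
    up to a power of 2q, of the form f(2e) + g(2o) with f and g integral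
    polynomials ([node_of_Theta]).

    Existence of the counting measures. Inside V the space E_r is the set of
    vectors fixed by G(E_r), so embeddings into E_r are the points of a smooth
    G-set fixed by G(E_r). Let nu_r(f) count such points in a fibre of f over a
    fixed point. Witt extension inside E_r ([witt_Esp]) makes this independent
    of the fibre for large r, and then nu_r respects the relations of Theta
    ([nu_iso], [nu_comp], [nu_base_change]). That nu_r is a polynomial in q^r
    has to be checked only on the generators x_d, where it is the number of
    points of a sphere in E_r ([card_sphere], [evcount_poly]). Spaces of
    modified discriminant 1 are all isometric to E_r ([classify_Esp]), which
    identifies nu_r with the required extension counts ([extensions_counted]).

    Conclusion. A counting measure is determined on the x_d by the sphere counts
    ([counting_nzvecs]), and the two measures together map 2e to (2t, 0) and 2o
    to (0, 2t) ([pair_ge], [pair_go]). So f(2e) + g(2o) goes to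
    (f(2t) + g(0), f(0) + g(2t)): this vanishes only if f and g are opposite
    constants ([CL_inj]), and the image consists of the pairs with equal
    values at 0 ([image_CL]). Finally (f, g) |-> f(t) + g(t') - f(0) identifies
    these pairs with the coordinate ring of the node t t' = 0
    ([node_psi_bij]). *)

Set Implicit Arguments.
Unset Strict Implicit.
Unset Printing Implicit Defensive.

Import Order.TTheory GRing.Theory Num.Theory.
Local Open Scope ring_scope.

(** * The form, subspaces and Witt extension *)

Section Form.
Variable F : finFieldType.
Implicit Types (x y z v w e f : Vinf F) (c : F).
Local Notation B := (@Vinf_form F).

Lemma formE N x y : (size x.1 <= N)%N -> (size x.2 <= N)%N ->
  B x y = \sum_(i < N) (x.1`_i * y.2`_i + x.2`_i * y.1`_i).
Proof.
move=> h1 h2; rewrite /Vinf_form.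
have h : (maxn (size x.1) (size x.2) <= N)%N by rewrite geq_max h1.
rewrite (big_ord_widen N (fun i => x.1`_i * y.2`_i + x.2`_i * y.1`_i) h).
rewrite big_mkcond /=; apply: eq_bigr => i _; case: ltnP => //.
rewrite geq_max => /andP[i1 i2].
by rewrite (nth_default _ i1) (nth_default _ i2) !mul0r addr0.
Qed.

Lemma formC x y : B x y = B y x.
Proof.
set N := maxn (maxn (size x.1) (size x.2)) (maxn (size y.1) (size y.2)).
rewrite !(@formE N) /N ?leq_max ?leqnn ?orbT //.
by apply: eq_bigr => i _; ring.
Qed.

Lemma formDr x y z : B x (y + z) = B x y + B x z.
Proof.
by rewrite /Vinf_form -big_split; apply: eq_bigr => i _ /=; rewrite !coefD; ring.
Qed.
Lemma formZr c x y : B x (c *: y) = c * B x y.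
Proof.
by rewrite /Vinf_form mulr_sumr; apply: eq_bigr => i _ /=; rewrite !coefZ; ring.
Qed.
Lemma formDl x y z : B (x + y) z = B x z + B y z.
Proof. by rewrite formC formDr !(formC z). Qed.
Lemma formZl c x y : B (c *: x) y = c * B x y.
Proof. by rewrite formC formZr formC. Qed.
Lemma formNr x y : B x (- y) = - B x y.
Proof. by rewrite -scaleN1r formZr mulN1r. Qed.
Lemma formNl x y : B (- x) y = - B x y.
Proof. by rewrite formC formNr formC. Qed.
Lemma form0r x : B x 0 = 0.
Proof. by rewrite -(scale0r (0 : Vinf F)) formZr mul0r. Qed.
Lemma form0l x : B 0 x = 0.
Proof. by rewrite formC form0r. Qed.

Definition formL := (formDl, formDr, formNl, formNr, formZl, formZr, form0l, form0r).

Lemma form_e x i : B x (e_ F i) = x.2`_i.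
Proof.
rewrite (@formE (maxn i.+1 (maxn (size x.1) (size x.2)))) ?leq_max ?leqnn ?orbT //=.
rewrite (bigD1 (Ordinal (leq_maxl i.+1 _) : 'I_(maxn i.+1 _))) //= big1.
  by rewrite coef0 coefXn eqxx /= mulr1n; ring.
by move=> j /eqP ji; rewrite coef0 coefXn; case: eqP => [h|_]; [case: ji; apply: val_inj|rewrite /= mulr0n; ring].
Qed.

Lemma form_f x i : B x (f_ F i) = x.1`_i.
Proof.
rewrite (@formE (maxn i.+1 (maxn (size x.1) (size x.2)))) ?leq_max ?leqnn ?orbT //=.
rewrite (bigD1 (Ordinal (leq_maxl i.+1 _) : 'I_(maxn i.+1 _))) //= big1.
  by rewrite coef0 coefXn eqxx /= mulr1n; ring.
by move=> j /eqP ji; rewrite coef0 coefXn; case: eqP => [h|_]; [case: ji; apply: val_inj|rewrite /= mulr0n; ring].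
Qed.

Lemma Vinf_eqP x y : (forall i, x.1`_i = y.1`_i) -> (forall i, x.2`_i = y.2`_i) -> x = y.
Proof.
move=> h1 h2; apply: injective_projections; apply/polyP; [exact: h1|exact: h2].
Qed.

(** The Siegel transformation of an isotropic e and a vector w orthogonal to
    e: a unipotent isometry that fixes e and every vector orthogonal to both e
    and w. These are the only isometries that have to be written down. *)
Definition eichler e w x : Vinf F :=
  x + B x e *: w - B x w *: e - (B w w / 2 * B x e) *: e.

Ltac vring := apply: Vinf_eqP => ? /=; rewrite ?(coefD, coefN, coefZ, coef0); ring.

Lemma eichler_linear e w : linear (eichler e w).
Proof. by move=> a x y; rewrite /eichler !formL; vring. Qed.

Hypothesis odd_q : odd #|F|.

Lemma two_neq0 : 2%:R != 0 :> F.
Proof.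
apply/negP => /eqP h2.
have ch2 : 2%N \in [pchar F] by rewrite inE /= h2 eqxx.
have := card_pprimeChar ch2; move: odd_q.
case: logn => [_ c1|k]; last by move=> + e; rewrite e oddX.
by have := finNzRing_gt1 F; rewrite c1.
Qed.

Lemma halfD c : c / 2 + c / 2 = c.
Proof. by field; exact: two_neq0. Qed.

Lemma eichlerK e w : B e e = 0 -> B w e = 0 ->
  cancel (eichler e w) (eichler e (- w)).
Proof.
move=> ee we x; rewrite /eichler !formL ee we (formC e w) we.
by rewrite [- - B w w]opprK; have := halfD (B w w); move: (B w w / 2) => h <-; vring.
Qed.

Lemma eichler_form e w : B e e = 0 -> B w e = 0 ->
  forall x y, B (eichler e w x) (eichler e w y) = B x y.
Proof.
move=> ee we x y; rewrite /eichler !formL ee we (formC e w) we.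
rewrite (formC e y) (formC w y).
by have := halfD (B w w); move: (B w w / 2) => h <-; ring.
Qed.

Lemma eichler_ex e w : B e e = 0 -> B w e = 0 ->
  exists g : Orth F, g =1 eichler e w.
Proof.
move=> ee we; have we' : B (- w) e = 0 by rewrite formL we oppr0.
have K := eichlerK ee we; have := eichlerK ee we'; rewrite opprK => K'.
by exists (MkOrth (@eichler_linear e w) (Bijective K K') (eichler_form ee we)).
Qed.

Implicit Types (a b : Vinf F) (E : Vinf F -> Prop) (A S : seq (Vinf F)) (g k : Orth F).

Definition lin_closed E := E 0 /\ forall (c : F) x y, E x -> E y -> E (c *: x + y).
Definition nondeg E := forall v, E v -> v <> 0 -> exists2 w, E w & B v w = 1.
Definition stable E g := forall x, E (g x) <-> E x.

Lemma linD E x y : lin_closed E -> E x -> E y -> E (x + y).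
Proof. by move=> [_ h] Ex Ey; rewrite -[x]scale1r; apply: h. Qed.
Lemma linZ E c x : lin_closed E -> E x -> E (c *: x).
Proof. by move=> [h0 h] Ex; rewrite -[_ *: _]addr0; apply: h. Qed.
Lemma linB E x y : lin_closed E -> E x -> E y -> E (x - y).
Proof. by move=> [_ h] Ex Ey; rewrite addrC -scaleN1r; apply: h. Qed.

Lemma OrthD g x y : g (x + y) = g x + g y.
Proof. by have := Orth_linear g 1 x y; rewrite !scale1r. Qed.
Lemma Orth0 g : g 0 = 0.
Proof. by have := Orth_linear g (-1) 0 0; rewrite !scaleN1r !addNr. Qed.
Lemma OrthZ g c x : g (c *: x) = c *: g x.
Proof. by have := Orth_linear g c x 0; rewrite Orth0 !addr0. Qed.

(** Membership in the span, by recursion: subtracting a suitable multiple of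
    the first vector leads to the span of the others. *)
Fixpoint lspan A (v : Vinf F) : Prop :=
  if A is a :: A' then exists c, lspan A' (v - c *: a) else v = 0.

Lemma lspan_lin A : lin_closed (lspan A).
Proof.
elim: A => [|a A [h0 h]] /=; first by split=> // a x y -> ->; rewrite scaler0 addr0.
split; first by exists 0; rewrite scale0r subr0.
move=> b x y [c hx] [d hy]; exists (b * c + d).
have -> : b *: x + y - (b * c + d) *: a = b *: (x - c *: a) + (y - d *: a) by vring.
exact: h.
Qed.

Lemma lspan_cons A a v : lspan A v -> lspan (a :: A) v.
Proof. by move=> h; exists 0; rewrite scale0r subr0. Qed.

Lemma lspan_mem A a : a \in A -> lspan A a.
Proof.
elim: A => //= b A IH; rewrite inE => /orP[/eqP->|/IH]; last exact: lspan_cons.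
by exists 1; rewrite scale1r subrr; case: (lspan_lin A).
Qed.

Lemma lspan_min E A v : lin_closed E -> (forall a, a \in A -> E a) -> lspan A v -> E v.
Proof.
move=> linE; elim: A v => [|a A IH] v h /=; first by move->; case: linE.
move=> [c hc]; rewrite (_ : v = c *: a + (v - c *: a)); last by vring.
apply: (proj2 linE); first by apply: h; rewrite inE eqxx.
by apply: (IH _ _ hc) => b bA; apply: h; rewrite inE bA orbT.
Qed.

Lemma lspan_perp A v w : (forall a, a \in A -> B a w = 0) -> lspan A v -> B v w = 0.
Proof.
apply: lspan_min; split=> [|a x y hx hy]; first exact: form0l.
by rewrite !formL hx hy mulr0 addr0.
Qed.

Lemma lspan_agree A v g k : (forall a, a \in A -> g a = k a) -> lspan A v -> g v = k v.
Proof.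
apply: lspan_min; split=> [|a x y hx hy]; first by rewrite !Orth0.
by rewrite !OrthD !OrthZ hx hy.
Qed.

Lemma lspan_map g A v : lspan (map g A) (g v) <-> lspan A v.
Proof.
have H g' A' v' : lspan A' v' -> lspan (map g' A') (g' v').
  apply: (@lspan_min (fun v => lspan (map g' A') (g' v))).
    split=> [|a x y hx hy]; first by rewrite Orth0; case: (lspan_lin (map g' A')).
    by rewrite OrthD OrthZ; apply: (proj2 (lspan_lin _)).
  by move=> a aA; apply: lspan_mem; rewrite map_f.
split; last exact: H.
move/(H (Orth_inv g)); rewrite Orth_invK -map_comp.
by rewrite (@eq_map _ _ _ id) ?map_id // => x /=; rewrite Orth_invK.
Qed.

(** Induction on A. If the first vector a of A is not in the span of the
    others, let a' be orthogonal to the others with <a, a'> = 1; a dual vector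
    for v - <v, a'> a is then corrected by a multiple of a' so that it becomes
    orthogonal to a. *)
Lemma dual_vec_ex E A v : lin_closed E -> nondeg E ->
  (forall a, a \in A -> E a) -> E v -> ~ lspan A v ->
  exists w, [/\ E w, forall a, a \in A -> B a w = 0 & B v w = 1].
Proof.
move=> lE nE; elim: A v => [|a A IH] v AE Ev /= nv.
  by have [w Ew vw] := nE v Ev nv; exists w.
have AE' b : b \in A -> E b by move=> bA; apply: AE; rewrite inE bA orbT.
have Ea : E a by apply: AE; rewrite inE eqxx.
have [aA|naA] := pselect (lspan A a).
  have [|w [Ew Aw vw]] := IH v AE' Ev.
    by move=> h; apply: nv; exists 0; rewrite scale0r subr0.
  exists w; split=> // b; rewrite inE => /orP[/eqP->|]; last exact: Aw.
  exact: lspan_perp Aw aA.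
have [a' [Ea' Aa' aa']] := IH a AE' Ea naA.
have [|w [Ew Aw vw]] := IH (v - B v a' *: a) AE' (linB lE Ev (linZ _ lE Ea)).
  by move=> h; apply: nv; exists (B v a').
exists (w - B a w *: a'); split; first by apply: linB => //; apply: linZ.
  move=> b; rewrite inE !formL => /orP[/eqP->|bA]; first by rewrite aa'; ring.
  by rewrite Aw ?Aa' // mulr0 subrr.
by rewrite -vw !formL; ring.
Qed.

Lemma stable_inv E g : stable E g -> stable E (Orth_inv g).
Proof. by move=> h x; rewrite -(h (Orth_inv g x)) Orth_invKV. Qed.
Lemma stable_mul E g k : stable E g -> stable E k -> stable E (Orth_mul g k).
Proof. by move=> h h' x /=; rewrite h. Qed.

Lemma eichler_stable E g e w : lin_closed E -> E e -> E w ->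
  B e e = 0 -> B w e = 0 -> g =1 eichler e w -> stable E g.
Proof.
have H w' x : lin_closed E -> E e -> E w' -> E x -> E (eichler e w' x).
  by move=> lE Ee Ew Ex; rewrite /eichler; do ?[apply: linB|apply: linZ|apply: linD].
move=> lE Ee Ew ee we gE x; rewrite gE; split; last exact: H.
move=> /(@H (- w) _ lE Ee); rewrite eichlerK //; apply.
by rewrite -scaleN1r; apply: linZ.
Qed.

(** Let f be isotropic and orthogonal to v, v' and A with <e, f> = 1. Three
    Siegel transformations fixing A take v to v - e, then to v' - e, then to v'.
    The first and the inverse of the last use the isotropic vector e and a
    vector dual to v, respectively v', modulo A; the middle one uses f and
    v - v'. *)
Lemma witt_step E A v v' e : lin_closed E -> nondeg E ->
  (forall a, a \in A -> E a) -> E v -> E v' -> ~ lspan A v -> ~ lspan A v' ->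
  (forall a, a \in A -> B a v = B a v') -> B v v = B v' v' ->
  E e -> B e e = 0 -> (forall a, a \in [:: v, v' & A] -> B a e = 0) ->
  ~ lspan [:: v, v' & A] e ->
  exists g, [/\ forall a, a \in A -> g a = a, g v = v' & stable E g].
Proof.
move=> lE nE AE Ev Ev' nv nv' Avv' vv' Ee ee Se nSe.
have SE a : a \in [:: v, v' & A] -> E a.
  by rewrite !inE => /or3P[/eqP->|/eqP->|/AE].
have Sv : v \in [:: v, v' & A] by rewrite inE eqxx.
have Sv' : v' \in [:: v, v' & A] by rewrite !inE eqxx orbT.
have SA a : a \in A -> a \in [:: v, v' & A] by move=> aA; rewrite !inE aA !orbT.
have [f [Ef Sf ef ff]] : exists f, [/\ E f,
    forall a, a \in [:: v, v' & A] -> B a f = 0, B e f = 1 & B f f = 0].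
  have [f [Ef Sf ef]] := dual_vec_ex lE nE SE Ee nSe.
  exists (f - (B f f / 2) *: e); split.
  - by apply: linB => //; apply: linZ.
  - by move=> a aS; rewrite !formL Sf // Se // mulr0 subrr.
  - by rewrite !formL ef ee mulr0 subr0.
  rewrite !formL ee (formC f e) ef.
  by have := halfD (B f f); move: (B f f / 2) => h <-; ring.
(* The first transformation, and the inverse of the last one. *)
have lift u : E u -> u \in [:: v, v' & A] -> ~ lspan A u ->
    exists g, [/\ forall a, a \in A -> g a = a, g u = u - e & stable E g].
  move=> Eu Su nu; have [w0 [Ew0 Aw0 uw0]] := dual_vec_ex lE nE AE Eu nu.
  pose w := w0 - B w0 e *: f.
  have Ew : E w by apply: linB => //; apply: linZ.
  have we : B w e = 0 by rewrite !formL (formC f) ef mulr1 subrr.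
  have Aw a : a \in A -> B a w = 0.
    by move=> aA; rewrite !formL Aw0 // Sf ?SA // mulr0 subrr.
  have uw : B u w = 1 by rewrite !formL uw0 Sf // mulr0 subr0.
  have [g gE] := eichler_ex ee we; exists g; split.
  - by move=> a aA; rewrite gE /eichler Aw // Se ?SA //; vring.
  - by rewrite gE /eichler uw Se //; vring.
  - exact: eichler_stable gE.
have [g1 [g1A g1v s1]] := lift v Ev Sv nv.
have [g3 [g3A g3v s3]] := lift v' Ev' Sv' nv'.
(* The middle transformation: it takes v - e to v' - e. *)
pose w := v - v'; have Ew : E w by apply: linB.
have wf : B w f = 0 by rewrite !formL !Sf // subrr.
have [g2 g2E] := eichler_ex ff wf.
exists (Orth_mul (Orth_inv g3) (Orth_mul g2 g1)); split.
- move=> a aA /=; rewrite g1A // g2E -[RHS](Orth_invK g3) g3A //; congr (_ _).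
  have aw : B a w = 0 by rewrite /w formDr formNr Avv' // subrr.
  by rewrite /eichler aw (Sf a (SA a aA)); vring.
- rewrite /= g1v g2E -[RHS](Orth_invK g3) g3v; congr (_ _).
  rewrite /eichler /w !formL !(formC e) !(Se _ Sv) !(Se _ Sv') (Sf _ Sv) (formC f e) ef.
  rewrite (formC v' v) vv'.
  have -> : (B v' v' - B v v' + (- B v v' - - B v' v')) / 2 = B v' v' - B v v'.
    by rewrite -[RHS]halfD; ring.
  by vring.
- apply: stable_mul; [exact: stable_inv|apply: stable_mul => //].
  exact: eichler_stable g2E.
Qed.

(** The span H_N of the e_i and f_i with i < N. *)
Definition insize N : Vinf F -> Prop := fun x => (size x.1 <= N)%N /\ (size x.2 <= N)%N.

Lemma insize_lin N : lin_closed (insize N).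
Proof.
split=> [|a x y [x1 x2] [y1 y2]]; first by rewrite /insize /= size_poly0.
by split=> /=; apply: leq_trans (size_polyD _ _) _; rewrite geq_max ?y1 ?y2 andbT;
  apply: leq_trans (size_scale_leq _ _) _.
Qed.

Lemma insize_leq M N x : (M <= N)%N -> insize M x -> insize N x.
Proof. by move=> h [x1 x2]; split; apply: leq_trans h. Qed.

Lemma insize_ex A : exists N, forall a, a \in A -> insize N a.
Proof.
elim: A => [|a A [N IH]]; first by exists 0%N.
exists (maxn N (maxn (size a.1) (size a.2))) => b; rewrite inE => /orP[/eqP->|/IH].
  by split; rewrite !leq_max leqnn ?orbT.
by apply: insize_leq; rewrite leq_maxl.
Qed.

Lemma form_e_out N x : insize N x -> B x (e_ F N) = 0.
Proof. by move=> [_ h]; rewrite form_e nth_default. Qed.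

Lemma full_lin : lin_closed (fun=> True). Proof. by []. Qed.

Lemma coef_neq0 (p : {poly F}) : p <> 0 -> exists i, p`_i != 0.
Proof.
by move/eqP => p0; exists (size p).-1; rewrite -lead_coefE lead_coef_eq0.
Qed.

Lemma form_e_f_neq0 v : v <> 0 -> exists i, (v.1`_i != 0) \/ (v.2`_i != 0).
Proof.
move=> v0; have [h1|/coef_neq0[i hi]] := pselect (v.1 = 0); last by exists i; left.
have [h2|/coef_neq0[i hi]] := pselect (v.2 = 0); last by exists i; right.
by case: v0; apply: injective_projections.
Qed.

Lemma full_nondeg : nondeg (fun=> True).
Proof.
move=> v _ /form_e_f_neq0 [i []] hi.
  by exists ((v.1`_i)^-1 *: f_ F i) => //; rewrite formZr form_f mulVf.
by exists ((v.2`_i)^-1 *: e_ F i) => //; rewrite formZr form_e mulVf.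
Qed.

Lemma e_out N A : (forall a, a \in A -> insize N a) -> ~ lspan A (e_ F N).
Proof.
move=> h /(lspan_min (insize_lin N) h) [] /=.
by rewrite size_polyXn ltnn.
Qed.

(** All the vectors lie in some H_N, and e_N is the isotropic vector which
    the one-step extension requires. *)
Lemma witt_full A v v' : ~ lspan A v -> ~ lspan A v' ->
  (forall a, a \in A -> B a v = B a v') -> B v v = B v' v' ->
  exists g, (forall a, a \in A -> g a = a) /\ g v = v'.
Proof.
move=> nv nv' Avv' vv'; have [N hN] := insize_ex [:: v, v' & A].
have [|||g [gA gv _]] := @witt_step _ A v v' (e_ F N) full_lin full_nondeg
  (fun _ _ => I) I I nv nv' Avv' vv' I; last by exists g.
- by rewrite form_e /= coef0.
- by move=> a /hN; apply: form_e_out.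
- exact: e_out.
Qed.

(** The pointwise stabiliser of A fixes no vector outside the span of A, so
    it determines this span. *)
Lemma not_lspan_moved A v : ~ lspan A v ->
  exists g, (forall a, a \in A -> g a = a) /\ g v <> v.
Proof.
move=> nv; have [//|w [_ Aw vw]] := dual_vec_ex full_lin full_nondeg _ I nv.
have [N hN] := insize_ex [:: w, v & A].
have we : B w (e_ F N) = 0 by apply/form_e_out/hN; rewrite !inE eqxx.
have ve : B v (e_ F N) = 0 by apply/form_e_out/hN; rewrite !inE eqxx orbT.
have ee : B (e_ F N) (e_ F N) = 0 by rewrite form_e /= coef0.
have [g gE] := eichler_ex ee we; exists g; split=> [a aA|].
  rewrite gE /eichler Aw // (@form_e_out N a); first by vring.
  by apply: hN; rewrite !inE aA !orbT.
rewrite gE /eichler vw ve => h.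
suff /polyP/(_ N) : (e_ F N).1 = 0 by rewrite coefXn eqxx coef0 => /eqP; rewrite oner_eq0.
have -> : e_ F N = v - (v + 0 *: w - 1 *: e_ F N - (B w w / 2 * 0) *: e_ F N).
  by vring.
by rewrite h subrr.
Qed.

Variables (par : bool) (r : nat).

(** A model of E_r inside V. If par is false it is H_r; if par is true it is
    the orthogonal sum of H_r and the line spanned by e_r + f_r / 2, a vector of
    norm 1. *)
Definition Esp : Vinf F -> Prop := fun x =>
  [/\ (size x.1 <= r + par)%N, (size x.2 <= r + par)%N & x.2`_r = x.1`_r / 2].

Lemma Esp_lin : lin_closed Esp.
Proof.
have h : lin_closed (insize (r + par)) by exact: insize_lin.
split=> [|a x y [x1 x2 x3] [y1 y2 y3]].
  by split; rewrite ?size_poly0 //= !coef0 mul0r.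
have [] : insize (r + par) (a *: x + y) by apply: (proj2 h).
split=> //=; rewrite !coefD !coefZ x3 y3; ring.
Qed.

Lemma Esp_e i : (i < r)%N -> Esp (e_ F i).
Proof.
move=> h; split=> /=; rewrite ?size_polyXn ?size_poly0 ?coef0 ?coefXn //.
  exact: leq_trans h (leq_addr _ _).
by rewrite gtn_eqF // mul0r.
Qed.
Lemma Esp_f i : (i < r)%N -> Esp (f_ F i).
Proof.
move=> h; split=> /=; rewrite ?size_polyXn ?size_poly0 ?coef0 ?coefXn //.
  exact: leq_trans h (leq_addr _ _).
by rewrite gtn_eqF // mul0r.
Qed.

Definition last_vec : Vinf F := ('X^r, 2^-1 *: 'X^r).

Lemma Esp_last : par -> Esp last_vec.
Proof.
rewrite /Esp => ->; split=> /=; rewrite ?size_polyXn ?addn1 //.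
  by apply: leq_trans (size_scale_leq _ _) _; rewrite size_polyXn.
by rewrite coefZ coefXn eqxx mulr1 mul1r.
Qed.

Lemma form_last x : B x last_vec = x.1`_r / 2 + x.2`_r.
Proof.
have -> : last_vec = e_ F r + 2^-1 *: f_ F r.
  by apply: Vinf_eqP => i /=; rewrite !(coefD, coefZ, coef0) ?mulr0 ?addr0 ?add0r.
by rewrite !formL form_e form_f; ring.
Qed.

Lemma Esp_r0 x : ~~ par -> Esp x -> x.1`_r = 0.
Proof. by rewrite /Esp => /negbTE-> [h _ _]; rewrite nth_default // -[r]addn0. Qed.

Lemma Esp_nondeg : nondeg Esp.
Proof.
move=> v Ev v0.
have [[i ir h]|h] := pselect (exists2 i, (i < r)%N & (v.1`_i != 0) || (v.2`_i != 0)).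
  case/orP: h => hi.
    exists ((v.1`_i)^-1 *: f_ F i); first exact/(linZ _ Esp_lin)/Esp_f.
    by rewrite formZr form_f mulVf.
  exists ((v.2`_i)^-1 *: e_ F i); first exact/(linZ _ Esp_lin)/Esp_e.
  by rewrite formZr form_e mulVf.
have [s1 s2 vr] := Ev.
have out i : i != r -> (v.1`_i = 0) /\ (v.2`_i = 0).
  move=> ir; case: (ltnP i r) => hi.
    have /negP : ~ ((v.1`_i != 0) || (v.2`_i != 0)) by move=> hh; apply: h; exists i.
    by rewrite negb_or !negbK => /andP[/eqP -> /eqP ->].
  have hi' : (r + par <= i)%N by move: ir hi; case: (par); lia.
  by rewrite !nth_default //; apply: leq_trans hi'.
have vr0 : v.1`_r <> 0.
  move=> h0; apply: v0; apply: Vinf_eqP => i /=; rewrite coef0;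
  by have [->|/out[]//] := eqVneq i r; rewrite ?vr h0 ?mul0r.
have hp : par by apply/negPn/negP => hp; apply: vr0; apply: Esp_r0.
exists ((v.1`_r)^-1 *: last_vec); first exact/(linZ _ Esp_lin)/Esp_last.
rewrite formZr form_last vr halfD mulVf //; exact/eqP.
Qed.

Lemma sub_e_closed E : lin_closed E -> (forall i, (i < r)%N -> E (e_ F i)) ->
  forall p : {poly F}, (size p <= r)%N -> E (p, 0).
Proof.
move=> lE; elim: r => [|n IH] En p sp.
  by move: sp; rewrite leqn0 size_poly_eq0 => /eqP->; case: lE.
rewrite (_ : (p, 0) = p`_n *: e_ F n + (p - p`_n *: 'X^n, 0)); last first.
  by apply: Vinf_eqP => i /=; rewrite ?(coefD, coefN, coefZ, coef0); ring.
apply: (proj2 lE); first exact: En.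
apply: IH => [i h|]; first exact/En/ltnW.
apply/leq_sizeP => j; rewrite coefD coefN coefZ coefXn leq_eqVlt.
case: (eqVneq n j) => [-> _|_ /= hj]; first by rewrite mulr1 subrr.
by rewrite mulr0 subr0 nth_default //; apply: leq_trans hj.
Qed.

Lemma sub_f_closed E : lin_closed E -> (forall i, (i < r)%N -> E (f_ F i)) ->
  forall p : {poly F}, (size p <= r)%N -> E (0, p).
Proof.
move=> lE; elim: r => [|n IH] En p sp.
  by move: sp; rewrite leqn0 size_poly_eq0 => /eqP->; case: lE.
rewrite (_ : (0, p) = p`_n *: f_ F n + (0, p - p`_n *: 'X^n)); last first.
  by apply: Vinf_eqP => i /=; rewrite ?(coefD, coefN, coefZ, coef0); ring.
apply: (proj2 lE); first exact: En.
apply: IH => [i h|]; first exact/En/ltnW.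
apply/leq_sizeP => j; rewrite coefD coefN coefZ coefXn leq_eqVlt.
case: (eqVneq n j) => [-> _|_ /= hj]; first by rewrite mulr1 subrr.
by rewrite mulr0 subr0 nth_default //; apply: leq_trans hj.
Qed.

Definition Ebas : seq (Vinf F) :=
  [seq e_ F i | i <- iota 0 r] ++ [seq f_ F i | i <- iota 0 r]
    ++ (if par then [:: last_vec] else [::]).

Lemma Ebas_Esp a : a \in Ebas -> Esp a.
Proof.
rewrite !mem_cat => /or3P[/mapP[i]|/mapP[i]|].
- by rewrite mem_iota => /andP[_ h] ->; apply: Esp_e.
- by rewrite mem_iota => /andP[_ h] ->; apply: Esp_f.
by case: ifP => // hp; rewrite inE => /eqP->; apply: Esp_last.
Qed.

(** The recursion principle for E_r in terms of its basis, for predicates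
    that are only known to be closed under linear combinations. *)
Lemma Ebas_min E x : lin_closed E -> (forall i, (i < r)%N -> E (e_ F i)) ->
  (forall i, (i < r)%N -> E (f_ F i)) -> (par -> E last_vec) -> Esp x -> E x.
Proof.
move=> lE Ee Ef El Ex.
rewrite (_ : x = x.1`_r *: last_vec + ((x.1 - x.1`_r *: 'X^r, 0) +
                 (0, x.2 - x.2`_r *: 'X^r))); last first.
  have [_ _ ->] := Ex.
  by apply: Vinf_eqP => i /=; rewrite ?(coefD, coefN, coefZ, coef0); ring.
have sz (p : {poly F}) : (size p <= r + par)%N -> (size (p - p`_r *: 'X^r)%R <= r)%N.
  move=> sp; apply/leq_sizeP => j; rewrite coefD coefN coefZ coefXn leq_eqVlt.
  case: (eqVneq r j) => [-> _|_ /= hj]; first by rewrite mulr1 subrr.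
  rewrite mulr0 subr0 nth_default //; apply: leq_trans sp _.
  by case: (par); rewrite ?addn1 ?addn0 // ltnW.
have [s1 s2 _] := Ex.
apply: linD => //; last by apply: linD => //; [apply: sub_e_closed|apply: sub_f_closed]; rewrite ?sz.
have [hp|hp] := boolP par; first by apply: linZ => //; apply: El.
by rewrite (Esp_r0 hp Ex) scale0r; case: lE.
Qed.

Lemma Ebas_span x : lspan Ebas x <-> Esp x.
Proof.
split; first exact: lspan_min Esp_lin Ebas_Esp.
apply: Ebas_min => [|i h|i h|hp]; [exact: lspan_lin|..]; apply: lspan_mem;
  rewrite !mem_cat; apply/or3P.
- by apply: Or31; apply: map_f; rewrite mem_iota.
- by apply: Or32; apply: map_f; rewrite mem_iota.
by apply: Or33; rewrite hp inE.
Qed.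

(** The span of e_0, ..., e_(r-1) is totally isotropic. In it, orthogonality to
    S imposes at most |S| conditions, and the vectors of the span of S have their
    e-coordinates in a space of dimension at most |S|; so r > 2|S| leaves room
    for a vector orthogonal to S outside its span. *)
Lemma Esp_isotropic S : (2 * size S < r)%N ->
  exists e, [/\ Esp e, B e e = 0, forall a, a \in S -> B a e = 0 & ~ lspan S e].
Proof.
move=> rS; set s := size S.
(* The rows of M are the e-parts of S; the columns of P are the f-parts, which
   pair with the e-part of the vector that is looked for. *)
pose M := \matrix_(i < s, j < r) (nth 0 S i).1`_j.
pose P := \matrix_(j < r, i < s) (nth 0 S i).2`_j.
have /row_subPn [i hi] : ~~ (kermx P <= M)%MS.
  apply/negP => /mxrankS; rewrite mxrank_ker leqNgt => /negP; apply.
  have := rank_leq_col P; have := rank_leq_row M; rewrite -/s in rS *; lia.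
set x := row i (kermx P) in hi.
have xP : x *m P = 0 by rewrite /x -row_mul mulmx_ker row0.
pose e : Vinf F := (rVpoly x, 0).
have se : (size (rVpoly x) <= r)%N by apply: size_poly.
have lM : lin_closed (fun v : Vinf F => (poly_rV v.1 <= M)%MS).
  split=> [|c y z hy hz]; first by rewrite linear0 sub0mx.
  by rewrite /= linearP addmx_sub // scalemx_sub.
exists e; split.
- apply: (@sub_e_closed Esp Esp_lin) => // k hk; exact: Esp_e.
- by rewrite (@formE r) ?size_poly0 // big1 // => k _; rewrite /= !coef0; ring.
- move=> a aS; rewrite formC (@formE r) ?size_poly0 //=.
  have ha : (index a S < s)%N by rewrite index_mem.
  have /rowP/(_ (Ordinal ha)) := xP; rewrite !mxE => h0; rewrite -[RHS]h0.
  apply: eq_bigr => k _.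
  by rewrite [RHS]mulrC mxE /= nth_index // coef0 mul0r addr0 mulrC coef_rVpoly_ord.
have H a : a \in S -> (poly_rV a.1 <= M)%MS.
  move=> aS; have ha : (index a S < s)%N by rewrite index_mem.
  have -> : poly_rV a.1 = row (Ordinal ha) M.
    by apply/rowP => k; rewrite !mxE nth_index.
  exact: row_sub.
by move/(lspan_min lM H); rewrite /= rVpolyK; apply/negP.
Qed.

(** Extension inside E_r, one vector of A at a time: a vector in the span of
    the earlier ones is already correctly mapped, and any other one is adjusted
    by the one-step extension. *)
Lemma witt_Esp A g : (forall a, a \in A -> Esp a) ->
  (forall a, a \in A -> Esp (g a)) -> ((size A).*2.+2 < r)%N ->
  exists k, (forall a, a \in A -> k a = g a) /\ stable Esp k.
Proof.
elim: A => [|a A IH] AE gAE sA; first by exists (Orth_one F).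
have Ea : Esp a by apply: AE; rewrite inE eqxx.
have AE' b : b \in A -> Esp b by move=> bA; apply: AE; rewrite inE bA orbT.
have [||k0 [k0A s0]] := IH AE'.
- by move=> b bA; apply: gAE; rewrite inE bA orbT.
- by apply: leq_ltn_trans sA; rewrite /= !doubleS; lia.
have [aA|naA] := pselect (lspan A a).
  exists k0; split=> // b; rewrite inE => /orP[/eqP->|]; last exact: k0A.
  exact: lspan_agree aA.
have mA : map k0 A = map g A by apply/eq_in_map.
set A1 := map g A; set v := k0 a; set v' := g a.
have [|e [Ee ee Se nSe]] := @Esp_isotropic [:: v, v' & A1].
  by apply: leq_trans sA; rewrite /= size_map; lia.
have A1E b : b \in A1 -> Esp b.
  by move=> /mapP[c cA ->]; apply: gAE; rewrite inE cA orbT.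
have [||||||k1 [k1A k1v s1]] := @witt_step Esp A1 v v' e Esp_lin Esp_nondeg A1E _ _ _ _ _ _ Ee ee Se nSe.
- exact/s0.
- by apply: gAE; rewrite inE eqxx.
- by rewrite /A1 -mA /v lspan_map.
- by rewrite /A1 /v' lspan_map.
- move=> b /mapP[c cA ->]; rewrite -{1}(k0A c cA) !Orth_form //.
- by rewrite !Orth_form.
exists (Orth_mul k1 k0); split; last exact: stable_mul.
move=> b; rewrite inE => /orP[/eqP->|bA] //=.
by rewrite (k0A b bA) k1A // map_f.
Qed.

Lemma not_Esp_moved v : ~ Esp v -> exists g, (forall x, Esp x -> g x = x) /\ g v <> v.
Proof.
move=> nv; have [|g [gA gv]] := @not_lspan_moved Ebas v; first by rewrite Ebas_span.
exists g; split=> // x /Ebas_span; apply: (@lspan_agree Ebas x g (Orth_one F)).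
exact: gA.
Qed.
End Form.

(** * Transitive smooth G-sets as orbits of tuples *)

Section GSets.
Variable F : finFieldType.
Implicit Types (A B C : seq (Vinf F)) (g h k : Orth F) (X Y Z : tsset F).

Lemma gact_mul X g h (x : X) : gact (Orth_mul g h) x = gact g (gact h x).
Proof. exact: gactM. Qed.
Lemma gactK X g (x : X) : gact (Orth_inv g) (gact g x) = x.
Proof. by rewrite -gact_mul -[RHS]gact1; congr gact; apply: Orth_mulV. Qed.
Lemma gactKV X g (x : X) : gact g (gact (Orth_inv g) x) = x.
Proof. by rewrite -gact_mul -[RHS]gact1; congr gact; apply: Orth_mulVr. Qed.

Lemma ts_trans X (x y : X) : exists g, gact g x = y.
Proof.
have [x0 h] := tsset_trans X; have [a <-] := h x; have [b <-] := h y.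
by exists (Orth_mul b (Orth_inv a)); rewrite gact_mul gactK.
Qed.

Definition gfix A g := forall a, a \in A -> g a = a.

Lemma gfix_map A g : map g A = A <-> gfix A g.
Proof.
split=> h; last by rewrite -[RHS]map_id; apply/eq_in_map.
by move=> a aA; have /eq_in_map/(_ a aA) : map g A = map id A by rewrite map_id.
Qed.

Lemma gfix_cat A B g : gfix (A ++ B) g <-> gfix A g /\ gfix B g.
Proof.
split=> [h|[hA hB] a]; last by rewrite mem_cat => /orP[/hA|/hB].
by split=> a aA; apply: h; rewrite mem_cat aA ?orbT.
Qed.

Lemma gfix_cons A b g : gfix (b :: A) g <-> g b = b /\ gfix A g.
Proof.
split=> [h|[hb hA] a]; last by rewrite inE => /orP[/eqP->|/hA].
by split=> [|a aA]; apply: h; rewrite inE ?eqxx ?aA ?orbT.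
Qed.

Lemma gfix_span A v g : lspan A v -> gfix A g -> g v = v.
Proof. by move=> Av gA; apply: (lspan_agree (k := Orth_one F) gA Av). Qed.

Lemma gmap_ext (Y X : gset F) (f f' : gmap Y X) : f =1 f' -> f = f'.
Proof.
case: f f' => [f pf] [f' pf'] /= /funext E; subst f'.
by congr MkGmap; apply: Prop_irrelevance.
Qed.

(** A map out of a transitive G-set is given by the image of one point, whose
    stabiliser has to grow. *)
Lemma gmap_of Y X (y : Y) (x : X) :
  (forall g, gact g y = y -> gact g x = x) -> {f : gmap Y X | f y = x}.
Proof.
move=> st; pose rep z := projT1 (cid (ts_trans y z)).
have repE z : gact (rep z) y = z by rewrite /rep; case: cid.
have st2 g h : gact g y = gact h y -> gact g x = gact h x.
  move=> e; rewrite -[RHS](gactKV g); congr gact; apply/esym.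
  by rewrite -gact_mul; apply: st; rewrite gact_mul -e gactK.
have eqv g z : gact (rep (gact g z)) x = gact g (gact (rep z) x).
  by rewrite -gact_mul; apply: st2; rewrite gact_mul !repE.
by exists (MkGmap eqv); rewrite /= -[RHS]gact1; apply: st2; rewrite repE gact1.
Qed.

Lemma gmap_agree Y X (f f' : gmap Y X) y : f y = f' y -> f = f'.
Proof.
move=> e; apply: gmap_ext => z; have [g <-] := ts_trans y z.
by rewrite !gmapP e.
Qed.

Lemma iso_of Y X (y : Y) (x : X) :
  (forall g, gact g y = y <-> gact g x = x) -> {f : gmap Y X | f y = x & bijective f}.
Proof.
move=> st; have [f fy] := gmap_of (fun g => (proj1 (st g))).
have [f' fx] := gmap_of (fun g => (proj2 (st g))).
exists f => //; exists f' => z.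
  by have [g <-] := ts_trans y z; rewrite !gmapP fy fx.
by have [g <-] := ts_trans x z; rewrite !gmapP fx fy.
Qed.

Lemma Theta_relE (a b : free_symbols F) : Theta_rel (a - b) ->
  rq (@Theta_rel F) a = rq (@Theta_rel F) b.
Proof.
move=> h; apply/rqP; apply/asboolP.
by exists 1%N, (fun=> 1), (fun=> a - b); split=> //; rewrite big_ord1 mul1r.
Qed.

Lemma Tclass_iso Y X (f : gmap Y X) : bijective f -> Tclass f = 1.
Proof. by move=> /Theta_rel_iso /Theta_relE. Qed.

Lemma Tclass_comp Z Y X (f : gmap Y X) (g : gmap Z Y) :
  Tclass (gmap_comp f g) = Tclass f * Tclass g.
Proof. by rewrite /Tclass -rmorphM; apply/Theta_relE/Theta_rel_comp. Qed.

Lemma Tclass_base_change Y X X' (f : gmap Y X) (h : gmap X' X)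
    (n : nat) (Y' : 'I_n -> tsset F) (p : forall i, gmap (Y' i) Y)
    (f' : forall i, gmap (Y' i) X') :
    orbit_decomposition f h p f' -> Tclass f = \sum_(i < n) Tclass (f' i).
Proof.
by move=> /Theta_rel_base_change /Theta_relE; rewrite raddf_sum.
Qed.

(** The class of a map depends only on the stabilisers of a point and of its
    image, because these determine source, target and map up to isomorphism. *)
Lemma Tclass_eq Y X Y2 X2 (f : gmap Y X) (f2 : gmap Y2 X2) (y : Y) (y2 : Y2) :
  (forall g, gact g y = y <-> gact g y2 = y2) ->
  (forall g, gact g (f y) = f y <-> gact g (f2 y2) = f2 y2) ->
  Tclass f = Tclass f2.
Proof.
move=> /iso_of [u uy ub] /iso_of [w wx wb].
have : gmap_comp w f = gmap_comp f2 u by apply: (@gmap_agree _ _ _ _ y); rewrite /= uy wx.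
move=> e; have e1 := Tclass_comp w f; have e2 := Tclass_comp f2 u.
rewrite e e2 (Tclass_iso ub) (Tclass_iso wb) in e1.
exact: etrans (esym (mul1r _)) (etrans (esym e1) (mulr1 _)).
Qed.

Definition tcode A : nat := choice.pickle (A : seq ({poly F} * {poly F})).
Definition tdecode (n : nat) : seq (Vinf F) := odflt [::] (choice.unpickle n).
Lemma tcodeK : cancel tcode tdecode.
Proof. by move=> A; rewrite /tdecode /tcode choice.pickleK. Qed.

(** The orbit of the tuple A. Tuples are coded by natural numbers because the
    carrier of a G-set must be in Set. *)
Definition orb_car A : Set := {n : nat | exists g : Orth F, n = tcode (map g A)}.
Definition orb_val A (z : orb_car A) : seq (Vinf F) := tdecode (sval z).
Definition orb_mk A g : orb_car A :=
  exist _ (tcode (map g A)) (ex_intro _ g erefl).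

Lemma orb_val_mk A g : orb_val (orb_mk A g) = map g A.
Proof. exact: tcodeK. Qed.

Lemma orb_ext A (z z' : orb_car A) : orb_val z = orb_val z' -> z = z'.
Proof.
case: z z' => [n pn] [n' pn']; rewrite /orb_val /= => e.
have E : n = n'.
  by case: (pn) (pn') e => [g ->] [g' ->]; rewrite !tcodeK => ->.
by subst n'; congr exist; apply: Prop_irrelevance.
Qed.

Lemma orb_act_ex A g (z : orb_car A) : exists h, map g (orb_val z) = map h A.
Proof.
case: z => n [h nE]; exists (Orth_mul g h).
by rewrite /orb_val /= nE tcodeK -map_comp.
Qed.

Definition orb_act A g (z : orb_car A) : orb_car A :=
  orb_mk A (projT1 (cid (orb_act_ex g z))).

Lemma orb_val_act A g (z : orb_car A) : orb_val (orb_act g z) = map g (orb_val z).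
Proof. by rewrite /orb_act orb_val_mk; case: cid. Qed.

Lemma orb_act1 A (z : orb_car A) : orb_act 1%g z = z.
Proof. by apply: orb_ext; rewrite orb_val_act map_id. Qed.
Lemma orb_actM A g h (z : orb_car A) : orb_act (g * h)%g z = orb_act g (orb_act h z).
Proof. by apply: orb_ext; rewrite !orb_val_act -map_comp. Qed.

Definition orb_gset A : gset F := MkGset (@orb_act1 A) (@orb_actM A).

Definition orb_pt A : orb_car A := orb_mk A (Orth_one F).
Lemma orb_val_pt A : orb_val (orb_pt A) = A.
Proof. by rewrite orb_val_mk map_id. Qed.

Lemma orb_trans A : gtransitive (orb_gset A).
Proof.
exists (orb_pt A) => -[n [g nE]]; exists g; apply: orb_ext.
by rewrite orb_val_act orb_val_pt /orb_val /= nE tcodeK.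
Qed.

Lemma orb_smooth A : Vsmooth (orb_gset A).
Proof.
move=> x; exists (orb_val x) => g; rewrite -/(gfix _ _) -gfix_map -orb_val_act.
by split=> [/(congr1 (@orb_val A))|/orb_ext].
Qed.

Definition orb A : tsset F := MkTsset (orb_trans A) (@orb_smooth A).
Definition pt A : orb A := orb_pt A.

Lemma gact_pt_eq A g h : gact g (pt A) = gact h (pt A) <-> map g A = map h A.
Proof.
have E k : orb_val (orb_act k (orb_pt A)) = map k A by rewrite orb_val_act orb_val_pt.
split=> [/(congr1 (@orb_val A))|e]; first by rewrite /= !E.
by apply: orb_ext; rewrite /= !E.
Qed.

Lemma gact_pt A g : gact g (pt A) = pt A <-> gfix A g.
Proof.
rewrite -gfix_map -[X in _ = X]gact1 gact_pt_eq map_id //.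
Qed.

Lemma gact_gpt A g h : gact g (gact h (pt A)) = gact h (pt A) <-> gfix (map h A) g.
Proof. by rewrite -gact_mul gact_pt_eq -gfix_map -map_comp. Qed.

Definition fixsub B A := forall g, gfix B g -> gfix A g.

Definition orbmap B A (h : fixsub B A) : gmap (orb B) (orb A) :=
  projT1 (gmap_of (fun g e => proj2 (gact_pt A g) (h g (proj1 (gact_pt B g) e)))).
Lemma orbmap_pt B A (h : fixsub B A) : orbmap h (pt B) = pt A.
Proof. by rewrite /orbmap; case: gmap_of. Qed.

End GSets.
Arguments orb : simpl never.
Arguments pt : simpl never.

(** The class of G/G(B) -> G/G(A) when G(B) is contained in G(A). The value 0
    otherwise is a mere default. *)
HB.lock Definition tau (F : finFieldType) (B A : seq (Vinf F)) : Theta F :=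
  if pselect (fixsub B A) is left h then Tclass (orbmap h) else 0.

(** * Classes of maps between orbits of tuples *)

Section Tau.
Variable F : finFieldType.
Implicit Types (A B C : seq (Vinf F)) (g h k : Orth F) (X Y Z : tsset F).

Lemma tauE B A (h : fixsub B A) : tau B A = Tclass (orbmap h).
Proof.
rewrite tau.unlock; case: pselect => [h'|n]; last by case: (n h).
by rewrite (Prop_irrelevance h' h).
Qed.

(** All of Theta is expressed by the classes [tau], since every map of
    transitive smooth G-sets is isomorphic to some G/G(B) -> G/G(A). *)
Lemma Tclass_tau Y X (f : gmap Y X) (y : Y) B A :
  (forall g, gact g y = y <-> gfix B g) ->
  (forall g, gact g (f y) = f y <-> gfix A g) -> Tclass f = tau B A.
Proof.
move=> sy sx; have h : fixsub B A.
  by move=> g /sy e; apply/sx; rewrite -gmapP e.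
rewrite (tauE h); apply: (Tclass_eq (y := y) (y2 := pt B)) => g.
  by rewrite gact_pt; apply: sy.
by rewrite orbmap_pt gact_pt; apply: sx.
Qed.

Lemma tsset_stab X (x : X) : exists A, forall g, gact g x = x <-> gfix A g.
Proof. exact: tsset_smooth. Qed.

Lemma tau_eq B A B' A' : fixsub B A ->
  (forall g, gfix B g <-> gfix B' g) -> (forall g, gfix A g <-> gfix A' g) ->
  tau B A = tau B' A'.
Proof.
move=> h hB hA; rewrite (tauE h); apply: (Tclass_tau (y := pt B)) => g.
  by rewrite gact_pt.
by rewrite orbmap_pt gact_pt.
Qed.

Lemma tau1 B A : (forall g, gfix B g <-> gfix A g) -> tau B A = 1.
Proof.
move=> e; have h : fixsub B A by move=> g; apply: (proj1 (e g)).
rewrite (tauE h); apply: Tclass_iso.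
have [|f fy fb] := @iso_of F (orb B) (orb A) (pt B) (pt A).
  by move=> g; rewrite !gact_pt.
by rewrite (@gmap_agree F _ _ (orbmap h) f (pt B)) ?orbmap_pt.
Qed.

Lemma tau_comp C B A : fixsub C B -> fixsub B A -> tau C A = tau C B * tau B A.
Proof.
move=> h h'; have h'' : fixsub C A by move=> g /h/h'.
rewrite (tauE h) (tauE h') (tauE h'') mulrC -Tclass_comp; congr Tclass.
by apply: (@gmap_agree F _ _ _ _ (pt C)); rewrite /= !orbmap_pt.
Qed.

Lemma tau_conj g B A : fixsub B A -> tau (map g B) (map g A) = tau B A.
Proof.
move=> h; rewrite (tauE h); apply/esym/(Tclass_tau (y := gact g (pt B))) => k.
  by rewrite gact_gpt.
by rewrite gmapP orbmap_pt gact_gpt.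
Qed.

Lemma fixsub_catl B A : fixsub (B ++ A) B.
Proof. by move=> g /gfix_cat[]. Qed.
Lemma fixsub_catr B A : fixsub (B ++ A) A.
Proof. by move=> g /gfix_cat[]. Qed.

(** The base change relation along G/G(A') -> G/G(A). The orbits of the
    fibre product correspond to the G(A')-orbits on the G(A)-orbit of the tuple
    B; the tuples gs j B are to be representatives of these. *)
Lemma tau_base_change (J : finType) (P : {pred J}) (gs : J -> Orth F) A B A' :
  fixsub B A -> fixsub A' A -> (forall j, j \in P -> gfix A (gs j)) ->
  (forall g, gfix A g -> exists j k,
     [/\ j \in P, gfix A' k & map g B = map k (map (gs j) B)]) ->
  (forall i j k, i \in P -> j \in P -> gfix A' k ->
     map k (map (gs i) B) = map (gs j) B -> i = j) ->
  tau B A = \sum_(j in P) tau (A' ++ map (gs j) B) A'.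
Proof.
move=> hBA hA'A gsA ex uq; rewrite big_enum_val /= (tauE hBA).
pose gi (i : 'I_#|P|) := gs (enum_val i).
pose Y' i := orb (A' ++ map (gi i) B).
have sp i g : gact g (pt (A' ++ map (gi i) B)) = pt _ ->
    gact g (gact (gi i) (pt B)) = gact (gi i) (pt B).
  by rewrite gact_pt gact_gpt => /gfix_cat[].
pose p i : gmap (Y' i) (orb B) := projT1 (gmap_of (sp i)).
have pE i g : p i (gact g (pt _)) = gact (Orth_mul g (gi i)) (pt B).
  by rewrite gmapP /p; case: gmap_of => f ->; rewrite gact_mul.
pose f' i : gmap (Y' i) (orb A') := orbmap (@fixsub_catl A' (map (gi i) B)).
have f'E i g : f' i (gact g (pt _)) = gact g (pt A') by rewrite gmapP orbmap_pt.
have giA i : gfix A (gi i) by apply/gsA/enum_valP.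
rewrite (@Tclass_base_change F _ _ _ (orbmap hBA) (orbmap hA'A) _ Y' p f').
  by apply: eq_bigr => i _; rewrite (tauE (@fixsub_catl _ _)).
split=> [i z|y x'].
  have [g <-] := ts_trans (pt _ : Y' i) z; rewrite pE f'E !gmapP !orbmap_pt gact_mul.
  by congr gact; apply/gact_pt.
have [g <-] := ts_trans (pt B) y; have [h <-] := ts_trans (pt A') x'.
rewrite !gmapP !orbmap_pt => e.
have [|j [k [jP kA' e']]] := ex (Orth_mul (Orth_inv h) g).
  by apply/gact_pt; rewrite gact_mul e gactK.
pose i := enum_rank_in jP j.
have iE : enum_val i = j by rewrite enum_rankK_in.
have e2 : map g B = map (Orth_mul (Orth_mul h k) (gi i)) B.
  rewrite /gi iE (_ : map g B = map h (map (Orth_mul (Orth_inv h) g) B)).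
    by rewrite e' -!map_comp.
  by rewrite -map_comp; apply: eq_map => x /=; rewrite Orth_invKV.
exists (existT _ i (gact (Orth_mul h k) (pt _))); split=> /=.
  rewrite pE f'E; split; first exact/gact_pt_eq.
  by apply/gact_pt_eq/eq_in_map => a aA' /=; rewrite kA'.
move=> [i' z'] /=; have [g' <-] := ts_trans (pt _ : Y' i') z'; rewrite pE f'E.
move=> [/gact_pt_eq e3 /gact_pt_eq e4].
have ii' : i = i'.
  apply: enum_val_inj.
  apply: (uq _ _ (Orth_mul (Orth_inv g') (Orth_mul h k))); rewrite ?enum_valP //.
    apply/gfix_map; rewrite -[RHS]map_id.
    rewrite (_ : map _ A' = map (Orth_inv g') (map h A')).
      rewrite -e4 -map_comp; apply: eq_map => x /=; exact: Orth_invK.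
    by rewrite -map_comp; apply/eq_in_map => a aA' /=; rewrite kA'.
  rewrite -/(gi i) -/(gi i').
  rewrite -map_comp (_ : map _ B = map (Orth_inv g') (map g B)).
    by rewrite -e3 -map_comp; apply: eq_map => x /=; rewrite Orth_invK.
  by rewrite e2 -map_comp.
subst i'; congr existT; apply/gact_pt_eq; rewrite !map_cat; congr cat.
  by rewrite e4; apply/eq_in_map => a aA' /=; rewrite kA'.
by have := e3; rewrite e2 -!map_comp.
Qed.
End Tau.

(** * Induction on the free ring and on Theta *)

Section FreeInd.
Variable F : finFieldType.
Variable Pr : free_symbols F -> Prop.
Hypothesis Pr1 : Pr 1.
Hypothesis PrB : forall x y, Pr x -> Pr y -> Pr (x - y).
Hypothesis PrM : forall x y, Pr x -> Pr y -> Pr (x * y).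
Hypothesis Pr_symb : forall (Y X : tsset F) (f : gmap Y X), Pr (symb f).

(** A monomial in the symbols is split off symbol by symbol, by induction on
    its degree. *)
Lemma free_ind (a : free_symbols F) : Pr a.
Proof.
have Pr0 : Pr 0 by rewrite -(subrr 1); apply: PrB.
have PrN x : Pr x -> Pr (- x) by move=> Px; rewrite -sub0r; apply: PrB.
have PrD x y : Pr x -> Pr y -> Pr (x + y).
  by move=> Px Py; rewrite -[y]opprK; apply/PrB/PrN.
have PrMn x n : Pr x -> Pr (x *+ n).
  by move=> Px; elim: n => [|n IH]; rewrite ?mulr0n ?mulrS //; apply: PrD.
have PrU (m : {cmonom symbol F}) : Pr << m >>.
  have [n] := ubnP (mdeg m); elim: n m => [m h0|n IH m /ltnSE dm].
    by exfalso; rewrite ltn0 in h0.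
  have [->|/eqP m1] := eqVneq m (onecm _); first exact: Pr1.
  have [i im] : exists i, i \in finsupp m.
    case: (fset_0Vmem (finsupp m)) => [m0|[i im]]; last by exists i.
    by case: m1; apply: mdeg_eq0I; rewrite mdegE m0 big_seq_fset0.
  have E : m = mulcm (ucm i) (divcm m (ucm i)).
    apply/eqP/cmP => j; rewrite mulcmE divcmE ucmE; case: eqP => [<-|_].
      by rewrite addnC subnK // lt0n cmE_neq0.
    by rewrite subn0.
  have -> : << m >> = << ucm i >> * << divcm m (ucm i) >> :> free_symbols F.
    rewrite {1}E; apply/esym; exact: (fgmulUU (1 : int) 1).
  apply: PrM; first by case: i {im E} => Y X f; apply: Pr_symb.
  by apply: IH; move: dm; rewrite {1}E (mdegM (ucm i)) mdegU.
rewrite [a]monalgE; elim: (enum_fset _) => [|m s IH]; first by rewrite big_nil.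
rewrite big_cons; apply: PrD IH.
have -> : << a@_m *g m >> = << m >> *~ a@_m :> free_symbols F.
  by rewrite -{1}[a@_m]intz -raddfMz.
case: (a@_m) => k; first by rewrite -pmulrn; apply: PrMn; apply: PrU.
by rewrite NegzE mulrNz -pmulrn; apply: PrN; apply: PrMn; apply: PrU.
Qed.
End FreeInd.

(** * One-vector extensions over a hyperbolic subspace *)

Section Step.
Variable F : finFieldType.
Hypothesis odd_q : odd #|F|.
Implicit Types (A : seq (Vinf F)) (g h k : Orth F) (v : Vinf F) (c d : F) (n : nat).
Local Notation B := (@Vinf_form F).
Local Notation q := #|F|.

Lemma Theta_ind (Pr : Theta F -> Prop) : Pr 1 ->
  (forall x y, Pr x -> Pr y -> Pr (x - y)) ->
  (forall x y, Pr x -> Pr y -> Pr (x * y)) ->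
  (forall (Y X : tsset F) (f : gmap Y X), Pr (Tclass f)) -> forall z, Pr z.
Proof.
move=> P1 PB PM Ps z; have [a <-] := rq_surj z.
apply: (@free_ind F (fun a => Pr (rq _ a))).
- by rewrite (rmorph1 (rq (@Theta_rel F))).
- by move=> x y Px Py; rewrite (rmorphB (rq (@Theta_rel F))); apply: PB.
- by move=> x y Px Py; rewrite (rmorphM (rq (@Theta_rel F))); apply: PM.
- exact: Ps.
Qed.

(** The vector of H_n with given e- and f-coordinates; it makes H_n available
    as a finite type. *)
Definition hypv n (u : 'rV[F]_n * 'rV[F]_n) : Vinf F := (rVpoly u.1, rVpoly u.2).

Lemma hypv_insize n (u : 'rV[F]_n * 'rV[F]_n) : insize n (hypv u).
Proof. by split; apply: size_poly. Qed.

Lemma hypv_surj n v : insize n v -> exists u : 'rV[F]_n * 'rV[F]_n, hypv u = v.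
Proof.
by move=> [v1 v2]; exists (poly_rV v.1, poly_rV v.2); rewrite /hypv /= !poly_rV_K //; case: (v).
Qed.

Lemma hypv_inj n : injective (@hypv n).
Proof.
by move=> [a b] [a' b'] [/(congr1 (@poly_rV _ n)) + /(congr1 (@poly_rV _ n))];
  rewrite !rVpolyK => -> ->.
Qed.

Lemma Esp_false n v : Esp false n v <-> insize n v.
Proof.
rewrite /Esp /insize addn0; split=> [[]//|[h1 h2]]; split=> //.
by rewrite !nth_default // mul0r.
Qed.

Definition hyp_basis n : seq (Vinf F) := Ebas F false n.

Lemma hyp_span n v : lspan (hyp_basis n) v <-> insize n v.
Proof. by rewrite /hyp_basis Ebas_span Esp_false. Qed.

Lemma hyp_insize n a : a \in hyp_basis n -> insize n a.
Proof. by move=> h; apply/hyp_span/lspan_mem. Qed.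

Lemma gfix_hyp n g : gfix (hyp_basis n) g <-> forall v, insize n v -> g v = v.
Proof.
split=> [h v /hyp_span hv|h a /hyp_insize]; [exact: gfix_span hv h|exact: h].
Qed.

(** A vector of norm d orthogonal to H_n, and nonzero even for d = 0. *)
Definition w_ n d : Vinf F := e_ F n + (d / 2) *: f_ F n.

Lemma form_w v n d : B v (w_ n d) = v.2`_n + d / 2 * v.1`_n.
Proof. by rewrite !formL form_e form_f. Qed.

Lemma form_ww n d : B (w_ n d) (w_ n d) = d.
Proof.
rewrite form_w /= !(coefD, coefZ, coef0) !coefXn eqxx /= mulr1n.
by rewrite -[RHS](halfD odd_q); ring.
Qed.

Lemma form_w_out n d v : insize n v -> B v (w_ n d) = 0.
Proof. by move=> [h1 h2]; rewrite form_w !nth_default // mulr0 addr0. Qed.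

Lemma w_coef n d : (w_ n d).1`_n = 1.
Proof. by rewrite /= coefD coefZ coef0 coefXn eqxx mulr0 addr0. Qed.

Lemma add_w_out n d v : insize n v -> ~ insize n (v + w_ n d).
Proof.
move=> [h1 h2] [/leq_sizeP/(_ n (leqnn n)) + _]; rewrite coefD w_coef.
by rewrite (nth_default _ h1) add0r => /eqP; rewrite oner_eq0.
Qed.

(** By Witt extension G(H_n) permutes transitively the nonzero vectors of
    norm d orthogonal to H_n. This is the class of the set which they form. *)
Definition nzvecs n d : Theta F := tau (w_ n d :: hyp_basis n) (hyp_basis n).

Lemma gfix_consr A b g : gfix (b :: A) g -> gfix A g.
Proof. by move/gfix_cons=> []. Qed.

(** The orthogonal projection to H_n. *)
Definition trunc n v : Vinf F := (take_poly n v.1, take_poly n v.2).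
Lemma trunc_insize n v : insize n (trunc n v).
Proof. by split; apply: size_take_poly. Qed.

Lemma trunc_form n u v : insize n u -> B u (v - trunc n v) = 0.
Proof.
move=> [h1 h2]; rewrite (formE _ h1 h2) big1 // => i _ /=.
by rewrite !coefB !coef_take_poly ltn_ord !subrr; ring.
Qed.

Lemma insize_perp_eq n u v : insize n u -> insize n v ->
  (forall x, insize n x -> B u x = B v x) -> u = v.
Proof.
move=> [u1 u2] [v1 v2] e; apply: Vinf_eqP => i.
  case: (ltnP i n) => hi; last by rewrite !nth_default //; apply: leq_trans hi.
  rewrite -!form_f; apply: e; rewrite -Esp_false; exact: Esp_f.
case: (ltnP i n) => hi; last by rewrite !nth_default //; apply: leq_trans hi.
by rewrite -!form_e; apply: e; rewrite -Esp_false; exact: Esp_e.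
Qed.

(** A vector in the G(A)-orbit of b is a vector outside the span of A with
    the norm of b and the pairings of b with A. Write it as u + w with u in H_n
    and w orthogonal to H_n, which contains A. For a given u the possible w have
    norm d = <b, b> - <u, u>: the nonzero ones form one G(H_n)-orbit, with class
    [nzvecs n d], and w = 0 occurs when d = 0, unless u is in the span of A. The
    sum on the right ignores this exception, which the cardinality on the left
    makes up for. *)
Lemma tau_step A b n : (forall a, a \in A -> insize n a) -> ~ lspan A b ->
  tau (b :: A) A +
    #|[pred u : 'rV[F]_n * 'rV[F]_n | [&& all (fun a => B a (hypv u) == B a b) A,
        `[< lspan A (hypv u) >] & B (hypv u) (hypv u) == B b b] ]|%:R
  = \sum_(u : 'rV[F]_n * 'rV[F]_n | all (fun a => B a (hypv u) == B a b) A)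
       (nzvecs n (B b b - B (hypv u) (hypv u)) + (B b b - B (hypv u) (hypv u) == 0)%:R).
Proof.
(* The index (u, true) stands for the vector u itself, and (u, false) for the
   vectors u + w with w <> 0, represented by w = w_ n d. *)
move=> AH nb; pose J := (('rV[F]_n * 'rV[F]_n) * bool)%type.
pose cond (u : 'rV[F]_n * 'rV[F]_n) := all (fun a => B a (hypv u) == B a b) A.
pose d (u : 'rV[F]_n * 'rV[F]_n) := B b b - B (hypv u) (hypv u).
pose inA (u : 'rV[F]_n * 'rV[F]_n) := `[< lspan A (hypv u) >].
pose P : {pred J} := fun j => cond j.1 && (j.2 ==> ((d j.1 == 0) && ~~ inA j.1)).
pose rep (j : J) := if j.2 then hypv j.1 else hypv j.1 + w_ n (d j.1).
have lA v : lspan A v -> insize n v by apply: lspan_min => //; apply: insize_lin.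
have hA g : gfix (hyp_basis n) g -> gfix A g by move=> /gfix_hyp gH a /AH; apply: gH.
have hatw (u : 'rV[F]_n * 'rV[F]_n) x : insize n x -> B x (hypv u + w_ n (d u)) = B x (hypv u).
  by move=> hx; rewrite formDr form_w_out // addr0.
have normw (u : 'rV[F]_n * 'rV[F]_n) : B (hypv u + w_ n (d u)) (hypv u + w_ n (d u)) = B b b.
  have h := hypv_insize u; rewrite formDl hatw // formDr form_ww.
  by rewrite (formC _ (hypv u)) form_w_out // /d; ring.
have nrep j : j \in P -> ~ lspan A (rep j).
  case: j => u [] /andP[/= hc hd]; rewrite /rep /=.
    by move: hd => /= /andP[_ /asboolP].
  by move=> /lA; apply: add_w_out; apply: hypv_insize.
have repA j : j \in P -> forall a, a \in A -> B a (rep j) = B a b.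
  case: j => u be /andP[/= /allP hc _] a aA; rewrite -(eqP (hc a aA)) /rep /=.
  by case: be => //; apply/hatw/AH.
have reprep j : j \in P -> B (rep j) (rep j) = B b b.
  case: j => u [] /andP[/= _ hd]; rewrite /rep /=; last exact: normw.
  by move: hd => /= /andP[+ _]; rewrite subr_eq0 => /eqP.
have gex j : exists g, j \in P -> gfix A g /\ g b = rep j.
  have [jP|] := boolP (j \in P); last by exists (Orth_one F).
  have [||g gE] := witt_full odd_q nb (nrep j jP); last by exists g.
    by move=> a aA; rewrite (repA j jP).
  by rewrite (reprep j jP).
pose gs j := projT1 (cid (gex j)).
have gsP j : j \in P -> gfix A (gs j) /\ gs j b = rep j.
  by rewrite /gs; case: cid.
have fixd k v : gfix (hyp_basis n) k -> insize n v -> k v = v by move=> /gfix_hyp; apply.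
rewrite (@tau_base_change F J P gs A (b :: A) (hyp_basis n)); first last.
- move=> i j k iP jP kH /= [e _]; move: e.
  rewrite (gsP i iP).2 (gsP j jP).2.
  have ink x y : k x = y -> insize n y -> x = y.
    by move=> e hy; apply: (bij_inj (Orth_bij k)); rewrite e (fixd k y).
  case: i iP => u [] iP; case: j jP => u' [] jP; rewrite /rep /= => e.
  + by move: e; rewrite (fixd k _ kH (hypv_insize u)) => /hypv_inj->.
  + move: e; rewrite (fixd k _ kH (hypv_insize u)) => e.
    by case: (@add_w_out n (d u') (hypv u')); rewrite -?e; apply: hypv_insize.
  + by case: (@add_w_out n (d u) (hypv u)); rewrite ?(ink _ _ e); apply: hypv_insize.
  + congr pair; apply/hypv_inj/(insize_perp_eq (hypv_insize u) (hypv_insize u')) => x hx.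
    rewrite !(formC _ x) -hatw // -[RHS]hatw // -e -{2}(fixd k x kH hx) Orth_form //.
- move=> g gA; set v := g b.
  have vv : B v v = B b b by rewrite Orth_form.
  have vA a : a \in A -> B a v = B a b by move=> aA; rewrite -(gA a aA) /v Orth_form gA.
  have nv : ~ lspan A v.
    by rewrite -(lspan_map g A b) in nb; rewrite (proj2 (gfix_map A g) gA) in nb.
  have [u uv] := hypv_surj (trunc_insize n v).
  have uvA a : a \in A -> B a (hypv u) = B a b.
    move=> aA; rewrite -vA // uv; apply/eqP; rewrite eq_sym -subr_eq0.
    by rewrite -formNr -formDr trunc_form //; apply: AH.
  have cu : cond u by apply/allP => a aA; rewrite uvA.
  have [vn|vn] := pselect (insize n v).
    have uv' : hypv u = v by rewrite uv /trunc !take_poly_id //; case: (v) vn => ? ? [].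
    have jP : (u, true) \in P.
      rewrite unfold_in /P /= cu /= /d uv' vv subrr eqxx /=; apply/asboolP.
      by rewrite uv'.
    exists (u, true), (Orth_one F); split=> //.
    rewrite map_id; have [fA fb] := gsP _ jP.
    by rewrite /= fb /rep /= uv'; congr cons; apply/eq_in_map => a aA; rewrite gA // fA.
  have jP : (u, false) \in P by rewrite unfold_in /P /= cu.
  have [||||k [kH kv]] := @witt_full F odd_q (hyp_basis n) (rep (u, false)) v.
  + by move=> /hyp_span; apply: add_w_out; apply: hypv_insize.
  + by move=> /hyp_span.
  + move=> a /hyp_insize ha; rewrite /rep /= hatw // uv; apply/eqP.
    by rewrite eq_sym -subr_eq0 -formNr -formDr trunc_form.
  + by rewrite (reprep _ jP).
  exists (u, false), k; split=> //; have [fA fb] := gsP _ jP.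
  rewrite /= fb kv -map_comp; congr cons; apply/eq_in_map => a aA /=.
  by rewrite gA // fA // (hA k).
- by move=> j jP; case: (gsP j jP).
- by move=> g; apply: hA.
- by move=> g; apply: gfix_consr.
have Ej j : j \in P -> tau (hyp_basis n ++ map (gs j) (b :: A)) (hyp_basis n) =
    if j.2 then 1 else nzvecs n (d j.1).
  move=> jP; have [fA fb] := gsP j jP.
  have E g : gfix (hyp_basis n ++ map (gs j) (b :: A)) g <-> gfix (rep j :: hyp_basis n) g.
    rewrite gfix_cat /= fb !gfix_cons (proj2 (gfix_map A (gs j)) fA).
    by split=> [[? []]//|[? /[dup] ? /hA]].
  case: j jP E {fA fb} => u [] jP E /=.
    apply: tau1 => g; rewrite E gfix_cons; split=> [[]//|gH].
    by split=> //; rewrite /rep /= (fixd g _ gH (hypv_insize u)).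
  apply: tau_eq => //; first exact: fixsub_catl.
  move=> g; rewrite E !gfix_cons /rep /=; split=> -[+ gH].
    by rewrite OrthD (fixd g _ gH (hypv_insize u)) => /addrI.
  by rewrite OrthD (fixd g _ gH (hypv_insize u)) => ->.
rewrite (eq_bigr _ Ej) big_mkcond /=.
rewrite (eq_bigr (fun j : J => (fun u be => if (u, be) \in P then
   (if be then 1 else nzvecs n (d u)) else 0) j.1 j.2)); last by case.
rewrite -(pair_bigA _ (fun u be => if (u, be) \in P then
   (if be then 1 else nzvecs n (d u)) else 0)) /=.
rewrite [RHS]big_mkcond -sum1_card natr_sum [X in _ + X]big_mkcond -big_split /=.
apply: eq_bigr => u _; rewrite big_bool /= !unfold_in /P /= -/(cond u) -/(d u) -/(inA u).
rewrite andbT [B (hypv u) _ == _]eq_sym -[B b b == _]subr_eq0 -/(d u).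
case: (cond u) => /=; last by rewrite !addr0.
case: (d u == 0); case: (inA u) => /=; rewrite ?addr0 ?add0r //.
by rewrite addrC.
Qed.
End Step.

(** * Generators of Theta and the flag relations *)

Section Gen.
Variable F : finFieldType.
Hypothesis odd_q : odd #|F|.
Implicit Types (A : seq (Vinf F)) (g h k : Orth F) (v : Vinf F) (c d : F) (n : nat).
Local Notation B := (@Vinf_form F).
Local Notation q := #|F|.

Lemma form_hypv n (u : 'rV[F]_n * 'rV[F]_n) :
  B (hypv u) (hypv u) = 2 * \sum_i u.1 0 i * u.2 0 i.
Proof.
have [h1 h2] := hypv_insize u; rewrite (formE _ h1 h2) mulr_sumr.
by apply: eq_bigr => i _ /=; rewrite !coef_rVpoly_ord; ring.
Qed.

(** For a fixed nonzero e-part the norm of a vector of H_n is equidistributed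
    on F; for e-part 0 it is always 0. Multiplying by q clears the denominator. *)
Lemma hyp_sum (M : zmodType) (phi : F -> M) n :
  (\sum_(u : 'rV[F]_n * 'rV[F]_n) phi (B (hypv u) (hypv u))) *+ q
     + (\sum_d phi d) *+ q ^ n
  = phi 0 *+ (q ^ n * q) + (\sum_d phi d) *+ (q ^ n * q ^ n).
Proof.
rewrite (eq_bigr (fun u : 'rV[F]_n * 'rV[F]_n =>
  phi (2 * \sum_i u.1 0 i * u.2 0 i))); last by move=> u _; rewrite form_hypv.
rewrite -(pair_bigA _ (fun a b : 'rV[F]_n => phi (2 * \sum_i a 0 i * b 0 i))) /=.
rewrite (bigD1 0) //= mulrnDl.
have card_rV : #|{: 'rV[F]_n}| = (q ^ n)%N by rewrite card_mx mul1n.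
have -> : \sum_(b : 'rV[F]_n) phi (2 * \sum_i (0 : 'rV[F]_n) 0 i * b 0 i) = phi 0 *+ q ^ n.
  rewrite (eq_bigr (fun=> phi 0)) ?sumr_const ?card_rV // => b _.
  by rewrite big1 ?mulr0 // => i _; rewrite mxE mul0r.
have row_sum (a : 'rV[F]_n) : a != 0 ->
    (\sum_(b : 'rV[F]_n) phi (2 * \sum_i a 0 i * b 0 i)) *+ q = (\sum_d phi d) *+ q ^ n.
  move=> /rV0Pn [i ai].
  (* Adding c b0 to the f-part adds c to the norm, for the e-part a. *)
  pose b0 : 'rV[F]_n := (2 * a 0 i)^-1 *: delta_mx 0 i.
  have b0E (b : 'rV[F]_n) c :
      2 * (\sum_j a 0 j * (b + c *: b0) 0 j) = 2 * (\sum_j a 0 j * b 0 j) + c.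
    rewrite (eq_bigr (fun j => a 0 j * b 0 j + c * (2 * a 0 i)^-1 * (a 0 j * (j == i)%:R))).
      rewrite big_split /= -mulr_sumr mulrDr; congr (_ + _).
      rewrite (bigD1 i) //= big1 => [|j /negbTE->]; last by rewrite mulr0.
      rewrite eqxx mulr1 addr0; field; by rewrite two_neq0 ?ai.
    by move=> j _; rewrite !mxE; ring.
  have cst (x : M) : x *+ q = \sum_(c : F) x by rewrite sumr_const.
  rewrite cst.
  rewrite (eq_bigr (fun c => \sum_(b : 'rV[F]_n) phi (2 * \sum_j a 0 j * b 0 j + c))).
    rewrite exchange_big /= -card_rV -[#|_|]/#|'rV[F]_n| -sumr_const; apply: eq_bigr => b _.
    rewrite [RHS](reindex_inj (addrI (2 * \sum_j a 0 j * b 0 j))).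
    exact: eq_bigl.
  move=> c _; rewrite (reindex_inj (addIr (c *: b0))).
  by apply: eq_bigr => b _; rewrite b0E.
rewrite -mulrnA -addrA; congr (_ + _).
rewrite -sumrMnl (eq_bigr (fun=> (\sum_d phi d) *+ q ^ n)); last exact: row_sum.
rewrite sumr_const -mulrnA -mulrnDr; congr (_ *+ _).
have -> : #|[pred a : 'rV[F]_n | a != 0]| = (q ^ n).-1.
  by rewrite -card_rV (cardC1 (0 : 'rV[F]_n)).
by rewrite addnC -mulnS prednK // expn_gt0 (ltnW (finNzRing_gt1 F)).
Qed.

(** The class of all vectors of norm d orthogonal to H_n, with 0 included. *)
Definition vecs n d : Theta F := nzvecs n d + (d == 0)%:R.

Lemma w_neq0 n d : w_ n d <> 0.
Proof. by move=> e; have := @w_coef F n d; rewrite e coef0 => /eqP; rewrite eq_sym oner_eq0. Qed.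

(** Adjoining a nonzero vector to the empty tuple: only its norm matters. *)
Lemma tau_vec v : v <> 0 -> tau [:: v] [::] = nzvecs 0 (B v v).
Proof.
move=> v0; have [||||g [_ gv]] := @witt_full F odd_q [::] v (w_ 0 (B v v)) => //.
- exact: w_neq0.
- by rewrite form_ww.
by rewrite -(tau_conj g) /= ?gv.
Qed.

(** Multiplication by a is a G-equivariant bijection of V. *)
Lemma nzvecs_sq c a : a != 0 -> nzvecs 0 (a ^+ 2 * c) = nzvecs 0 c.
Proof.
move=> a0; have v0 : a *: w_ 0 c <> 0.
  move/(congr1 (fun v => a^-1 *: v)); rewrite scalerA mulVf // scale1r scaler0.
  exact: w_neq0.
have := tau_vec v0; rewrite formZl formZr form_ww // mulrA -expr2 => <-.
apply: tau_eq => // g; rewrite !gfix_cons; split=> -[e _]; split=> //.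
  have := congr1 (fun v => a^-1 *: v) e; rewrite OrthZ !scalerA mulVf // !scale1r; exact.
by rewrite OrthZ e.
Qed.

(** Vectors of norm c in V, sorted by their projection to H_n. *)
Lemma vecs_split n c :
  vecs 0 c = \sum_(u : 'rV[F]_n * 'rV[F]_n) vecs n (c - B (hypv u) (hypv u)).
Proof.
have := @tau_step F odd_q [::] (w_ 0 c) n; rewrite /= form_ww // => <- //; last exact: w_neq0.
congr (_ + _); congr (_%:R); case: eqVneq => [->|c0].
  rewrite (eq_card (B := pred1 (0 : 'rV[F]_n * 'rV[F]_n))) ?card1 // => u.
  rewrite !inE /=; apply/andP/eqP => [[/asboolP u0 _]|->].
    by apply: hypv_inj; rewrite u0 /hypv !linear0.
  have h0 : hypv (0 : 'rV[F]_n * 'rV[F]_n) = 0 by rewrite /hypv !linear0.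
  by rewrite h0 form0l eqxx; split=> //; apply/asboolP.
rewrite eq_card0 // => u; rewrite !inE /=; apply/andP => -[/asboolP -> ].
by rewrite form0l eq_sym (negbTE c0).
Qed.

(** The class of V, split according to the norm. *)
Definition vecs_total : Theta F := \sum_c vecs 0 c.

(** With Q = q and N = q^n, let x and t be the classes of vectors of norm c
    in V and in the orthogonal complement of H_n, and s and sn the sums of these
    classes over all norms. The two hypotheses are the splitting along H_n, for
    the norm c and summed over the norms; sn is eliminated and t is solved for. *)
Lemma split_solve (R : comPzRingType) (Q N x t s sn : R) :
  x * Q + sn * N = t * (N * Q) + sn * (N * N) ->
  s * Q + sn * (N * Q) = sn * (N * Q) + sn * (N * N * Q) ->
  t * (N * Q * (N * Q)) = x * (N * Q * Q) - s * (N * Q) + s * Q.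
Proof.
move=> h1; rewrite [s * Q + _]addrC => /addrI h2.
have e : t * (N * Q) = x * Q + sn * N - sn * (N * N) by rewrite h1 addrK.
transitivity (t * (N * Q) * (N * Q)); first by ring.
rewrite e; transitivity (x * (N * Q * Q) - sn * (N * N * Q) * N + sn * (N * N * Q)).
  by ring.
by rewrite -h2; ring.
Qed.

Lemma split_solve_nat (R : comPzRingType) (Q N : nat) (x t s sn : R) :
  x *+ Q + sn *+ N = t *+ (N * Q) + sn *+ (N * N) ->
  s *+ Q + sn *+ (N * Q) = sn *+ (N * Q) + sn *+ (N * N * Q) ->
  t *+ (N * Q * (N * Q)) = x *+ (N * Q * Q) - s *+ (N * Q) + s *+ Q.
Proof.
have E (y : R) (k : nat) : y *+ k = y * k%:R by rewrite mulr_natr.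
by rewrite !(E x) !(E sn) !(E t) !(E s) !natrM; apply: split_solve.
Qed.

(** The classes of vectors orthogonal to H_n are recovered from those of
    vectors of V, up to a power of q. *)
Lemma vecs_inv n c : vecs n c *+ (q ^ n * q * (q ^ n * q)) =
  vecs 0 c *+ (q ^ n * q * q) - vecs_total *+ (q ^ n * q) + vecs_total *+ q.
Proof.
pose sn := \sum_d vecs n d.
have sumB c' : \sum_d vecs n (c' - d) = sn.
  rewrite /sn [RHS](reindex_inj (inv_inj (subKr c'))); exact: eq_bigr.
have E c' : vecs 0 c' *+ q + sn *+ q ^ n = vecs n c' *+ (q ^ n * q) + sn *+ (q ^ n * q ^ n).
  by rewrite (vecs_split n) -(sumB c') (hyp_sum (fun d => vecs n (c' - d))) subr0.
have E2 : vecs_total *+ q + sn *+ (q ^ n * q) = sn *+ (q ^ n * q) + sn *+ (q ^ n * q ^ n * q).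
  have : \sum_c (vecs 0 c *+ q + sn *+ q ^ n) =
         \sum_c (vecs n c *+ (q ^ n * q) + sn *+ (q ^ n * q ^ n)).
    by apply: eq_bigr => d _; apply: E.
  rewrite !big_split /= !sumrMnl !sumr_const -!mulrnA !(mulnC #|xpredT|).
  by [].
exact: split_solve_nat (E c) E2.
Qed.

Section Generation.
Variable Pr : Theta F -> Prop.
Hypothesis Pr1 : Pr 1.
Hypothesis PrB : forall x y, Pr x -> Pr y -> Pr (x - y).
Hypothesis PrM : forall x y, Pr x -> Pr y -> Pr (x * y).
Hypothesis Prq : forall x, Pr (x *+ q) -> Pr x.
Hypothesis Prx : forall c, Pr (nzvecs 0 c).

(** Every class is a product of classes of one-vector extensions; these are
    integral combinations of the [vecs n c], and the latter are combinations of
    the [nzvecs 0 c] after multiplication by a power of q. *)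
Lemma Theta_generated z : Pr z.
Proof.
have Pr0 : Pr 0 by rewrite -(subrr 1); apply: PrB.
have PrD x y : Pr x -> Pr y -> Pr (x + y).
  move=> Px Py; rewrite -[y]opprK; apply: PrB => //; rewrite -sub0r; exact: PrB.
have PrMn x n : Pr x -> Pr (x *+ n).
  move=> Px; elim: n => [|n IH]; first by rewrite mulr0n.
  by rewrite mulrS; apply: PrD.
have PrS (I : Type) (r : seq I) (P : pred I) (G : I -> Theta F) :
    (forall i, Pr (G i)) -> Pr (\sum_(i <- r | P i) G i).
  by move=> PG; elim/big_ind: _.
have Prqn x n : Pr (x *+ q ^ n) -> Pr x.
  elim: n => [|n IH]; first by rewrite expn0 mulr1n.
  by rewrite expnSr mulrnA => /Prq.
have Prt0 c : Pr (vecs 0 c) by apply: PrD => //; apply: PrMn.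
have PrS0 : Pr vecs_total by apply: PrS.
have PrTt n c : Pr (vecs n c).
  apply: (@Prqn _ (n.+1 + n.+1)%N); rewrite expnD expnSr vecs_inv.
  by apply: PrD; [apply: PrB|]; apply: PrMn.
have Pr_step A b : Pr (tau (b :: A) A).
  have [Ab|nb] := pselect (lspan A b).
    rewrite tau1 // => g; rewrite gfix_cons; split=> [[]//|gA].
    by split=> //; apply: gfix_span gA.
  have [n AH] := insize_ex A.
  have e := tau_step odd_q AH nb.
  rewrite -[tau _ _](addrK (#|[pred u : 'rV[F]_n * 'rV[F]_n | [&& all (fun a => B a (hypv u) == B a b) A,
        `[< lspan A (hypv u) >] & B (hypv u) (hypv u) == B b b] ]|%:R : Theta F)) e.
  apply: PrB; last exact: PrMn.
  by apply: PrS => u; apply: PrTt.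
have Pr_cat C A : Pr (tau (C ++ A) A).
  elim: C => [|b C IH]; first by rewrite tau1.
  rewrite (tau_comp (B := C ++ A)); first exact: (PrM (Pr_step _ _) IH).
    by move=> g; apply: gfix_consr.
  exact: fixsub_catr.
apply: Theta_ind; [exact: Pr1|exact: PrB|exact: PrM|move=> Y X f].
have [y0 _] := tsset_trans Y.
have [C stC] := tsset_stab y0; have [A stA] := tsset_stab (f y0).
rewrite (Tclass_tau stC stA).
have CA : fixsub C A by move=> g /stC e; apply/stA; rewrite -gmapP e.
rewrite (_ : tau C A = tau (C ++ A) A); first exact: Pr_cat.
apply: tau_eq => // g.
by rewrite gfix_cat; split=> [gC|[]//]; split=> //; apply: CA.
Qed.
End Generation.

(** The class over a vector p of norm c of the set of vectors of norm d whose
    pairing with p is m, when c d <> m ^ 2. The parameter x is the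
    e_0-coordinate of such a vector, with p = e_0 + c / 2 f_0 in H_1. *)
Definition Phi c m d : Theta F := \sum_x vecs 1 (c * x ^+ 2 - 2 * m * x + d).

(** Reduction to the pulled back extension over H_1. The condition on the
    Gram determinant excludes vectors proportional to p1, so that no correction
    term appears. *)
Lemma tau_pair p1 p2 : p1 <> 0 -> ~ lspan [:: p1] p2 ->
  B p1 p1 * B p2 p2 != B p1 p2 ^+ 2 ->
  tau [:: p2; p1] [:: p1] = Phi (B p1 p1) (B p1 p2) (B p2 p2).
Proof.
set c := B p1 p1; set m := B p1 p2; set d := B p2 p2 => p10 np2 cdm.
have [||||g [_ gp1]] := @witt_full F odd_q [::] p1 (w_ 0 c) => //.
- exact: w_neq0.
- by rewrite form_ww.
rewrite -(tau_conj g); last by move=> h; apply: gfix_consr.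
rewrite /= gp1; set b := g p2.
have bb : B b b = d by rewrite Orth_form.
have wb : B (w_ 0 c) b = m by rewrite -gp1 Orth_form.
have nb : ~ lspan [:: w_ 0 c] b by rewrite -gp1 (lspan_map g [:: p1]).
have w0 : insize 1 (w_ 0 c).
  by apply/Esp_false/(linD (Esp_lin F false 1));
    [apply: Esp_e|apply: linZ; [apply: Esp_lin|apply: Esp_f]].
have AH a : a \in [:: w_ 0 c] -> insize 1 a by rewrite inE => /eqP->.
have := tau_step odd_q AH nb; rewrite bb eq_card0 ?addr0 => [->|]; last first.
  move=> u; rewrite !inE /= andbT wb; apply/and3P => -[/eqP hm /asboolP [a]].
  move=> /eqP; rewrite subr_eq0 => /eqP hu /eqP hd; move: hm hd; rewrite hu.
  rewrite formZl !formZr form_ww // => hm hd.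
  by move/eqP: cdm; apply; rewrite -hm -hd; ring.
have wu (u : 'rV[F]_1 * 'rV[F]_1) :
    B (w_ 0 c) (hypv u) = u.2 0 0 + c / 2 * u.1 0 0.
  by rewrite formC form_w /= -[0%N]/(nat_of_ord (0 : 'I_1)) !coef_rVpoly_ord.
have uu (u : 'rV[F]_1 * 'rV[F]_1) : B (hypv u) (hypv u) = 2 * (u.1 0 0 * u.2 0 0).
  by rewrite form_hypv big_ord1.
(* The vectors of H_1 whose pairing with e_0 + c / 2 f_0 is m. *)
pose h (x : F) : 'rV[F]_1 * 'rV[F]_1 := (const_mx x, const_mx (m - c / 2 * x)).
rewrite (reindex_onto h (fun u => u.1 0 0)) /=.
  apply: eq_big => [x|x _]; first by rewrite andbT wb wu /= !mxE subrK !eqxx.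
  rewrite uu /= !mxE; congr vecs.
  rewrite -[c in RHS](halfD odd_q); ring.
move=> [u1 u2]; rewrite wu wb andbT /= => /eqP hm; rewrite /h; congr pair.
  by apply/matrixP => i j; rewrite !ord1 mxE.
by apply/matrixP => i j; rewrite !ord1 mxE -hm addrK.
Qed.

(** Both sides are the class of the set of pairs of vectors with Gram matrix
    (c, m; m, d): the pair can be built starting from either vector. *)
Lemma Phi_rel c m d : c * d != m ^+ 2 -> nzvecs 0 c * Phi c m d = nzvecs 0 d * Phi d m c.
Proof.
move=> cdm; pose p1 := w_ 0 c; pose p2 := m *: f_ F 0 + w_ 1 d.
have p11 : B p1 p1 = c by rewrite form_ww.
have p12 : B p1 p2 = m.
  by rewrite formDr formZr form_f w_coef form_w /= !(coefD, coefZ, coef0, coefXn) /=; ring.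
have p22 : B p2 p2 = d.
  have w0 : (w_ 1 d).1`_0 = 0 by rewrite /= !(coefD, coefZ, coef0, coefXn) /=; ring.
  rewrite /p2; move: (form_ww odd_q 1 d) w0; move: (w_ 1 d) => w ww w0.
  by rewrite !formL !form_f formC form_f w0 ww /= coef0; ring.
have c1 : p1.1`_1 = 0 by rewrite /= !(coefD, coefZ, coef0, coefXn) /= mulr0 addr0.
have c2 : p2.1`_1 = 1 by rewrite coefD w_coef coefZ coef0 mulr0 add0r.
have p10 : p1 <> 0 by exact: w_neq0.
have p20 : p2 <> 0.
  by move=> e; move: c2; rewrite e coef0 => /eqP; rewrite eq_sym oner_eq0.
have n2 : ~ lspan [:: p1] p2.
  move=> [a /eqP]; rewrite subr_eq0 => /eqP e; move: c2; rewrite e coefZ c1 mulr0.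
  by move/eqP; rewrite eq_sym oner_eq0.
have n1 : ~ lspan [:: p2] p1.
  move=> [a /eqP]; rewrite subr_eq0 => /eqP e; move: c1; rewrite e coefZ c2 mulr1 => a0.
  by apply: p10; rewrite e a0 scale0r.
have swap : tau [:: p2; p1] [::] = tau [:: p1; p2] [::].
  by apply: tau_eq => // g; rewrite !gfix_cons; split=> -[? [? ?]].
have fx (p p' : Vinf F) : tau [:: p; p'] [::] = tau [:: p; p'] [:: p'] * tau [:: p'] [::].
  by apply: tau_comp => g // /gfix_consr.
have p21 : B p2 p1 = m by rewrite formC.
have := tau_pair p10 n2; have := tau_pair p20 n1.
rewrite p11 p12 p21 p22 (mulrC d c) => /(_ cdm) e1 /(_ cdm) e2.
have := fx p2 p1; have := fx p1 p2; rewrite e1 e2 (tau_vec p10) (tau_vec p20) p11 p22 -swap.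
move=> h1 h2; rewrite (mulrC (nzvecs 0 c)) (mulrC (nzvecs 0 d)).
exact: etrans (esym h2) h1.
Qed.
End Gen.

(** * Quadratic character sums *)

Section Chi.
Variable F : finFieldType.
Hypothesis odd_q : odd #|F|.
Implicit Types (a c d x y : F).
Local Notation q := #|F|.

Definition nsqrt d : nat := #|[pred x : F | x ^+ 2 == d]|.
(** The quadratic character of F, with value 0 at 0. *)
Definition chi d : int := (nsqrt d)%:R - 1.

Lemma nsqrt0 : nsqrt 0 = 1%N.
Proof. by rewrite -(card1 (0 : F)); apply: eq_card => x; rewrite !inE expf_eq0. Qed.

Lemma neg_neq a : a != 0 -> a != - a.
Proof.
move=> a0; rewrite -subr_eq0 opprK -mulr2n -mulr_natr mulf_eq0 negb_or a0.
exact: two_neq0.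
Qed.

Lemma nsqrt_sq a : a != 0 -> nsqrt (a ^+ 2) = 2%N.
Proof.
move=> a0; transitivity #|pred2 a (- a)|; last by rewrite card2 neg_neq.
by apply: eq_card => x; rewrite !inE eqf_sqr.
Qed.

Lemma nsqrt_cases d : [\/ d = 0, exists2 a, a != 0 & d = a ^+ 2 | nsqrt d = 0%N].
Proof.
have [->|d0] := eqVneq d 0; first exact: Or31.
have [/existsP[a /eqP ad]|h] := boolP [exists a, a ^+ 2 == d].
  by apply: Or32; exists a; rewrite // -sqrf_eq0 ad.
apply: Or33; apply: eq_card0 => x; rewrite !inE; apply: contraNF h => hx.
by apply/existsP; exists x.
Qed.

Lemma sum_nsqrt : (\sum_d nsqrt d)%N = q.
Proof.
rewrite /nsqrt -sum1_card (eq_bigr (fun d => \sum_(x | x ^+ 2 == d) 1)%N); last first.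
  by move=> d _; rewrite sum1_card.
rewrite (exchange_big_dep predT) //=; apply: eq_bigr => x _.
by rewrite sum1_card (eq_card (B := pred1 (x ^+ 2))) ?card1 // => d; rewrite !inE eq_sym.
Qed.

Lemma sum_chi : \sum_d chi d = 0.
Proof. by rewrite /chi sumrB sumr_const -natr_sum sum_nsqrt subrr. Qed.

Lemma chi0 : chi 0 = 0. Proof. by rewrite /chi nsqrt0. Qed.
Lemma chi_sq a : a != 0 -> chi (a ^+ 2) = 1. Proof. by move=> a0; rewrite /chi nsqrt_sq. Qed.

Lemma chi_sqM a d : a != 0 -> chi (a ^+ 2 * d) = chi d.
Proof.
move=> a0; congr (_%:R - 1); rewrite /nsqrt -!sum1_card (reindex_inj (mulfI a0)) /=.
by apply: eq_bigl => x; rewrite !inE exprMn (inj_eq (mulfI (expf_neq0 2 a0))).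
Qed.

Lemma chi_le1 d : chi d <= 1.
Proof. by have [->|[a a0 ->]|h] := nsqrt_cases d; rewrite ?chi0 ?chi_sq // /chi h. Qed.

(** The sums chi x + chi (c x) are all nonpositive, and their total over x is
    0, so each of them vanishes. *)
Lemma chi_nonsq c d : nsqrt c = 0%N -> chi (c * d) = - chi d.
Proof.
move=> hc; apply/eqP; rewrite -addr_eq0 addrC -oppr_eq0; apply/eqP.
have c0 : c != 0 by apply/eqP => c0; rewrite c0 nsqrt0 in hc.
have le0 x : 0 <= - (chi x + chi (c * x)).
  rewrite oppr_ge0; have [->|[a a0 ->]|h] := nsqrt_cases x.
  - by rewrite mulr0 chi0.
  - by rewrite chi_sq // mulrC chi_sqM // /chi hc.
  - by rewrite {1}/chi h sub0r addrC subr_le0 chi_le1.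
have /eqP : \sum_x - (chi x + chi (c * x)) = 0.
  have E : \sum_x chi (c * x) = 0.
    by rewrite -[RHS]sum_chi [RHS](reindex_inj (mulfI c0)).
  by rewrite sumrN big_split /= E sum_chi addr0 oppr0.
rewrite psumr_eq0 => [/allP/(_ d)|x _]; last exact: le0.
by rewrite mem_index_enum => /(_ isT) /eqP.
Qed.

Lemma chiM c d : chi (c * d) = chi c * chi d.
Proof.
have [->|[a a0 ->]|h] := nsqrt_cases c.
- by rewrite mul0r chi0 mul0r.
- by rewrite chi_sqM // chi_sq // mul1r.
- by rewrite chi_nonsq // {2}/chi h sub0r mulN1r.
Qed.

Lemma nonsq_ex : exists c, nsqrt c = 0%N.
Proof.
apply/not_existsP => h; have := sum_chi; rewrite (bigD1 0) //= chi0 add0r.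
rewrite (eq_bigr (fun=> 1)) => [/eqP|x x0]; last first.
  by have [/eqP|[a a0 ->]|/h//] := nsqrt_cases x; rewrite ?(negbTE x0) ?chi_sq.
rewrite sumr_const pnatr_eq0 => /eqP/card0_eq/(_ 1).
by rewrite unfold_in oner_eq0.
Qed.

(** Nonsquares form a single class modulo squares: by multiplicativity c d is
    a square. *)
Lemma nonsq_class c d : nsqrt c = 0%N -> nsqrt d = 0%N -> exists2 a, a != 0 & d = a ^+ 2 * c.
Proof.
move=> hc hd; have := chi_nonsq d hc; rewrite {2}/chi hd sub0r opprK => h.
have c0 : c != 0 by apply/eqP => c0; rewrite c0 nsqrt0 in hc.
have [e|[a a0 e]|h0] := nsqrt_cases (c * d).
- by move: h; rewrite e chi0.
- exists (a / c); first by rewrite mulf_neq0 ?invr_eq0.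
  by rewrite exprMn -e; field.
- by move: h; rewrite /chi h0.
Qed.

(** Points of the hyperbola y ^ 2 = x ^ 2 - D. In terms of a = x - y the
    equation is 2 x a = a ^ 2 + D, with exactly one solution x for a <> 0 and
    none for a = 0. *)
Lemma sum_nsqrt_shift D : D != 0 -> (\sum_(x : F) nsqrt (x ^+ 2 - D)%R = q.-1)%N.
Proof.
move=> D0; rewrite /nsqrt.
rewrite (eq_bigr (fun x => \sum_(a : F) (2 * x * a == a ^+ 2 + D)%R)%N); last first.
  move=> x _; rewrite -sum1_card big_mkcond (reindex_inj (inv_inj (subKr x))) /=.
  apply: eq_bigr => a _; rewrite inE; congr nat_of_bool.
  apply/eqP/eqP => h.
    have -> : 2 * x * a = x ^+ 2 + a ^+ 2 - (x - a) ^+ 2 by ring.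
    by rewrite h; ring.
  have -> : (x - a) ^+ 2 = x ^+ 2 + a ^+ 2 - 2 * x * a by ring.
  by rewrite h; ring.
rewrite exchange_big /= (bigD1 0) //= big1 => [|x _]; last first.
  by rewrite mulr0 expr0n add0r eq_sym (negbTE D0).
rewrite add0n (eq_bigr (fun=> 1%N)) => [|a a0].
  by rewrite sum1_card (cardC1 (0 : F)).
rewrite (bigD1 ((a ^+ 2 + D) / (2 * a))) //= big1 => [|x]; last first.
  move=> /eqP xa; apply/eqP; rewrite eqb0; apply/eqP => e; apply: xa.
  by rewrite -e; field; rewrite two_neq0 ?a0.
rewrite addn0; have -> // : 2 * ((a ^+ 2 + D) / (2 * a)) * a = a ^+ 2 + D.
  by field; rewrite two_neq0 ?a0.
by rewrite eqxx.
Qed.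

Lemma sum_chi_shift D : D != 0 -> \sum_x chi (x ^+ 2 - D) = -1.
Proof.
move=> D0; rewrite /chi sumrB sumr_const -natr_sum sum_nsqrt_shift //.
by rewrite -{2}(@prednK q) ?(ltnW (finNzRing_gt1 F)) // -natr1 opprD addNKr.
Qed.

(** Completing the square reduces this to x ^ 2 - D. *)
Lemma sum_chi_quad c m d : c != 0 -> m ^+ 2 - c * d != 0 ->
  \sum_x chi (c * x ^+ 2 - 2 * m * x + d) = - chi c.
Proof.
move=> c0 D0.
have cc : chi c * chi c = 1 by rewrite -chiM -expr2 chi_sq.
rewrite (eq_bigr (fun x => chi c * chi ((c * x - m) ^+ 2 - (m ^+ 2 - c * d)))).
  rewrite -mulr_sumr -(reindex_inj (h := fun x => c * x - m) (P := predT)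
    (F := fun y => chi (y ^+ 2 - (m ^+ 2 - c * d)))) ?sum_chi_shift ?mulrN1 //.
  by apply: inj_comp (addIr _) (mulfI c0).
move=> x _; rewrite -[LHS]mul1r -{1}cc -mulrA -chiM; congr (_ * chi _); ring.
Qed.

Lemma sum_root_quad c m d : c != 0 ->
  (\sum_(x : F) (c * x ^+ 2 - 2 * m * x + d == 0)%R)%N = nsqrt (m ^+ 2 - c * d).
Proof.
move=> c0; rewrite /nsqrt -sum1_card [RHS]big_mkcond.
rewrite [RHS](reindex_inj (h := fun x => c * x - m)) /=; last first.
  by apply: inj_comp (addIr _) (mulfI c0).
apply: eq_bigr => x _; rewrite inE -[in RHS]subr_eq0.
have -> : (c * x - m) ^+ 2 - (m ^+ 2 - c * d) = c * (c * x ^+ 2 - 2 * m * x + d) by ring.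
by rewrite mulf_eq0 (negbTE c0) /=; case: eqP.
Qed.

(** Otherwise every value of chi (x ^ 2 - c) is 1, since c is not a square;
    but these values add up to -1. *)
Lemma nonsq_disc c : nsqrt c = 0%N -> exists m, nsqrt (m ^+ 2 - c) = 0%N.
Proof.
move=> hc; apply/not_existsP => h.
have c0 : c != 0 by apply/eqP => c0; rewrite c0 nsqrt0 in hc.
have := sum_chi_shift c0; rewrite (eq_bigr (fun=> 1)) => [|x _].
  by rewrite sumr_const => /eqP; rewrite -subr_eq0 opprK natr1 pnatr_eq0.
have [e|[a a0 ->]|/h//] := nsqrt_cases (x ^+ 2 - c); last by rewrite chi_sq.
move/eqP: e; rewrite subr_eq0 => /eqP e; move: hc; rewrite -e.
have [->|x0] := eqVneq x 0; first by rewrite expr0n nsqrt0.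
by rewrite nsqrt_sq.
Qed.
End Chi.

(** * Consequences of the flag relations *)

Section NodeAlg.
Variable F : finFieldType.
Hypothesis odd_q : odd #|F|.
Local Notation q := #|F|.
(* T0 c, T1 c and X c are the images of nzvecs 0 c, vecs 1 c and vecs 0 c in a ring
   in which 2 and q are invertible, with inverses D2 and Dq. *)
Variables (L : comPzRingType) (T0 T1 : F -> L) (D2 Dq : L).
Local Notation Q := (q%:R : L).
Hypotheses (hD2 : 2%:R * D2 = 1) (hDq : Q * Dq = 1).
Let X c : L := T0 c + (c == 0)%:R.
Let S : L := \sum_c X c.
Hypothesis Hinv : forall c, T1 c * Q ^+ 4 = X c * Q ^+ 3 - S * Q ^+ 2 + S * Q.
Hypothesis Hsq : forall a c, a != 0 -> T0 (a ^+ 2 * c) = T0 c.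
Let Phi c m d : L := \sum_x T1 (c * x ^+ 2 - 2 * m * x + d).
Hypothesis Hrel : forall c m d, c * d != m ^+ 2 -> T0 c * Phi c m d = T0 d * Phi d m c.
Variable eps : F.
Hypothesis eps_ns : nsqrt eps = 0%N.

Let s : L := D2 * (T0 1 + T0 eps).
Let o : L := D2 * (T0 1 - T0 eps).
Let e : L := T0 0 + 1 - s.

Lemma cancelQ x y : Q * x = Q * y -> x = y.
Proof.
move=> h; rewrite -[x]mul1r -[y]mul1r -hDq (mulrC Q) -!mulrA; congr (_ * _); exact: h.
Qed.
Lemma cancel2 (x y : L) : 2%:R * x = 2%:R * y -> x = y.
Proof.
move=> h; rewrite -[x]mul1r -[y]mul1r -hD2 (mulrC 2%:R) -!mulrA; congr (_ * _); exact: h.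
Qed.

Lemma eps_neq0 : eps != 0.
Proof. by apply/eqP => h; move: eps_ns; rewrite h nsqrt0. Qed.

Lemma T0_1 : T0 1 = s + o.
Proof. by rewrite -[LHS]mul1r -hD2 /s /o; ring. Qed.
Lemma T0_eps : T0 eps = s - o.
Proof. by rewrite -[LHS]mul1r -hD2 /s /o; ring. Qed.
Lemma T0_0 : T0 0 = s + e - 1.
Proof. by rewrite /e; ring. Qed.

(** X takes one value on 0, one on nonzero squares and one on nonsquares, and
    s, e, o are chosen so that it is the sum of a constant, a multiple of the
    indicator of 0 and a multiple of the quadratic character. *)
Lemma XE c : X c = s + e * (c == 0)%:R + o * (chi c)%:~R.
Proof.
rewrite /X; have [->|[a a0 ->]|h] := nsqrt_cases c.
- by rewrite eqxx chi0 T0_0 /= !(mulr1n, mulr0z); ring.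
- rewrite -[a ^+ 2]mulr1 Hsq // mulr1 chi_sq // T0_1 sqrf_eq0 (negbTE a0) /= mulr0n; ring.
have [a a0 ->] := nonsq_class odd_q eps_ns h.
rewrite Hsq // T0_eps mulf_eq0 sqrf_eq0 (negbTE a0) (negbTE eps_neq0) /= mulr0n.
by rewrite chi_sqM // /chi eps_ns sub0r mulrN1z; ring.
Qed.

Lemma sumX (p : F -> F) :
  \sum_x X (p x) = s * Q + e * (\sum_x (p x == 0)%R)%N%:R + o * (\sum_x chi (p x))%:~R.
Proof.
rewrite mulrz_sumr natr_sum (eq_bigr _ (fun x _ => XE (p x))).
rewrite [LHS]big_split /= [X in X + _ = _]big_split /= sumr_const -(mulr_natr s).
by congr (_ + _ + _); rewrite mulr_sumr.
Qed.

Lemma SE : S = s * Q + e.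
Proof.
rewrite /S (sumX id) sum_chi mulr0z mulr0 addr0; congr (_ + _).
rewrite (bigD1 0) //= eqxx big1 ?addn0 ?mulr1 // => x /negbTE-> //.
Qed.

(** The inversion formula turns Phi, a sum of classes relative to H_1, into a
    sum of the classes X. *)
Lemma PhiE c m d : Phi c m d * Q ^+ 4 =
  (\sum_x X (c * x ^+ 2 - 2 * m * x + d)) * Q ^+ 3 - S * Q ^+ 3 + S * Q ^+ 2.
Proof.
rewrite /Phi mulr_suml (eq_bigr _ (fun x _ => Hinv _)) big_split sumrB /=.
have cst (y : L) : \sum_(x : F) y = y * Q by rewrite sumr_const mulr_natr.
by rewrite !cst -mulr_suml; ring.
Qed.

Lemma cancelQn k x y : x * Q ^+ k = y * Q ^+ k -> x = y.
Proof.
elim: k => [|k IH]; first by rewrite expr0 !mulr1.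
move=> h; apply: IH; apply: cancelQ; rewrite -[LHS]mulrC -[RHS]mulrC -!mulrA -exprSr; exact: h.
Qed.

Lemma Phi_c c m d : c != 0 -> m ^+ 2 - c * d != 0 ->
  Phi c m d * Q ^+ 2 =
  s * Q + e + e * (chi (m ^+ 2 - c * d))%:~R * Q - o * (chi c)%:~R * Q.
Proof.
move=> c0 D0; apply: (@cancelQn 2); rewrite -mulrA -exprD PhiE sumX SE.
rewrite sum_chi_quad // sum_root_quad //.
have -> : (nsqrt (m ^+ 2 - c * d))%:R = 1 + (chi (m ^+ 2 - c * d))%:~R :> L.
  by rewrite /chi mulrzBr mulr1z mulrz_nat; ring.
rewrite mulrNz; ring.
Qed.

Lemma Phi_0 m d : m != 0 -> Phi 0 m d * Q ^+ 2 = s * Q + e.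
Proof.
move=> m0; apply: (@cancelQn 2); rewrite -mulrA -exprD PhiE -SE.
have -> : \sum_x X (0 * x ^+ 2 - 2 * m * x + d) = S.
  rewrite /S [RHS](reindex_inj (h := fun x => 0 * x ^+ 2 - 2 * m * x + d)) //.
  apply: inj_comp (addIr d) _ => x y; rewrite !mul0r !sub0r => /oppr_inj.
  by apply: mulfI; rewrite mulf_neq0 // two_neq0.
ring.
Qed.

Lemma chi1 : chi (1 : F) = 1.
Proof. by rewrite -(expr1n _ 2) chi_sq ?oner_neq0. Qed.

Lemma chi_eps : chi eps = -1. Proof. by rewrite /chi eps_ns sub0r. Qed.

(** Three flag relations suffice: those with Gram matrices (1, 1; 1, 0) and
    (eps, 1; 1, 0), and one with (1, m; m, eps) where m ^ 2 - eps is not a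
    square. In the first two the discriminant is a square. The difference of the
    first two and the third relation therefore differ in one sign, which
    isolates 4 e o; the sum of the first two yields s. *)
Lemma node_rels : e * o = 0 /\ s * Q = e ^+ 2 - e + o ^+ 2 * Q.
Proof.
have [m hm] := nonsq_disc odd_q eps_ns.
have mE : m ^+ 2 - 1 * eps != 0.
  by apply/eqP => h; move: hm; rewrite -(mul1r eps) h nsqrt0.
have mE' : m ^+ 2 - eps * 1 != 0 by rewrite mulrC.
have chim : chi (m ^+ 2 - eps) = -1 by rewrite /chi hm sub0r.
have D1 c : (1 : F) ^+ 2 - c * 0 = 1 by rewrite expr1n mulr0 subr0.
have D1' c : (1 : F) ^+ 2 - c * 0 != 0 by rewrite D1 oner_neq0.
have ne1 c : c * 0 != (1 : F) ^+ 2 by rewrite mulr0 expr1n eq_sym oner_neq0.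
have R (c m' d : F) : c * d != m' ^+ 2 ->
    T0 c * (Phi c m' d * Q ^+ 2) = T0 d * (Phi d m' c * Q ^+ 2).
  by move=> h; rewrite !mulrA Hrel.
(* The Gram matrices (1, 1; 1, 0), (eps, 1; 1, 0) and (1, m; m, eps). *)
have r1 := R 1 1 0 (ne1 _); have r2 := R eps 1 0 (ne1 _).
have r3 := R 1 m eps _.
have {r3} := r3 (_ : 1 * eps != m ^+ 2); rewrite -subr_eq0 -oppr_eq0 opprB => /(_ mE) r3.
rewrite T0_1 T0_0 Phi_c ?oner_neq0 // Phi_0 ?oner_neq0 // D1 chi1 in r1.
rewrite T0_eps T0_0 Phi_c ?eps_neq0 // Phi_0 ?oner_neq0 // D1 chi1 chi_eps in r2.
rewrite T0_1 T0_eps Phi_c ?oner_neq0 // Phi_c ?eps_neq0 // mul1r mulr1 chim chi1 chi_eps in r3.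
rewrite !(mulrN1z, mulr1z) in r1 r2 r3.
split.
  apply: cancel2; apply: cancel2; rewrite !mulr0.
  have e12 : (s + o) * (s * Q + e + e * 1 * Q - o * 1 * Q) -
     (s - o) * (s * Q + e + e * 1 * Q - o * - 1 * Q) = 0 by rewrite r1 r2 subrr.
  have e3 : (s + o) * (s * Q + e + e * - 1 * Q - o * 1 * Q) -
     (s - o) * (s * Q + e + e * -1 * Q - o * - 1 * Q) = 0 by rewrite r3 subrr.
  by rewrite -[RHS](addr0 0) -{1}e12 -e3; ring.
apply: cancel2; apply/eqP; rewrite -subr_eq0; apply/eqP.
have e12 : (s + o) * (s * Q + e + e * 1 * Q - o * 1 * Q) +
     (s - o) * (s * Q + e + e * 1 * Q - o * - 1 * Q) - 2%:R * ((s + e - 1) * (s * Q + e)) = 0.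
  by rewrite r1 r2; ring.
by rewrite -[RHS]e12; ring.
Qed.
End NodeAlg.

(** * Evaluation at two elements with product zero *)

Section Ev.
Variable L : comPzRingType.
Implicit Types (f g : {poly int}) (y : L) (c : int).

(** The value at y of an integral polynomial. It is defined directly since L
    may be the zero ring. *)
Definition ev f y : L := foldr (fun c acc => acc * y + c%:~R) 0 (f : seq int).

Lemma ev0 y : ev 0 y = 0.
Proof. by rewrite /ev polyseq0. Qed.

Lemma ev_cons f c y : ev (f * 'X + c%:P) y = ev f y * y + c%:~R.
Proof.
rewrite -cons_poly_def /ev polyseq_cons; case: ifP => //= /negbFE/nilP f0.
rewrite f0 polyseqC /= mul0r add0r; have [->|c0] := eqVneq c 0; first by rewrite mulr0z.
by rewrite /= mul0r add0r.
Qed.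

Lemma evC c y : ev c%:P y = c%:~R.
Proof. by have := ev_cons 0 c y; rewrite mul0r add0r ev0 mul0r add0r. Qed.

Lemma evD f g y : ev (f + g) y = ev f y + ev g y.
Proof.
elim/poly_ind: f g => [|f a IH] g; first by rewrite ev0 !add0r.
elim/poly_ind: g => [|g b _]; first by rewrite ev0 !addr0.
have -> : f * 'X + a%:P + (g * 'X + b%:P) = (f + g) * 'X + (a + b)%:P.
  by rewrite polyCD; ring.
by rewrite !ev_cons IH mulrzDr; ring.
Qed.

Lemma evCM c f y : ev (c%:P * f) y = c%:~R * ev f y.
Proof.
elim/poly_ind: f => [|f a IH]; first by rewrite mulr0 ev0 mulr0.
have -> : c%:P * (f * 'X + a%:P) = (c%:P * f) * 'X + (c * a)%:P by rewrite polyCM; ring.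
by rewrite !ev_cons IH intrM; ring.
Qed.

Lemma evM f g y : ev (f * g) y = ev f y * ev g y.
Proof.
elim/poly_ind: f => [|f a IH]; first by rewrite mul0r ev0 mul0r.
have -> : (f * 'X + a%:P) * g = ((f * g) * 'X + 0%:P) + a%:P * g by rewrite polyC0; ring.
by rewrite evD evCM !ev_cons IH mulr0z; ring.
Qed.

Lemma evX y : ev 'X y = y.
Proof. by have := ev_cons 1 0 y; rewrite mul1r polyC0 addr0 evC mul1r addr0. Qed.

Lemma ev_split0 f y : exists w, ev f y = y * w + (f`_0)%:~R.
Proof.
elim/poly_ind: f => [|f a _]; first by exists 0; rewrite ev0 coef0 mulr0 addr0.
by exists (ev f y); rewrite ev_cons coefD coefMX coefC /= add0r mulrC.
Qed.

(** The mixed terms in the product of f(y) and g(z) come from the constant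
    coefficients only. *)
Lemma ev_cross f g y z : y * z = 0 ->
  ev f y * ev g z = (g`_0)%:~R * ev f y + (f`_0)%:~R * ev g z - (f`_0 * g`_0)%:~R.
Proof.
move=> yz; have [u ->] := ev_split0 f y; have [w ->] := ev_split0 g z.
rewrite intrM; transitivity (y * z * (u * w) + (y * u * (g`_0)%:~R
  + (f`_0)%:~R * (z * w) + (f`_0)%:~R * (g`_0)%:~R)); first by ring.
by rewrite yz; ring.
Qed.
End Ev.

Lemma rmorph_ev (L L' : comPzRingType) (h : {rmorphism L -> L'}) f y :
  h (ev f y) = ev f (h y).
Proof.
elim/poly_ind: f => [|f a IH]; first by rewrite !ev0 rmorph0.
by rewrite !ev_cons rmorphD rmorphM IH rmorph_int.
Qed.

Section NodeForm.
Variables (L : comPzRingType) (N : nat) (y z : L).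
Hypothesis yz : y * z = 0.

(** Up to a power of N, x is the value of a function on the two branches
    parametrised by y and z. *)
Definition node_form (x : L) : Prop := exists (k : nat) (f g : {poly int}),
  x * N%:R ^+ k = ev f y + ev g z.

Lemma node_formB x x' : node_form x -> node_form x' -> node_form (x - x').
Proof.
move=> [k [f [g e]]] [k' [f' [g' e']]].
exists (k + k')%N, ((N ^ k')%:R%:P * f + (- (N ^ k)%:R)%:P * f'),
  ((N ^ k')%:R%:P * g + (- (N ^ k)%:R)%:P * g').
rewrite !evD !evCM mulrNz !mulrz_nat !natrX exprD mulrBl.
transitivity (N%:R ^+ k' * (x * N%:R ^+ k) - N%:R ^+ k * (x' * N%:R ^+ k')); first by ring.
by rewrite e e'; ring.
Qed.

Lemma node_formM x x' : node_form x -> node_form x' -> node_form (x * x').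
Proof.
move=> [k [f [g e]]] [k' [f' [g' e']]].
exists (k + k')%N, (f * f' + (g'`_0)%:P * f + (g`_0)%:P * f' - (f`_0 * g'`_0 + f'`_0 * g`_0)%:P),
  (g * g' + (f`_0)%:P * g' + (f'`_0)%:P * g).
rewrite -polyCN !evD !evM !evC mulrNz mulrzDr exprD.
transitivity ((x * N%:R ^+ k) * (x' * N%:R ^+ k')); first by ring.
rewrite e e'; transitivity (ev f y * ev f' y + ev f y * ev g' z + ev f' y * ev g z + ev g z * ev g' z).
  by ring.
by rewrite !(ev_cross _ _ yz); ring.
Qed.

Lemma node_form1 : node_form 1.
Proof. by exists 0%N, 1, 0; rewrite ev0 -polyC1 evC expr0 mulr1 addr0. Qed.
Lemma node_form_y : node_form y.
Proof. by exists 0%N, 'X, 0; rewrite ev0 evX expr0 mulr1 addr0. Qed.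
Lemma node_form_z : node_form z.
Proof. by exists 0%N, 0, 'X; rewrite ev0 evX expr0 mulr1 add0r. Qed.

Lemma node_formD x x' : node_form x -> node_form x' -> node_form (x + x').
Proof.
move=> hx hx'; rewrite -[x']opprK; apply: node_formB => //; rewrite -sub0r.
by apply: node_formB => //; rewrite -(subrr x); apply: node_formB.
Qed.

Lemma node_formMn x n : node_form x -> node_form (x *+ n).
Proof.
move=> hx; elim: n => [|n IH]; first by rewrite mulr0n -(subrr x); apply: node_formB.
by rewrite mulrS; apply: node_formD.
Qed.

(** A divisor of N can be cancelled, by allowing a larger power of N. *)
Lemma node_form_div m n x : (n * m)%N = N -> node_form (x *+ n) -> node_form x.
Proof.
move=> nm [k [f [g e]]]; exists k.+1, (m%:R%:P * f), (m%:R%:P * g).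
rewrite !evCM mulrz_nat -mulrDr -e exprS -nm natrM -[in RHS](mulr_natr x); ring.
Qed.
End NodeForm.

(** * Normal forms of elements of Theta *)

Section LocForm.
Variable F : finFieldType.
Hypothesis odd_q : odd #|F|.
Local Notation q := #|F|.
Variables (L : comPzRingType) (h : {rmorphism Theta F -> L}) (D : L).
Hypothesis hD : (2 * q)%:R * D = 1.
Variable eps : F.
Hypothesis eps_ns : nsqrt eps = 0%N.

(** Twice the element e = x_0 + 1 - s, where s = (x_1 + x_eps) / 2. *)
Definition gen_e : Theta F := (nzvecs 0 0 + 1) *+ 2 - nzvecs 0 1 - nzvecs 0 eps.
(** Twice the element o = (x_1 - x_eps) / 2. *)
Definition gen_o : Theta F := nzvecs 0 1 - nzvecs 0 eps.

(** The elements of node form are closed under the ring operations and under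
    division by q, so that it is enough to consider the generators x_c; these are
    s + e - 1, s + o and s - o, and s is a polynomial in e and o divided by
    q. *)
Lemma node_of_Theta : h gen_e * h gen_o = 0 /\
  forall z, node_form (2 * q) (h gen_e) (h gen_o) (h z).
Proof.
pose T0 c : L := h (nzvecs 0 c); pose T1 c : L := h (vecs 1 c).
have hD2 : 2%:R * (q%:R * D) = 1 :> L by rewrite mulrA -natrM.
have hDq : q%:R * (2%:R * D) = 1 :> L by rewrite mulrA -natrM mulnC.
have Hinv c : T1 c * q%:R ^+ 4 = (T0 c + (c == 0)%:R) * q%:R ^+ 3 -
   (\sum_c (T0 c + (c == 0)%:R)) * q%:R ^+ 2 + (\sum_c (T0 c + (c == 0)%:R)) * q%:R.
  have hX c' : h (vecs 0 c') = T0 c' + (c' == 0)%:R by rewrite /vecs rmorphD rmorph_nat.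
  have := congr1 h (vecs_inv odd_q 1 c); rewrite expn1.
  rewrite rmorphD rmorphB !rmorphMn /= hX /vecs_total rmorph_sum (eq_bigr _ (fun c' _ => hX c')).
  set S := \sum_c _; rewrite -[h (vecs 1 c)]/(T1 c).
  rewrite -(mulr_natr (T1 c)) -(mulr_natr (T0 c + _)) -!(mulr_natr S) !natrM => e.
  by transitivity (T1 c * (q%:R * q%:R * (q%:R * q%:R))); [ring|rewrite e; ring].
have Hsq a c : a != 0 -> T0 (a ^+ 2 * c) = T0 c by move=> a0; rewrite /T0 nzvecs_sq.
have Hrel c m d : c * d != m ^+ 2 ->
    T0 c * (\sum_x T1 (c * x ^+ 2 - 2 * m * x + d)) =
    T0 d * (\sum_x T1 (d * x ^+ 2 - 2 * m * x + c)).
  move=> cd; have hP c' m' d' :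
      h (Phi c' m' d') = \sum_x T1 (c' * x ^+ 2 - 2 * m' * x + d') by exact: rmorph_sum.
  have hM c' m' d' : h (nzvecs 0 c' * Phi c' m' d') = T0 c' * h (Phi c' m' d') by exact: rmorphM.
  by rewrite -!hP -hM -[RHS]hM (Phi_rel odd_q cd).
pose s : L := (q%:R * D) * (T0 1 + T0 eps).
pose o : L := (q%:R * D) * (T0 1 - T0 eps).
pose e : L := T0 0 + 1 - s.
have [eo sQ] := node_rels odd_q hD2 hDq Hinv Hsq Hrel eps_ns.
rewrite -/s -/o -/e in eo sQ.
have eE : h gen_e = e *+ 2.
  rewrite /gen_e !rmorphB rmorphMn rmorphD rmorph1 /= -/(T0 0) -/(T0 1) -/(T0 eps).
  have s2 : s *+ 2 = T0 1 + T0 eps.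
    transitivity (2%:R * (q%:R * D) * (T0 1 + T0 eps)); last by rewrite hD2 mul1r.
    by rewrite -(mulr_natr s) /s; ring.
  by rewrite /e mulrnBl s2 opprD addrA.
have oE : h gen_o = o *+ 2.
  rewrite /gen_o rmorphB -/(T0 1) -/(T0 eps).
  transitivity (2%:R * (q%:R * D) * (T0 1 - T0 eps)); first by rewrite hD2 mul1r.
  by rewrite -(mulr_natr o) /o; ring.
have eo2 : h gen_e * h gen_o = 0 by rewrite eE oE mulrnAl mulrnAr eo !mul0rn.
split=> //.
pose G := node_form (2 * q) (h gen_e) (h gen_o).
have Ge : G e by apply: (@node_form_div _ _ _ _ q 2) => //; rewrite -eE; apply: node_form_y.
have Go : G o by apply: (@node_form_div _ _ _ _ q 2) => //; rewrite -oE; apply: node_form_z.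
have GD x x' : G x -> G x' -> G (x + x') by apply: node_formD.
have GM x x' : G x -> G x' -> G (x * x') by apply: node_formM.
have GB x x' : G x -> G x' -> G (x - x') by apply: node_formB.
have G1 : G 1 by apply: node_form1.
have Gs : G s.
  apply: (@node_form_div _ _ _ _ 2 q); first by rewrite mulnC.
  rewrite -mulr_natr sQ mulr_natr; apply: GD; first by apply: GB => //; rewrite expr2; apply: GM.
  by apply: node_formMn; rewrite expr2; apply: GM.
apply: (@Theta_generated F odd_q (fun z => G (h z))).
- by rewrite rmorph1.
- by move=> x x' Gx Gx'; rewrite rmorphB; apply: GB.
- by move=> x x' Gx Gx'; rewrite rmorphM; apply: GM.
- by move=> x; rewrite rmorphMn; apply: node_form_div; rewrite mulnC.
move=> c; rewrite -/(T0 c).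
have [->|[a a0 ->]|hc] := nsqrt_cases c.
- rewrite (T0_0 T0 (q%:R * D) eps) -/s -/e; apply: GB => //; exact: GD.
- by rewrite -[a ^+ 2]mulr1 Hsq // (T0_1 T0 hD2 eps); apply: GD.
- have [a a0 ->] := nonsq_class odd_q eps_ns hc.
  by rewrite Hsq // (T0_eps T0 hD2 eps); apply: GB.
Qed.
End LocForm.

(** * Cardinalities of predicates *)

Section Counts.

(** The cardinality of a predicate, on a type which need not be finite. *)
Definition counts (T : Type) (P : T -> Prop) (n : nat) : Prop :=
  exists (J : finType) (h : J -> T),
    [/\ injective h, forall t, P t <-> exists j, h j = t & #|J| = n].

Lemma counts_le (T T' : Type) (P : T -> Prop) (Q : T' -> Prop) (f : T -> T') n m :
  (forall t, P t -> Q (f t)) -> (forall t u, P t -> P u -> f t = f u -> t = u) ->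
  counts P n -> counts Q m -> (n <= m)%N.
Proof.
move=> PQ inj [J [h [hi hP <-]]] [K [k [ki kQ <-]]].
have Ph j : P (h j) by apply/hP; exists j.
have ex j : exists i, k i = f (h j) by apply/kQ/PQ.
pose s j := projT1 (cid (ex j)).
have sE j : k (s j) = f (h j) by rewrite /s; case: cid.
apply: (@leq_card _ _ s) => i j e; apply: hi; apply: inj => //.
by rewrite -!sE e.
Qed.

Lemma counts_uniq (T : Type) (P : T -> Prop) n m : counts P n -> counts P m -> n = m.
Proof.
move=> h h'; apply/eqP; rewrite eqn_leq.
by rewrite (@counts_le T T P P id) // (@counts_le T T P P id).
Qed.

Lemma counts_bij (T T' : Type) (P : T -> Prop) (Q : T' -> Prop) (f : T -> T') n :
  (forall t, P t -> Q (f t)) -> (forall t u, P t -> P u -> f t = f u -> t = u) ->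
  (forall t', Q t' -> exists2 t, P t & f t = t') ->
  counts P n -> counts Q n.
Proof.
move=> PQ inj surj [J [h [hi hP hn]]].
have Ph j : P (h j) by apply/hP; exists j.
exists J, (f \o h); split=> // [i j e|t']; first exact/hi/inj.
split=> [/surj[t /hP[j <-] <-]|[j <-]]; first by exists j.
exact/PQ/Ph.
Qed.

Lemma counts_fin (T : Type) (P : T -> Prop) (K : finType) (k : T -> K) :
  (forall t u, P t -> P u -> k t = k u -> t = u) -> exists n, counts P n.
Proof.
move=> inj; pose A : {pred K} := fun i => `[< exists2 t, P t & k t = i >].
pose J : finType := {i : K | i \in A}.
have ex (j : J) : exists t, P t /\ k t = val j.
  by have /asboolP[t Pt kt] := valP j; exists t.
pose h j := projT1 (cid (ex j)).
have hE j : P (h j) /\ k (h j) = val j by rewrite /h; case: cid.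
exists #|J|, J, h; split=> // [i j e|t].
  by apply: val_inj; rewrite /= -(proj2 (hE i)) -(proj2 (hE j)) e.
split=> [Pt|[j <-]]; last by case: (hE j).
have kA : k t \in A by apply/asboolP; exists t.
exists (exist _ (k t) kA); have [Ph kh] := hE (exist _ (k t) kA).
exact: inj.
Qed.

Lemma counts_sigma (I : finType) (T : I -> Type) (P : forall i, T i -> Prop) (n : I -> nat) :
  (forall i, counts (P i) (n i)) ->
  counts (fun s : {i : I & T i} => P (tag s) (tagged s)) (\sum_i n i).
Proof.
move=> c; pose J i : finType := projT1 (cid (c i)).
have ex i : exists h : J i -> T i, [/\ injective h, forall t, P i t <-> exists j, h j = t
   & #|J i| = n i] by rewrite /J; case: (cid (c i)).
pose h i : J i -> T i := projT1 (cid (ex i)).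
have hE i : [/\ injective (h i), forall t, P i t <-> exists j, h i j = t & #|J i| = n i].
  by rewrite /h; case: (cid (ex i)).
exists {i : I & J i}, (fun s => Tagged T (h (tag s) (tagged s))); split.
- move=> [i x] [j y] /= e; have ij : i = j := congr1 (@tag I T) e.
  move: e; case: _ / ij y => y e.
  by congr Tagged; have [hi _ _] := hE i; apply/hi/eq_from_Tagged.
- move=> [i t] /=; have [_ hP _] := hE i; rewrite hP; split=> [[j <-]|].
    by exists (Tagged J j).
  move=> [[i' j] /= e]; have ii : i' = i := congr1 (@tag I T) e.
  by subst i'; exists j; apply: eq_from_Tagged e.
rewrite card_tagged sumnE big_map big_enum /=; apply: eq_bigr => i _.
by case: (hE i).
Qed.

Lemma counts_fiber (T U : Type) (P : T -> Prop) (Q : U -> Prop) (p : T -> U) n m :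
  (forall t, P t -> Q (p t)) -> counts Q n ->
  (forall u, Q u -> counts (fun t => P t /\ p t = u) m) -> counts P (n * m).
Proof.
move=> PQ [J [h [hi hQ <-]]] c.
have Qh j : Q (h j) by apply/hQ; exists j.
have := @counts_sigma J (fun=> T) (fun j t => P t /\ p t = h j) (fun=> m) (fun j => c _ (Qh j)).
rewrite sum_nat_const; apply: (counts_bij (f := fun s : {_ : J & T} => projT2 s)).
- by move=> [j t] /= [].
- move=> [j t] [j' t'] /= [_ e] [_ e'] tt'; subst t'.
  by have -> : j = j' by apply: hi; rewrite -e -e'.
- move=> t Pt; have /hQ[j hj] := PQ t Pt.
  by exists (Tagged (fun=> T) (i := j) t).
Qed.

Lemma counts_pred (K : finType) (A : {pred K}) : counts (fun k => k \in A) #|A|.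
Proof.
exists {k : K | k \in A}, val; split; [exact: val_inj| |by rewrite card_sig].
by move=> k; split=> [kA|[[k' h] <-]] //; exists (exist _ k kA).
Qed.

Lemma counts1 (T : Type) (P : T -> Prop) t : P t -> (forall u, P u -> u = t) -> counts P 1.
Proof.
move=> Pt u; exists unit, (fun=> t); split; [by case=> -[]| |by rewrite card_unit].
by move=> v; split=> [/u->|[_ <-]] //; exists tt.
Qed.
End Counts.

(** * Counting points fixed by the stabiliser of E_r *)

Section Nu.
Variable F : finFieldType.
Hypothesis odd_q : odd #|F|.
Variable par : bool.
Local Notation q := #|F|.
Local Notation E := (@Esp F par).
Implicit Types (X Y Z : tsset F) (g h k : Orth F) (A B : seq (Vinf F)) (r : nat).

Definition efix r g := forall v, E r v -> g v = v.
(** For a set of embeddings into V, these are the embeddings with image in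
    E_r. *)
Definition over_E r (Y : tsset F) (y : Y) := forall g, efix r g -> gact g y = y.
Arguments over_E r {Y} y.

Lemma gact_eq_conj Y (y : Y) g h : gact g y = gact h y <-> gact (Orth_mul (Orth_inv h) g) y = y.
Proof.
rewrite gact_mul; split=> [->|e]; first exact: gactK.
by rewrite -[LHS](gactKV h) e.
Qed.

Lemma stab_act Y (y : Y) B g k : (forall g, gact g y = y <-> gfix B g) ->
  gact k (gact g y) = gact g y <-> gfix (map g B) k.
Proof.
move=> st; rewrite -gact_mul gact_eq_conj st; split=> [h b /mapP[c cB ->]|h c cB] /=.
  by have /= := congr1 g (h c cB); rewrite Orth_invKV.
by rewrite (h (g c)) ?map_f // Orth_invK.
Qed.

Lemma stab_eq Y (y : Y) B g h : (forall g, gact g y = y <-> gfix B g) ->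
  map g B = map h B -> gact g y = gact h y.
Proof.
move=> st e; apply/gact_eq_conj/st => b bB /=.
have /eq_in_map/(_ b bB) -> := e; exact: Orth_invK.
Qed.

(** A vector outside E_r is moved by some element of G(E_r). *)
Lemma over_EP r Y (y : Y) B g : (forall g, gact g y = y <-> gfix B g) ->
  over_E r (gact g y) <-> forall b, b \in B -> E r (g b).
Proof.
move=> st; split=> [h b bB|h k kE].
  apply: contrapT => /(not_Esp_moved odd_q)[k [kE]]; apply.
  by have /(stab_act g k st) := h k kE; apply; apply: map_f.
by apply/(stab_act g k st) => _ /mapP[b bB ->]; apply/kE/h.
Qed.

Lemma over_E_map r Y X (f : gmap Y X) y : over_E r y -> over_E r (f y).
Proof. by move=> h g gE; rewrite -gmapP h. Qed.

Lemma over_E_act r Y (y : Y) k : stable (E r) k -> over_E r y -> over_E r (gact k y).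
Proof.
move=> sk h g gE; rewrite -gact_mul; apply/gact_eq_conj/h => v Ev /=.
by rewrite gE ?Orth_invK //; apply/sk.
Qed.

Definition fib r Y X (f : gmap Y X) (x : X) : Y -> Prop := fun y => f y = x /\ over_E r y.

(** Points over E_r correspond to tuples of vectors of the finite space
    E_r. *)
Lemma fib_fin r Y X (f : gmap Y X) x : exists n, counts (fib r f x) n.
Proof.
have [y0 _] := tsset_trans Y; have [B stB] := tsset_stab y0.
pose co (v : Vinf F) : 'rV[F]_(r + par) * 'rV[F]_(r + par) := (poly_rV v.1, poly_rV v.2).
pose rep y := projT1 (cid (ts_trans y0 y)).
have repE y : gact (rep y) y0 = y by rewrite /rep; case: cid.
apply: (@counts_fin _ _ _ (fun y => map_tuple co (map_tuple (rep y) (in_tuple B)))).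
move=> y z [_ fy] [_ fz] e; rewrite -(repE y) -(repE z); apply: (stab_eq stB).
rewrite -(repE y) in fy; rewrite -(repE z) in fz.
have /(over_EP r _ stB) hy := fy; have /(over_EP r _ stB) hz := fz.
have := congr1 val e; rewrite /= -!map_comp => /eq_in_map h.
apply/eq_in_map => b bB; have [] := h b bB.
have [s1 s2 _] := hy b bB; have [t1 t2 _] := hz b bB.
move=> /(congr1 rVpoly); rewrite !poly_rV_K // => e1 /(congr1 rVpoly).
by rewrite !poly_rV_K // => e2; apply: injective_projections.
Qed.

(** What makes the count nu_r well defined; it holds only for large r. *)
Definition indep r Y X (f : gmap Y X) n :=
  (exists x : X, over_E r x) /\ forall x : X, over_E r x -> counts (fib r f x) n.

(** The common number of fixed points in the fibres, with the default value 0
    if they do not all have the same number. *)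
Definition nu r Y X (f : gmap Y X) : nat :=
  if pselect (exists n, indep r f n) is left h then projT1 (cid h) else 0%N.

Lemma insize_Esp N r v : (N <= r)%N -> insize N v -> E r v.
Proof.
move=> Nr [v1 v2]; split; first by apply: leq_trans v1 (leq_trans Nr (leq_addr _ _)).
  by apply: leq_trans v2 (leq_trans Nr (leq_addr _ _)).
by rewrite !nth_default ?mul0r //; [apply: leq_trans v1 Nr|apply: leq_trans v2 Nr].
Qed.

Lemma over_E_ex X : exists r0, forall r, (r0 <= r)%N -> exists x : X, over_E r x.
Proof.
have [x0 _] := tsset_trans X; have [A stA] := tsset_stab x0.
have [N hN] := insize_ex A; exists N => r Nr.
exists x0; rewrite -[x0]gact1; apply/(over_EP r _ stA) => a /hN.
exact: insize_Esp.
Qed.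

(** Two points of X over E_r are conjugate by an isometry of V preserving
    E_r, if r is large: this is Witt extension inside E_r for the tuple that X is
    an orbit of. *)
Lemma nuP Y X (f : gmap Y X) : exists r0, forall r, (r0 <= r)%N -> indep r f (nu r f).
Proof.
have [x0 _] := tsset_trans X; have [A stA] := tsset_stab x0.
have [N hN] := insize_ex A.
exists (maxn N (size A).*2.+3) => r; rewrite geq_max => /andP[Nr Ar].
rewrite /nu; case: pselect => [h|[]]; first by case: cid.
have [n cn] := fib_fin r f x0; exists n; split.
  exists x0; rewrite -[x0]gact1; apply/(over_EP r _ stA) => a /hN.
  exact: insize_Esp.
move=> x fx; have [g gx] := ts_trans x0 x; rewrite -gx in fx.
have /(over_EP r _ stA) gA := fx.
have AE a : a \in A -> E r a by move=> /hN; apply: insize_Esp.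
have [k [kA sk]] := witt_Esp odd_q AE gA Ar.
have kx : gact k x0 = x by rewrite -gx; apply: (stab_eq stA); apply/eq_in_map.
apply: (counts_bij (f := gact k)) cn.
- by move=> y [fy yy]; split; [rewrite gmapP fy|apply: over_E_act].
- by move=> y z _ _ /(congr1 (gact (Orth_inv k))); rewrite !gactK.
- move=> y [fy yy]; exists (gact (Orth_inv k) y); last exact: gactKV.
  split; last exact/over_E_act/yy/stable_inv.
  by rewrite gmapP fy -kx gactK.
Qed.

Lemma nu_eq r Y X (f : gmap Y X) x n : indep r f (nu r f) -> over_E r x ->
  counts (fib r f x) n -> nu r f = n.
Proof. by move=> [_ h] /h; apply: counts_uniq. Qed.

Lemma nu_iso Y X (f : gmap Y X) : bijective f ->
  exists r0, forall r, (r0 <= r)%N -> nu r f = 1%N.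
Proof.
move=> [f' fK f'K]; have [r0 h] := nuP f; exists r0 => r /h ir.
have [[x fx] _] := ir; apply: (nu_eq ir fx).
apply: (@counts1 _ _ (f' x)); last by move=> y [<- _]; rewrite fK.
split; first exact: f'K.
by move=> g gE; apply: (can_inj fK); rewrite gmapP f'K fx.
Qed.

Lemma nu_comp Z Y X (f : gmap Y X) (g : gmap Z Y) :
  exists r0, forall r, (r0 <= r)%N -> nu r (gmap_comp f g) = (nu r f * nu r g)%N.
Proof.
have [r1 h1] := nuP f; have [r2 h2] := nuP g; have [r3 h3] := nuP (gmap_comp f g).
exists (maxn r1 (maxn r2 r3)) => r; rewrite !geq_max => /and3P[/h1 i1 /h2 i2 /h3 i3].
have [[x fx] _] := i3; apply: (nu_eq i3 fx).
apply: (counts_fiber (p := g) (Q := fib r f x)).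
- by move=> z [/= e fz]; split=> //; apply: over_E_map.
- exact: (proj2 i1).
move=> y [fy yy]; apply: (counts_bij (f := id)) (proj2 i2 y yy) => //.
  by move=> z [gz zz]; split=> //; split=> //=; rewrite gz.
by move=> z [[_ zz] gz]; exists z.
Qed.

(** A fibre of f over h x' is the disjoint union of the fibres of the f' i
    over x'. *)
Lemma nu_base_change Y X X' (f : gmap Y X) (h : gmap X' X) (n : nat) (Y' : 'I_n -> tsset F)
    (p : forall i, gmap (Y' i) Y) (f' : forall i, gmap (Y' i) X') :
  orbit_decomposition f h p f' ->
  exists r0, forall r, (r0 <= r)%N -> nu r f = (\sum_(i < n) nu r (f' i))%N.
Proof.
move=> [e1 e2]; have [r1 h1] := nuP f.
have ex i := nuP (f' i); pose ri i := projT1 (cid (ex i)).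
have riP i r : (ri i <= r)%N -> indep r (f' i) (nu r (f' i)) by rewrite /ri; case: cid => ? /= +; apply.
have [r3 h3] := over_E_ex X'.
exists (maxn r1 (maxn r3 (\max_i ri i))) => r.
rewrite !geq_max => /and3P[/h1 i1 /h3[x' fx'] hm].
have ii i : indep r (f' i) (nu r (f' i)) by apply/riP/leq_trans/hm/leq_bigmax.
apply: (nu_eq i1 (over_E_map h fx')).
have := counts_sigma (fun i => proj2 (ii i) x' fx').
apply: (counts_bij (f := fun s : {i : 'I_n & Y' i} => p (tag s) (tagged s))).
- move=> [i z] /= [fz zz]; split; last exact: over_E_map.
  by rewrite e1 fz.
- move=> [i z] [j w] /= [fz _] [fw _] e.
  have [iz [_ u]] := e2 (p i z) x' (etrans (e1 i z) (congr1 h fz)).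
  exact: etrans (esym (u (existT _ i z) (conj erefl fz)))
    (u (existT _ j w) (conj (esym e) fw)).
move=> y [fy yy]; have [[i z] [/= [pz fz] u]] := e2 y x' fy.
exists (existT _ i z) => //=; split=> // g gE.
apply: (@eq_from_Tagged _ (fun i => tsset_gset (Y' i)) i); apply/esym.
by apply: (u (existT _ i (gact g z))); rewrite /= !gmapP pz fz yy ?fx'.
Qed.
End Nu.

(** * Counts of formal combinations of symbols *)

Section MonEval.
Variables (I : choiceType) (h : I -> rat).

(** With [sym_eval], the extension of h to a ring morphism from the free
    commutative ring on I. *)
Definition mon_eval (m : {cmonom I}) : rat := \prod_(k <- finsupp m) h k ^+ m k.

Lemma mon_evalEw (m : {cmonom I}) (d : {fset I}) : (finsupp m `<=` d)%fset ->
  mon_eval m = \prod_(k <- d) h k ^+ m k.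
Proof.
move=> le; rewrite /mon_eval (big_fset_incl _ le) // => i _.
by rewrite -cmE_neq0 negbK => /eqP->.
Qed.

Lemma mon_evalM : mmorphism mon_eval.
Proof.
split=> [m1 m2|]; last by rewrite /mon_eval mdom1 big_seq_fset0.
rewrite (@mon_evalEw m1 _ (fsubsetUl _ (finsupp m2))) (@mon_evalEw m2 _ (fsubsetUr (finsupp m1) _)).
rewrite /mon_eval mdomD -big_split /=; apply: eq_bigr => i _.
by rewrite cmM exprD.
Qed.
HB.instance Definition _ := isMultiplicative.Build {cmonom I} rat mon_eval mon_evalM.

Definition sym_eval (a : {malg int[{cmonom I}]}) : rat := mmap intr mon_eval a.

Lemma sym_evalB a b : sym_eval (a - b) = sym_eval a - sym_eval b.
Proof. exact: mmapB. Qed.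
Lemma sym_evalD a b : sym_eval (a + b) = sym_eval a + sym_eval b.
Proof. exact: mmapD. Qed.
Lemma sym_eval1 : sym_eval 1 = 1.
Proof. exact: mmap1. Qed.
Lemma sym_evalM a b : sym_eval (a * b) = sym_eval a * sym_eval b.
Proof. exact: (rmorphM (mmap intr mon_eval)). Qed.
Lemma sym_evalU i : sym_eval << ucm i >> = h i.
Proof. by rewrite /sym_eval mmapU mul1r /mon_eval mdomU big_seq_fset1 cmUU expr1. Qed.
Lemma sym_eval0 : sym_eval 0 = 0.
Proof. exact: mmap0. Qed.
Lemma sym_eval_sum n (f : 'I_n -> {malg int[{cmonom I}]}) :
  sym_eval (\sum_i f i) = \sum_i sym_eval (f i).
Proof. exact: (big_morph _ sym_evalD sym_eval0). Qed.
End MonEval.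

Section Evt.
Variable F : finFieldType.
Hypothesis odd_q : odd #|F|.
Variable par : bool.
Local Notation q := #|F|.
Implicit Types (z : Theta F) (a b : free_symbols F).

(** The count nu_r extended to formal combinations of symbols. For a fixed r
    it does not factor through Theta; this holds only for r large, depending on
    the relation. *)
Definition nu_free r a : rat := sym_eval (fun s : symbol F => (nu par r (sym_map s))%:R) a.

Lemma nu_free_symb r (Y X : tsset F) (f : gmap Y X) : nu_free r (symb f) = (nu par r f)%:R.
Proof. exact: sym_evalU. Qed.

Lemma nu_freeB r a b : nu_free r (a - b) = nu_free r a - nu_free r b.
Proof. exact: sym_evalB. Qed.
Lemma nu_freeM r a b : nu_free r (a * b) = nu_free r a * nu_free r b.
Proof. exact: sym_evalM. Qed.
Lemma nu_free1 r : nu_free r 1 = 1.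
Proof. exact: sym_eval1. Qed.
Lemma nu_free_sum r n (f : 'I_n -> free_symbols F) : nu_free r (\sum_i f i) = \sum_i nu_free r (f i).
Proof. exact: sym_eval_sum. Qed.

Lemma nu_free_rel a : Theta_rel a -> exists r0, forall r, (r0 <= r)%N -> nu_free r a = 0.
Proof.
case=> [Y X f fb|Z Y X f g|Y X X' f h n Y' p f' od].
- have [r0 h] := nu_iso odd_q par fb; exists r0 => r /h e.
  apply: etrans (nu_freeB _ _ _) _; apply/eqP; rewrite subr_eq0; apply/eqP.
  exact: etrans (nu_free_symb r f) (etrans (congr1 _ e) (esym (nu_free1 r))).
- have [r0 h] := nu_comp odd_q par f g; exists r0 => r /h e.
  apply: etrans (nu_freeB _ _ _) _; apply/eqP; rewrite subr_eq0; apply/eqP.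
  apply: etrans (nu_free_symb r _) _; apply/esym/(etrans (nu_freeM _ _ _)).
  apply: etrans (congr2 _ (nu_free_symb r f) (nu_free_symb r g)) _.
  by rewrite e natrM.
have [r0 k] := nu_base_change odd_q par od; exists r0 => r /k e.
apply: etrans (nu_freeB _ _ _) _; apply/eqP; rewrite subr_eq0; apply/eqP.
apply: etrans (nu_free_symb r _) _; apply/esym/(etrans (nu_free_sum _ _)).
by rewrite e natr_sum; apply: eq_bigr => i _; apply: nu_free_symb.
Qed.

Lemma nu_free_ideal a : a \in ideal_gen (@Theta_rel F) ->
  exists r0, forall r, (r0 <= r)%N -> nu_free r a = 0.
Proof.
move=> /asboolP[n [c [s [Ss ->]]]].
pose ri i := projT1 (cid (nu_free_rel (Ss i))).
have riP i r : (ri i <= r)%N -> nu_free r (s i) = 0 by rewrite /ri; case: cid => ? /= +; apply.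
exists (\max_i ri i) => r hr; rewrite nu_free_sum big1 // => i _.
rewrite nu_freeM riP ?mulr0 //.
exact: leq_trans (leq_bigmax i) hr.
Qed.

(** The sequence u agrees, for all large r, with the counts nu_r of some
    representative of z. By [evcount_uniq] the germ of u at infinity depends
    only on z. *)
Definition evcount z (u : nat -> rat) := exists2 a, rq (@Theta_rel F) a = z &
  exists r0, forall r, (r0 <= r)%N -> nu_free r a = u r.

Lemma evcount_ex z : exists u, evcount z u.
Proof. by have [a az] := rq_surj z; exists (nu_free ^~ a), a => //; exists 0%N. Qed.

Lemma evcount_uniq z u u' : evcount z u -> evcount z u' ->
  exists r0, forall r, (r0 <= r)%N -> u r = u' r.
Proof.
move=> [a az [r1 h1]] [b bz [r2 h2]].
have /rqP/nu_free_ideal[r3 h3] : rq (@Theta_rel F) a = rq (@Theta_rel F) b by rewrite az bz.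
exists (maxn r1 (maxn r2 r3)) => r; rewrite !geq_max => /and3P[/h1<- /h2<- /h3/eqP].
by rewrite nu_freeB subr_eq0 => /eqP.
Qed.

Lemma evcount_eq z u u' r1 : (forall r, (r1 <= r)%N -> u r = u' r) -> evcount z u -> evcount z u'.
Proof.
move=> e [a az [r0 h]]; exists a => //; exists (maxn r0 r1) => r.
by rewrite geq_max => /andP[/h-> /e].
Qed.

Lemma evcountB z z' u u' : evcount z u -> evcount z' u' -> evcount (z - z') (fun r => u r - u' r).
Proof.
move=> [a <- [r1 h1]] [b <- [r2 h2]]; exists (a - b); first exact: rqB.
exists (maxn r1 r2) => r; rewrite geq_max => /andP[/h1<- /h2<-]; exact: nu_freeB.
Qed.

Lemma evcountM z z' u u' : evcount z u -> evcount z' u' -> evcount (z * z') (fun r => u r * u' r).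
Proof.
move=> [a <- [r1 h1]] [b <- [r2 h2]]; exists (a * b); first exact: rqM.
exists (maxn r1 r2) => r; rewrite geq_max => /andP[/h1<- /h2<-]; exact: nu_freeM.
Qed.

Lemma evcount1 : evcount 1 (fun=> 1).
Proof. by exists 1; [exact: rmorph1|exists 0%N => r _; exact: nu_free1]. Qed.

Lemma evcountMn z u n : evcount z u -> evcount (z *+ n) (fun r => u r *+ n).
Proof.
move=> h; elim: n => [|n IH].
  rewrite mulr0n -(subrr z); apply: (evcount_eq (r1 := 0%N) _ (evcountB h h)) => r _.
  by rewrite subrr mulr0n.
rewrite mulrS -[z *+ n]opprK -(sub0r (z *+ n)) -(subrr z).
by apply: (evcount_eq (r1 := 0%N) _ (evcountB h (evcountB (evcountB h h) IH))) => r _; rewrite mulrS; ring.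
Qed.

Lemma evcount_class (Y X : tsset F) (f : gmap Y X) : evcount (Tclass f) (fun r => (nu par r f)%:R).
Proof. by exists (symb f) => //; exists 0%N => r _; apply: nu_free_symb. Qed.
End Evt.

(** * Spheres in E_r *)

Section XCount.
Variable F : finFieldType.
Hypothesis odd_q : odd #|F|.
Variable par : bool.
Local Notation q := #|F|.
Local Notation E := (@Esp F par).
Local Notation B := (@Vinf_form F).

(** Coordinates on E_r; the last one has to be 0 if par is false. *)
Definition esp_vec r (k : ('rV[F]_r * 'rV[F]_r) * F) : Vinf F := hypv k.1 + k.2 *: last_vec F r.

Lemma esp_vec_lin r : lin_closed (fun v => exists k : ('rV[F]_r * 'rV[F]_r) * F,
  (par || (k.2 == 0)) /\ esp_vec k = v).
Proof.
have hat0 : hypv (0 : 'rV[F]_r * 'rV[F]_r) = 0 by rewrite /hypv !linear0.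
split=> [|c x y [k [kp <-]] [l [lp <-]]].
  by exists (0, 0); rewrite eqxx orbT /esp_vec hat0 scale0r addr0.
exists (c *: k.1 + l.1, c * k.2 + l.2); split=> /=.
  by case: (par) kp lp => //= /eqP-> /eqP->; rewrite mulr0 addr0.
have h : hypv (c *: k.1 + l.1) = c *: hypv k.1 + hypv l.1.
  by apply: injective_projections; rewrite /= linearP.
rewrite /esp_vec /= h; move: (hypv _) (hypv _) (last_vec _ _) => a b w.
by apply: Vinf_eqP => i /=; rewrite ?(coefD, coefZ); ring.
Qed.

Lemma EspP r v : E r v <-> exists k : ('rV[F]_r * 'rV[F]_r) * F,
  (par || (k.2 == 0)) /\ esp_vec k = v.
Proof.
have hE k : insize r k -> E r k by apply: insize_Esp.
have hat_ex x : insize r x -> exists k : ('rV[F]_r * 'rV[F]_r) * F,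
    (par || (k.2 == 0)) /\ esp_vec k = x.
  by move=> /hypv_surj[u <-]; exists (u, 0); rewrite /esp_vec eqxx orbT scale0r addr0.
split=> [|[k [kp <-]]].
  apply: (@Ebas_min F par r _ v (esp_vec_lin r)).
  - by move=> i ir; apply/hat_ex/Esp_false/Esp_e.
  - by move=> i ir; apply/hat_ex/Esp_false/Esp_f.
  - move=> hp; exists (0, 1); rewrite hp /esp_vec /hypv !linear0 scale1r.
    by split=> //; rewrite -[RHS]add0r.
apply: linD; [exact: Esp_lin|exact/hE/hypv_insize|].
case/orP: kp => [hp|/eqP->]; last by rewrite scale0r; case: (Esp_lin F par r).
by apply: linZ; [exact: Esp_lin|exact: Esp_last].
Qed.

Lemma esp_vec_coef r (k : ('rV[F]_r * 'rV[F]_r) * F) : (esp_vec k).1`_r = k.2.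
Proof.
have [h _] := hypv_insize k.1.
by rewrite /= coefD coefZ coefXn eqxx mulr1 nth_default // add0r.
Qed.

Lemma esp_vec_inj r : injective (@esp_vec r).
Proof.
move=> k l e; have e2 : k.2 = l.2 by rewrite -!esp_vec_coef e.
move: e; rewrite /esp_vec e2 => /addIr/hypv_inj e1.
by case: k l e1 e2 => ? ? [? ?] /= -> ->.
Qed.

Lemma esp_vec_norm r (k : ('rV[F]_r * 'rV[F]_r) * F) :
  B (esp_vec k) (esp_vec k) = B (hypv k.1) (hypv k.1) + k.2 ^+ 2.
Proof.
have hl : B (hypv k.1) (last_vec F r) = 0.
  have [h1 h2] := hypv_insize k.1.
  by rewrite form_last !nth_default // mul0r addr0.
have ll : B (last_vec F r) (last_vec F r) = 1.
  by rewrite form_last /= coefZ coefXn eqxx mulr1 mul1r -[X in X + X]mul1r halfD.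
rewrite /esp_vec; move: (hypv _) (last_vec _ _) hl ll => h l hl ll.
by rewrite !formL (formC l) hl ll; ring.
Qed.

Lemma esp_vec_eq0 r (k : ('rV[F]_r * 'rV[F]_r) * F) : (esp_vec k == 0) = (k == 0).
Proof.
have e0 : esp_vec (0 : ('rV[F]_r * 'rV[F]_r) * F) = 0.
  by rewrite /esp_vec /hypv /= !linear0 scale0r addr0.
by rewrite -{1}e0 (inj_eq (@esp_vec_inj r)).
Qed.

(** The number of nonzero vectors of norm c in E_r. *)
Definition sphere_count (c : F) r : rat :=
  (if par then (nsqrt c)%:R * q%:R ^+ r + q%:R ^+ r * q%:R ^+ r - q%:R ^+ r
   else (c == 0)%:R * q%:R ^+ r + (q%:R ^+ r * q%:R ^+ r - q%:R ^+ r) / q%:R)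
  - (c == 0)%:R.

Lemma q_neq0 : (q%:R : rat) != 0.
Proof. by rewrite pnatr_eq0 -lt0n (ltnW (finNzRing_gt1 F)). Qed.

(** The equidistribution formula on H_r, applied to an indicator
    function. *)
Lemma card_slice r c (x : F) :
  (#|[pred u : 'rV[F]_r * 'rV[F]_r | B (hypv u) (hypv u) + x ^+ 2 == c]|)%:R =
  (x ^+ 2 == c)%:R * q%:R ^+ r + (q%:R ^+ r * q%:R ^+ r - q%:R ^+ r) / q%:R :> rat.
Proof.
have := hyp_sum odd_q (fun d => (d + x ^+ 2 == c)%:R : rat) r.
have -> : \sum_d (d + x ^+ 2 == c)%:R = 1 :> rat.
  rewrite (bigD1 (c - x ^+ 2)) //= subrK eqxx big1 ?addr0 // => d hd.
  by case: eqP => // e; case/eqP: hd; rewrite -e addrK.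
rewrite add0r => e; rewrite -sum1_card natr_sum big_mkcond /=.
set A := \sum_u _ in e; have -> : \sum_(u : 'rV[F]_r * 'rV[F]_r)
    (if B (hypv u) (hypv u) + x ^+ 2 == c then 1 else 0) = A :> rat.
  by apply: eq_bigr => u _; case: (_ == _).
apply: (mulIf q_neq0); rewrite [RHS]mulrDl divfK ?q_neq0 //.
move: e; rewrite -(mulr_natr A) -(mulr_natr (x ^+ 2 == c)%:R) !natrM !natrX => e.
by rewrite -[LHS](addrK (q%:R ^+ r)) e; ring.
Qed.

Lemma card_sphere r c : exists2 n, counts (fun v => [/\ E r v, v <> 0 & B v v = c]) n
  & n%:R = sphere_count c r.
Proof.
pose A : {pred ('rV[F]_r * 'rV[F]_r) * F} :=
  [pred k | (par || (k.2 == 0)) && (B (esp_vec k) (esp_vec k) == c)].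
exists #|[predD1 A & 0]|.
  apply: (counts_bij (f := @esp_vec r)) (counts_pred [predD1 A & 0]).
  - move=> k; rewrite inE => /andP[k0 /andP[kp /eqP kc]]; split=> //.
      by apply/EspP; exists k.
    by apply/eqP; rewrite esp_vec_eq0.
  - by move=> k l _ _; apply: esp_vec_inj.
  - move=> v [/EspP[k [kp <-]] v0 kc]; exists k => //.
    by rewrite inE -esp_vec_eq0; apply/andP; split; [apply/eqP|rewrite inE kp kc eqxx].
have A0 : (0 \in A) = (c == 0).
  rewrite inE eqxx orbT /=; have /eqP-> : esp_vec (0 : ('rV[F]_r * 'rV[F]_r) * F) == 0.
    by rewrite esp_vec_eq0.
  by rewrite form0l eq_sym.
have -> : (#|[predD1 A & 0]|)%:R = (#|A|)%:R - (c == 0)%:R :> rat.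
  by rewrite (cardD1 (0 : ('rV[F]_r * 'rV[F]_r) * F) A) A0 natrD addrC addKr.
congr (_ - _).
have -> : #|A| = (\sum_(x : F | par || (x == 0)%R)
    #|[pred u : 'rV[F]_r * 'rV[F]_r | (B (hypv u) (hypv u) + x ^+ 2 == c)%R]|)%N.
  rewrite -sum1_card (eq_bigr (fun x => \sum_(u : 'rV[F]_r * 'rV[F]_r |
    (B (hypv u) (hypv u) + x ^+ 2 == c)%R) 1)%N); last by move=> x _; rewrite sum1_card.
  rewrite pair_big_dep /= [RHS](reindex (fun k : ('rV[F]_r * 'rV[F]_r) * F => (k.2, k.1))).
    by apply: eq_bigl => -[u x]; rewrite inE esp_vec_norm.
  by exists (fun k => (k.2, k.1)) => -[].
rewrite natr_sum (eq_bigr _ (fun x _ => card_slice r c x)).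
case: par => /=.
  rewrite big_split /= sumr_const -mulr_suml -[RHS]addrA; congr (_ + _).
    congr (_ * _); rewrite /nsqrt -sum1_card natr_sum [RHS]big_mkcond.
    by apply: eq_bigr => x _; rewrite inE; case: (_ == _).
  by rewrite -[_ *+ _]mulr_natr divfK ?q_neq0.
by rewrite big_pred1_eq expr0n [0 == c]eq_sym.
Qed.

(** The set of nonzero vectors of norm c is an orbit of G, and its points
    fixed by G(E_r) are the vectors which lie in E_r. *)
Lemma nzvecs_class c : exists f : gmap (orb [:: w_ 0 c]) (orb [::]),
  nzvecs 0 c = Tclass f /\ exists r0, forall r, (r0 <= r)%N -> (nu par r f)%:R = sphere_count c r.
Proof.
have h : fixsub [:: w_ 0 c] [::] by [].
exists (orbmap h); split; first exact: (tauE h).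
have [r0 hr] := nuP odd_q par (orbmap h); exists r0 => r /hr ir.
have [n cn <-] := card_sphere r c; congr _%:R.
have fx : over_E par r (pt [::] : orb ([::] : seq (Vinf F))).
  by move=> g _; apply: (proj2 (gact_pt [::] g)).
have oh g : head 0 (orb_val (gact g (pt [:: w_ 0 c]) : orb [:: w_ 0 c])) = g (w_ 0 c).
  by have /= -> := orb_val_act g (orb_pt [:: w_ 0 c]); rewrite orb_val_pt.
apply: counts_uniq cn; apply: (counts_bij (f := fun y : orb [:: w_ 0 c] => head 0 (orb_val y)))
  (proj2 ir _ fx).
- move=> y [_ fy]; have [g gy] := ts_trans (pt _ : orb [:: w_ 0 c]) y; rewrite -gy in fy *.
  have /(over_EP odd_q) := fy; move=> /(_ [:: w_ 0 c] (fun k => gact_pt _ k)) Eg.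
  rewrite oh; split.
  + by apply: Eg; rewrite inE.
  + by move=> g0; apply: (@w_neq0 F 0 c); apply: (bij_inj (Orth_bij g)); rewrite g0 Orth0.
  + by rewrite Orth_form form_ww.
- move=> y z _ _.
  have [g <-] := ts_trans (pt _ : orb [:: w_ 0 c]) y.
  have [k <-] := ts_trans (pt _ : orb [:: w_ 0 c]) z.
  rewrite !oh => e; apply/gact_pt_eq; exact: (congr1 (fun v => [:: v]) e).
move=> v [Ev v0 vc].
have [||||g [_ gw]] := @witt_full F odd_q [::] (w_ 0 c) v => //.
- exact: w_neq0.
- by rewrite form_ww.
exists (gact g (pt _)); last by rewrite oh.
split.
  have [k <-] := ts_trans (pt [::] : orb [::]) (orbmap h (gact g (pt [:: w_ 0 c]))).
  by apply: (proj2 (gact_pt [::] k)).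
apply/(over_EP odd_q _ _ g (fun k => gact_pt _ k)) => b; rewrite inE => /eqP->.
by rewrite gw.
Qed.
End XCount.

(** * Polynomiality of the counts *)

Section PolyVal.
Variable F : finFieldType.
Hypothesis odd_q : odd #|F|.
Local Notation q := #|F|.
Implicit Types (P : {poly Zinv q}).

Definition qval P r : rat := val (P.[q%:R ^+ r]).

Lemma qvalB P P' r : qval (P - P') r = qval P r - qval P' r.
Proof. by rewrite /qval hornerD hornerN rmorphB. Qed.
Lemma qvalD P P' r : qval (P + P') r = qval P r + qval P' r.
Proof. by rewrite /qval hornerD rmorphD. Qed.
Lemma qvalM P P' r : qval (P * P') r = qval P r * qval P' r.
Proof. by rewrite /qval hornerM rmorphM. Qed.
Lemma qvalC c r : qval c%:P r = val c.
Proof. by rewrite /qval hornerC. Qed.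
Lemma qval1 r : qval 1 r = 1.
Proof. by rewrite -polyC1 qvalC rmorph1. Qed.
Lemma qvalX r : qval 'X r = q%:R ^+ r.
Proof. by rewrite /qval hornerX rmorphXn rmorph_nat. Qed.

(** The points q ^ r are infinite in number. *)
Lemma qval_uniq P P' r0 : (forall r, (r0 <= r)%N -> qval P r = qval P' r) -> P = P'.
Proof.
move=> h; apply/eqP; rewrite -subr_eq0; apply/eqP; set R := P - P'.
pose Q := map_poly (val : Zinv q -> rat) R.
suff Q0 : Q = 0.
  apply/polyP => i; apply: val_inj; rewrite coef0 rmorph0.
  by have /polyP/(_ i) := Q0; rewrite coef_map coef0.
apply/eqP; apply/negPn/negP => Q0.
pose rs := [seq (q%:R : rat) ^+ r | r <- iota r0 (size Q)].
have := @max_poly_roots _ Q rs Q0.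
rewrite size_map size_iota ltnn => H; suff: false by [].
apply: H.
  apply/allP => _ /mapP[r + ->]; rewrite mem_iota => /andP[r0r _].
  rewrite /root /Q -(rmorph_nat (val : Zinv q -> rat)) -rmorphXn horner_map /=.
  by rewrite -/(qval R r) qvalB h // subrr.
rewrite map_inj_uniq ?iota_uniq //; apply: ieexprIn.
  by rewrite ltr0n (ltnW (finNzRing_gt1 F)).
by rewrite (eqr_nat _ q 1) gtn_eqF // finNzRing_gt1.
Qed.

Definition qinv : Zinv q := Zinv_inv q.
Lemma val_qinv : val qinv = (q%:R)^-1. Proof. by []. Qed.

(** The number of nonzero vectors of norm c in E_r, as a polynomial in
    q ^ r. *)
Definition sphere_poly (par : bool) (c : F) : {poly Zinv q} :=
  (if par then (nsqrt c)%:R%:P * 'X + 'X * 'X - 'X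
   else (c == 0)%:R%:P * 'X + ('X * 'X - 'X) * qinv%:P) - (c == 0)%:R%:P.

Lemma qval_sphere_poly par c r : qval (sphere_poly par c) r = sphere_count par c r.
Proof.
rewrite /sphere_poly /sphere_count; case: par.
  by rewrite !(qvalB, qvalD, qvalM, qvalC, qvalX) !rmorph_nat.
by rewrite !(qvalB, qvalD, qvalM, qvalC, qvalX) !rmorph_nat.
Qed.

Section CountingMeasure.
Variable par : bool.
Local Notation evcount := (@evcount F par).

(** The elements with polynomial counts form a subring, closed under division
    by q since q is invertible in the coefficients; it contains the
    generators. *)
Lemma evcount_poly z : exists P, evcount z (qval P).
Proof.
apply: (@Theta_generated F odd_q (fun z => exists P, evcount z (qval P))).
- by exists 1; apply: (evcount_eq (r1 := 0%N) _ (evcount1 F par)) => r _; rewrite qval1.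
- move=> x y [P hP] [P' hP']; exists (P - P').
  by apply: (evcount_eq (r1 := 0%N) _ (evcountB hP hP')) => r _; rewrite qvalB.
- move=> x y [P hP] [P' hP']; exists (P * P').
  by apply: (evcount_eq (r1 := 0%N) _ (evcountM hP hP')) => r _; rewrite qvalM.
- move=> x [P hP]; exists (P * qinv%:P).
  have [u hu] := evcount_ex par x.
  have [r0 h] := evcount_uniq odd_q (evcountMn q hu) hP.
  apply: (evcount_eq (r1 := r0) _ hu) => r /h e.
  by rewrite qvalM qvalC val_qinv -e -(mulr_natr (u r)) mulfK // q_neq0.
move=> c; exists (sphere_poly par c); have [f [-> [r0 h]]] := nzvecs_class odd_q par c.
by apply: (evcount_eq (r1 := r0) _ (evcount_class par f)) => r /h ->; rewrite qval_sphere_poly.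
Qed.

Definition counting_phi z : {poly Zinv q} := projT1 (cid (evcount_poly z)).
Lemma counting_phiP z : evcount z (qval (counting_phi z)).
Proof. by rewrite /counting_phi; case: cid. Qed.

Lemma evcount_phi z P : evcount z (qval P) -> counting_phi z = P.
Proof. by move=> h; have [r0] := evcount_uniq odd_q (counting_phiP z) h; apply: qval_uniq. Qed.

Lemma counting_phiB : {morph counting_phi : x y / x - y}.
Proof.
move=> x y; apply: evcount_phi.
by apply: (evcount_eq (r1 := 0%N) _ (evcountB (counting_phiP x) (counting_phiP y))) => r _; rewrite qvalB.
Qed.

Lemma counting_phiM : monoid_morphism counting_phi.
Proof.
split=> [|x y]; apply: evcount_phi.
  by apply: (evcount_eq (r1 := 0%N) _ (evcount1 F par)) => r _; rewrite qval1.
by apply: (evcount_eq (r1 := 0%N) _ (evcountM (counting_phiP x) (counting_phiP y))) => r _; rewrite qvalM.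
Qed.

HB.instance Definition _ := GRing.isZmodMorphism.Build (Theta F) {poly Zinv q} counting_phi counting_phiB.
HB.instance Definition _ := GRing.isMonoidMorphism.Build (Theta F) {poly Zinv q} counting_phi counting_phiM.

Lemma counting_phi_class (Y X : tsset F) (f : gmap Y X) :
  exists r0, forall r, (r0 <= r)%N -> (counting_phi (Tclass f)).[q%:R ^+ r] = (nu par r f)%:R.
Proof.
have [r0 h] := evcount_uniq odd_q (counting_phiP (Tclass f)) (evcount_class par f).
exists r0 => r /h e; apply: val_inj; rewrite rmorph_nat; exact: e.
Qed.
End CountingMeasure.
End PolyVal.

(** * Quadratic spaces of modified discriminant 1 *)

Section Classify.
Variable F : finFieldType.
Hypothesis odd_q : odd #|F|.
Local Notation q := #|F|.
Local Notation B := (@Vinf_form F).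

Lemma mxformDl n (G : 'M[F]_n) x y z : mxform G (x + y) z = mxform G x z + mxform G y z.
Proof. by rewrite /mxform !mulmxDl mxE. Qed.
Lemma mxformDr n (G : 'M[F]_n) x y z : mxform G x (y + z) = mxform G x y + mxform G x z.
Proof. by rewrite /mxform linearD mulmxDr mxE. Qed.
Lemma mxformZl n (G : 'M[F]_n) c x y : mxform G (c *: x) y = c * mxform G x y.
Proof. by rewrite /mxform -!scalemxAl mxE. Qed.
Lemma mxformZr n (G : 'M[F]_n) c x y : mxform G x (c *: y) = c * mxform G x y.
Proof. by rewrite /mxform linearZ -scalemxAr mxE. Qed.
Lemma mxformC n (G : 'M[F]_n) x y : G^T = G -> mxform G x y = mxform G y x.
Proof.
move=> GT; have E : (x *m G *m y^T)^T = y *m G *m x^T.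
  by rewrite !trmx_mul trmxK GT mulmxA.
by rewrite /mxform -E [RHS]mxE.
Qed.
Definition mxformL := (mxformDl, mxformDr, mxformZl, mxformZr).

(** Fewer linear conditions than unknowns. *)
Lemma ker_ex n k (A : 'M[F]_(n, k)) : (k < n)%N -> exists2 x : 'rV_n, x != 0 & x *m A = 0.
Proof.
move=> kn; have /rowV0Pn[x xK x0] : kermx A != 0.
  rewrite -mxrank_eq0 mxrank_ker subn_eq0 -ltnNge.
  exact: leq_ltn_trans (rank_leq_col A) kn.
by exists x => //; apply/sub_kermxP.
Qed.

(** Otherwise the quadratic character would be -1 on all values of a
    quadratic polynomial in x; but the sum of these values of the character is 1
    or -1, while q > 1. *)
Lemma binary_repr (a b c : F) : a != 0 -> b != 0 -> c != 0 ->
  exists x y, a * x ^+ 2 + b * y ^+ 2 + c = 0.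
Proof.
move=> a0 b0 c0; apply: contrapT => h.
have h0 x : nsqrt (- a / b * x ^+ 2 - 2 * 0 * x + - c / b) = 0%N.
  apply: eq_card0 => y; rewrite inE; apply/eqP => e; apply: h; exists x, y.
  by rewrite e; field.
have := @sum_chi_quad F odd_q (- a / b) 0 (- c / b).
rewrite (eq_bigr (fun=> -1)) => [|x _]; last by rewrite /chi h0 sub0r.
rewrite sumr_const => /(_ _ _)/wrap[]; rewrite ?mulf_neq0 ?oppr_eq0 ?invr_eq0 //.
  have -> : 0 ^+ 2 - - a / b * (- c / b) = - (a * c) / b ^+ 2 by field.
  by rewrite mulf_neq0 ?oppr_eq0 ?mulf_neq0 ?invr_eq0 ?expf_neq0.
move=> e; have := chi_le1 odd_q (- a / b).
move: e; rewrite mulNrn => /oppr_inj <-; apply/negP; rewrite -ltNge.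
by rewrite (ltr_nat _ 1) finNzRing_gt1.
Qed.

Lemma det2 (G : 'M[F]_2) : \det G = G 0 0 * G 1 1 - G 0 1 * G 1 0.
Proof.
have l1 : lift ord0 ord0 = 1 :> 'I_2 by apply: val_inj.
have l2 : lift 1 ord0 = 0 :> 'I_2 by apply: val_inj.
rewrite (expand_det_row _ 0) !big_ord_recl big_ord0 /cofactor !det_mx11 !mxE /= addr0.
by rewrite !l1 l2; ring.
Qed.

(** In dimension 2 an isotropic vector is written down with the help of a
    square root of the opposite of the determinant. In dimension at least 3, an
    orthogonal triple of anisotropic vectors spans an isotropic combination,
    because a binary form represents all nonzero values. *)
Lemma isotropic_ex n (G : 'M[F]_n.+2) : G^T = G ->
  (2 < n.+2)%N \/ (exists c : F, - \det G = c ^+ 2) ->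
  exists2 z : 'rV_n.+2, z != 0 & mxform G z z = 0.
Proof.
move=> GT h; apply: contrapT => an.
have nz z : z != 0 -> mxform G z z != 0 by move=> z0; apply/eqP => e; apply: an; exists z.
case: n G GT h an nz => [|n] G GT h an nz.
  have [//|[c hc]] := h.
  have l1 : lift ord0 ord0 = 1 :> 'I_2 by apply: val_inj.
  have formE (x y : 'rV_2) : mxform G x y =
      (x 0 0 * G 0 0 + x 0 1 * G 1 0) * y 0 0 + (x 0 0 * G 0 1 + x 0 1 * G 1 1) * y 0 1.
    rewrite /mxform mxE !big_ord_recl big_ord0 !mxE !big_ord_recl !big_ord0 !addr0.
    by rewrite !l1.
  have G10 : G 1 0 = G 0 1 by rewrite -[in LHS]GT mxE.
  have a0 : G 0 0 != 0.
    have := nz (delta_mx 0 0); rewrite formE !mxE !eqxx /= !(mulr0, mul0r, mul1r, mulr1, addr0).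
    apply; apply/eqP => /matrixP/(_ 0 0)/eqP; rewrite !mxE !eqxx; exact/negP/oner_neq0.
  (* With a = G 0 0, b = G 0 1 and b ^ 2 - a (G 1 1) = c ^ 2, the quadratic form
     vanishes at (c - b, a). *)
  pose z : 'rV[F]_2 := \row_j (if j == 0 then c - G 0 1 else G 0 0).
  have z0 : z != 0.
    by apply/eqP => /matrixP/(_ 0 1)/eqP; rewrite !mxE; apply/negP.
  have := nz z z0; rewrite formE !mxE /= G10; move/eqP; case.
  transitivity (G 0 0 * (c ^+ 2 - (G 0 1 * G 0 1 - G 0 0 * G 1 1))); first by ring.
  by rewrite -hc det2 G10; ring.
(* An orthogonal triple u, v, w, obtained from one and then two linear
   conditions. *)
have [u u0 _] := @ker_ex n.+3 1 0 isT.
have au := nz u u0.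
have [v v0 vu] := @ker_ex n.+3 1 (G *m u^T) isT.
have vu0 : mxform G v u = 0 by rewrite /mxform -mulmxA vu mxE.
have bv := nz v v0.
have [w w0 /eqP] := @ker_ex n.+3 (1 + 1) (G *m (col_mx u v)^T) isT.
rewrite tr_col_mx !mul_mx_row row_mx_eq0 => /andP[/eqP wu /eqP wv].
have wu0 : mxform G w u = 0 by rewrite /mxform -mulmxA wu mxE.
have wv0 : mxform G w v = 0 by rewrite /mxform -mulmxA wv mxE.
have cw := nz w w0.
have [x [y e]] := binary_repr au bv cw.
have z0 : x *: u + y *: v + w = 0.
  apply/eqP/negPn/negP => /nz/eqP; apply; rewrite !mxformL.
  rewrite (mxformC u v) // (mxformC u w) // (mxformC v w) // vu0 wu0 wv0 -[RHS]e; ring.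
have : mxform G (x *: u + y *: v + w) w = mxform G w w.
  by rewrite !mxformL (mxformC u w) // (mxformC v w) // wu0 wv0 !mulr0 !add0r.
by rewrite z0 -(scale0r w) mxformZl mul0r => e'; move/eqP: cw; rewrite -e'.
Qed.

Definition hyp_mx : 'M[F]_(1 + 1) := block_mx 0 1 1 0.

Lemma hyp_mx_sq : hyp_mx *m hyp_mx = 1%:M.
Proof. by rewrite mulmx_block !(mulmx0, mul0mx, mul1mx, addr0, add0r) -scalar_mx_block. Qed.

Lemma hyp_mx_form (x y : 'rV[F]_(1 + 1)) :
  (x *m hyp_mx *m y^T) 0 0 = x 0 0 * y 0 1 + x 0 1 * y 0 0.
Proof.
have l0 : lshift 1 (0 : 'I_1) = 0 by apply: val_inj.
have l1 : rshift 1 (0 : 'I_1) = 1 by apply: val_inj.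
rewrite -[X in X *m hyp_mx]hsubmxK -[X in _ *m X^T]hsubmxK /hyp_mx mul_row_block tr_row_mx mul_row_col.
rewrite !(mulmx0, mulmx1, addr0, add0r) !mxE !big_ord1 !mxE.
by rewrite !l0 !l1 addrC.
Qed.

Lemma det_hyp : \det hyp_mx = -1.
Proof.
have l0 : lshift 1 (0 : 'I_1) = 0 by apply: val_inj.
have l1 : rshift 1 (0 : 'I_1) = 1 by apply: val_inj.
have e00 : hyp_mx 0 0 = 0 by rewrite -l0 block_mxEul mxE.
have e11 : hyp_mx 1 1 = 0 by rewrite -l1 block_mxEdr mxE.
have e01 : hyp_mx 0 1 = 1 by rewrite -l0 -l1 block_mxEur mxE.
have e10 : hyp_mx 1 0 = 1 by rewrite -l0 -l1 block_mxEdl mxE.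
by rewrite det2 e00 e01 e10 e11; ring.
Qed.

(** An isotropic vector of a nondegenerate space lies in a hyperbolic plane,
    and the orthogonal complement of this plane splits off. *)
Lemma hyp_split N (G : 'M[F]_(1 + 1 + N)) (z : 'rV[F]_(1 + 1 + N)) :
  G^T = G -> G \in unitmx -> z != 0 -> mxform G z z = 0 ->
  exists2 P : 'M[F]_(1 + 1 + N), P \in unitmx &
  exists C : 'M[F]_N, P *m G *m P^T = block_mx hyp_mx 0 0 C.
Proof.
move=> GT Gu z0 zz.
have [y0 zy0] : exists y, mxform G z y = 1.
  have /rV0Pn[i hi] : z *m G != 0.
    by apply: contra_neq z0 => e; rewrite -[z](mulmxK Gu) e mul0mx.
  exists (((z *m G) 0 i)^-1 *: delta_mx 0 i).
  rewrite mxformZr /mxform trmx_delta -colE.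
  by have -> : col i (z *m G) 0 0 = (z *m G) 0 i; [rewrite [LHS]mxE|rewrite mulVf].
(* y completes z to a hyperbolic pair. *)
pose y := y0 - (mxform G y0 y0 / 2) *: z.
have zy : mxform G z y = 1 by rewrite /y -scaleNr mxformDr mxformZr zz mulr0 addr0.
have yy : mxform G y y = 0.
  rewrite /y -scaleNr !mxformL zz (mxformC y0 z GT) zy0.
  by have := halfD odd_q (mxform G y0 y0); move: (_ / 2) => t <-; ring.
pose U : 'M[F]_(1 + 1, 1 + 1 + N) := col_mx z y.
have e11 (A : 'M[F]_1) (c : F) : A 0 0 = c -> A = c%:M.
  by move=> <-; apply/matrixP => i j; rewrite !ord1 mxE mulr1n.
have UU : U *m G *m U^T = hyp_mx.
  rewrite mul_col_mx tr_col_mx mul_col_row /hyp_mx; congr block_mx.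
  - by rewrite (e11 _ _ zz) raddf0.
  - exact: e11 _ _ zy.
  - by apply: e11; rewrite -zy; apply: mxformC.
  - by rewrite (e11 _ _ yy) raddf0.
have freeU : row_free U.
  apply: inj_row_free => x xU; rewrite -[x]mulmx1 -hyp_mx_sq mulmxA -UU !mulmxA xU.
  by rewrite !mul0mx.
have rK : \rank (kermx (G *m U^T)) = N.
  have : \rank (G *m U^T) = (1 + 1)%N.
    rewrite -mxrank_tr trmx_mul trmxK GT mxrankMfree ?row_free_unit //.
    exact/eqP.
  by rewrite mxrank_ker => ->; rewrite addKn.
have [Q [freeQ QU]] : exists Q : 'M[F]_(N, 1 + 1 + N), row_free Q /\ Q *m (G *m U^T) = 0.
  move: (row_base_free (kermx (G *m U^T))) (eq_row_base (kermx (G *m U^T))).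
  move: (row_base _); rewrite rK => Q fQ eQ; exists Q; split=> //.
  by apply/sub_kermxP; rewrite eQ.
pose P : 'M[F]_(1 + 1 + N) := col_mx U Q.
have PP : P *m G *m P^T = block_mx hyp_mx 0 0 (Q *m G *m Q^T).
  rewrite mul_col_mx tr_col_mx mul_col_row UU -!mulmxA QU; congr block_mx.
  by apply: trmx_inj; rewrite !trmx_mul trmxK GT trmx0 -mulmxA.
exists P; last by exists (Q *m G *m Q^T).
rewrite -row_free_unit; apply: inj_row_free => x xP.
have := mulmxA x (P *m G) P^T; rewrite PP mulmxA xP mul0mx mul0mx.
rewrite -[x]hsubmxK mul_row_block !mulmx0 add0r addr0 => /eqP.
rewrite row_mx_eq0 => /andP[/eqP x1 _].
have x10 : lsubmx x = 0 by rewrite -[LHS]mulmx1 -hyp_mx_sq mulmxA x1 mul0mx.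
have x20 : rsubmx x = 0.
  apply: (row_free_inj freeQ); rewrite mul0mx -xP -[in RHS](hsubmxK x) x10.
  by rewrite mul_row_col mul0mx add0r.
by have := hsubmxK x; rewrite x10 x20 row_mx0.
Qed.

(** Renumbering of the basis, which frees the pair e_0, f_0 for a new
    hyperbolic plane. *)
Definition shift (x : Vinf F) : Vinf F := (x.1 * 'X, x.2 * 'X).

Lemma shift_linear : linear shift.
Proof.
by move=> a x y; apply: injective_projections; rewrite /= mulrDl -scalerAl.
Qed.

Lemma shift_form x y : B (shift x) (shift y) = B x y.
Proof.
have [N hN] := insize_ex [:: x]; have [x1 x2] := hN x (mem_head _ _).
have sz (p : {poly F}) : (size p <= N)%N -> (size (p * 'X)%R <= N.+1)%N.
  by move=> h; apply: leq_trans (size_polyMleq _ _) _; rewrite size_polyX addn2.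
rewrite (@formE F N x y x1 x2) (@formE F N.+1 (shift x) _ (sz _ x1) (sz _ x2)) big_ord_recl /= !coefMX /=.
by rewrite !mul0r addr0 add0r; apply: eq_bigr => j _; rewrite !coefMX.
Qed.

Lemma shift_e0 x : B (shift x) (e_ F 0) = 0. Proof. by rewrite form_e coefMX. Qed.
Lemma shift_f0 x : B (shift x) (f_ F 0) = 0. Proof. by rewrite form_f coefMX. Qed.

Lemma EspS par r v : Esp par r.+1 v <->
  exists a b x, Esp par r x /\ v = a *: e_ F 0 + b *: f_ F 0 + shift x.
Proof.
split=> [[s1 s2 hv]|[a [b [x [Ex ->]]]]]; last first.
  have lE := Esp_lin F par r.+1.
  apply: linD => //; first by apply: linD => //; apply: linZ => //; [apply: Esp_e|apply: Esp_f].
  have [s1 s2 hx] := Ex; split=> /=; rewrite ?coefMX //=.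
    by apply: leq_trans (size_polyMleq _ _) _; rewrite size_polyX addn2 ltnS.
  by apply: leq_trans (size_polyMleq _ _) _; rewrite size_polyX addn2 ltnS.
exists v.1`_0, v.2`_0, (drop_poly 1 v.1, drop_poly 1 v.2); split.
  by split=> /=; rewrite ?size_drop_poly ?leq_subLR ?add1n // !coef_drop_poly addn1.
apply: Vinf_eqP => -[|i] /=; rewrite !(coefD, coefZ, coefMX, coefXn, coef0) /=
  ?(mulr1, mulr0, addr0, add0r) // coef_drop_poly addn1 //.
Qed.

(** Hyperbolic planes are split off until the dimension is at most 1. The
    modified discriminant does not change, so it forces the remaining line to be
    spanned by a vector of norm 1 and, in even dimension, provides the isotropic
    vector of the last plane. *)
Lemma classify_Esp (par : bool) r (G : 'M[F]_(r.*2 + par)) : nondegenerate_space 1 G ->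
  exists h : 'rV[F]_(r.*2 + par) -> Vinf F,
    [/\ linear h, forall x y, B (h x) (h y) = mxform G x y
      & forall v, Esp par r v <-> exists x, h x = v].
Proof.
elim: r G => [|r IH] G [GT Gu [c c0 mG]].
  case: par G GT Gu mG => G GT Gu mG.
    have GE : G = (c ^+ 2)%:M.
      move: mG; rewrite /mdisc expr0 !mul1r => e.
      by apply/matrixP => i j; rewrite !ord1 mxE mulr1n -e; apply/esym/det_mx11.
    exists (fun x => (x 0 0 * c) *: last_vec F 0); split.
    - by move=> a x y; rewrite !mxE scalerA -scalerDl; congr (_ *: _); ring.
    - move=> x y; rewrite !formL form_last /= coefZ coefXn eqxx mulr1 mul1r.
      rewrite -[X in X + X]mul1r halfD // GE /mxform mul_mx_scalar -scalemxAl !mxE big_ord1 mxE.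
      ring.
    move=> v; rewrite EspP; split=> [[[u x] [_ <-]]|[x <-]].
      exists ((x / c)%:M); rewrite mxE eqxx mulr1n divfK // /esp_vec /=.
      have -> : hypv u = 0 by apply: injective_projections; apply/polyP => i;
        rewrite coef0 nth_default // (leq_trans (size_poly _ _)).
      by rewrite add0r.
    exists (0, x 0 0 * c); split=> //; rewrite /esp_vec /=.
    by have -> : hypv (0 : 'rV[F]_0 * 'rV[F]_0) = 0; [rewrite /hypv !linear0|rewrite add0r].
  exists (fun=> 0); split.
  - by move=> a x y; rewrite scaler0 addr0.
  - by move=> x y; rewrite form0l /mxform [x]thinmx0 !mul0mx mxE.
  move=> v; rewrite Esp_false; split=> [[]|[_ <-]]; last by rewrite /insize /= size_poly0.
  rewrite !leqn0 !size_poly_eq0 => /eqP v1 /eqP v2; exists 0.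
  by apply: injective_projections.
set N := (r.*2 + par)%N.
have {}mG : - ((-1) ^+ N./2 * \det G) = c ^+ 2.
  by rewrite -[RHS]mul1r -mG /mdisc -[(r.+1.*2 + par)%N./2]/(N./2.+1) exprS; ring.
have [z z0 zz] : exists2 z : 'rV_(1 + 1 + N), z != 0 & mxform (n := 1 + 1 + N) G z z = 0.
  apply: (@isotropic_ex N) => //; have [N0|N0] := posnP N; last by left.
  by right; exists c; rewrite -mG (_ : N./2 = 0%N) ?N0 // mul1r.
have [P Pu [C PC]] := hyp_split GT Gu z0 zz.
have CT : C^T = C.
  have : (P *m G *m P^T)^T = P *m G *m P^T by rewrite !trmx_mul trmxK GT mulmxA.
  by rewrite PC tr_block_mx => /eq_block_mx[].
have dC : - \det C = (\det P) ^+ 2 * \det G.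
  have := congr1 determinant PC; rewrite !det_mulmx det_tr det_lblock det_hyp => e.
  by rewrite -mulN1r -e; ring.
have Cn : nondegenerate_space 1 C.
  split=> //.
    rewrite unitmxE unitfE -oppr_eq0 dC mulf_neq0 ?expf_neq0 //; by rewrite -unitfE -unitmxE.
  exists (c * \det P); first by rewrite mulf_neq0 // -unitfE -unitmxE.
  by rewrite /mdisc mul1r exprMn -mG -[\det C]opprK dC; ring.
have [h [hl hf hE]] := IH C Cn.
pose w (v : 'rV[F]_(1 + 1 + N)) : 'rV[F]_(1 + 1 + N) := v *m invmx P.
have wP v : w v *m P = v by rewrite /w mulmxKV.
pose hh (v : 'rV[F]_(1 + 1 + N)) : Vinf F :=
  (lsubmx (w v)) 0 0 *: e_ F 0 + (lsubmx (w v)) 0 1 *: f_ F 0 + shift (h (rsubmx (w v))).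
have wl a x y : w (a *: x + y) = a *: w x + w y by rewrite /w mulmxDl scalemxAl.
exists hh; split.
- move=> a x y; rewrite /hh wl !linearP hl shift_linear !mxE.
  move: (shift (h (rsubmx (w x)))) (shift (h (rsubmx (w y)))) => s t.
  by apply: Vinf_eqP => i /=; rewrite ?(coefD, coefN, coefZ, coef0); ring.
- move=> x y; have -> : mxform (n := 1 + 1 + N) G x y =
      (w x *m (P *m G *m P^T) *m (w y)^T) 0 0.
    by rewrite !mulmxA wP -!mulmxA -trmx_mul wP mulmxA.
  rewrite PC -[w x in RHS]hsubmxK -[w y in RHS]hsubmxK mul_row_block tr_row_mx mul_row_col.
  rewrite !mulmx0 addr0 add0r [RHS]mxE hyp_mx_form /hh.
  rewrite !formDl !formDr !formZl !formZr shift_form hf !Vinf_form_ee !Vinf_form_ff.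
  rewrite !(formC (e_ F 0) (shift _)) !(formC (f_ F 0) (shift _)) !shift_e0 !shift_f0.
  rewrite Vinf_form_ef (formC (f_ F 0)) Vinf_form_ef /mxform /=; ring.
move=> v; rewrite EspS; split=> [[a [b [x [/hE[x' <-] ->]]]]|[x <-]]; last first.
  by exists (lsubmx (w x) 0 0), (lsubmx (w x) 0 1), (h (rsubmx (w x))); split=> //; apply/hE; eexists.
pose u : 'rV[F]_(1 + 1 + N) := row_mx (row_mx a%:M b%:M) x'.
exists (u *m P); rewrite /hh /w mulmxK // row_mxKl row_mxKr.
have l0 : 0 = lshift 1 (0 : 'I_1) by apply: val_inj.
have l1 : 1 = rshift 1 (0 : 'I_1) by apply: val_inj.
by rewrite l1 l0 row_mxEl row_mxEr !mxE.
Qed.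
End Classify.

(** * Extensions of embeddings as fixed points *)

Section Bridge.
Variable F : finFieldType.
Hypothesis odd_q : odd #|F|.
Local Notation q := #|F|.
Local Notation B := (@Vinf_form F).
Variable par : bool.

Lemma linear_row n (U : lmodType F) (h : 'rV[F]_n -> U) v : linear h ->
  h v = \sum_i v 0 i *: h (delta_mx 0 i).
Proof.
move=> hl; have h0 : h 0 = 0.
  by have := hl (-1) 0 0; rewrite !scaleN1r !addNr.
rewrite {1}[v]row_sum_delta.
have hD x y : h (x + y) = h x + h y by have := hl 1 x y; rewrite !scale1r.
rewrite (big_morph h hD h0); apply: eq_bigr => i _.
by rewrite -[_ *: _]addr0 hl h0 addr0.
Qed.

(** An isometry of the given space onto E_r turns embeddings into it into
    embeddings into V with image in E_r. These are the points fixed by G(E_r)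
    since only vectors of E_r are fixed by this group. *)
Lemma extensions_counted r (G : 'M[F]_(r.*2 + par)) (Y X : tsset F) (f : gmap Y X)
    (k m : nat) (BV : 'M[F]_k) (BW : 'M[F]_m) (i : 'M[F]_(k, m)) (j : 'M[F]_(k, r.*2 + par)) :
  nondegenerate_space 1 G -> restriction_along BV BW i f ->
  embedding (mxform BV) (mxform G) (mulmxr j) ->
  exists2 x : X, over_E par r x & counts (fib par r f x) (extension_count BW G i j).
Proof.
move=> Gn [b [a [[b_inj b_emb b_act] [a_inj a_emb a_act] abf]]] [jl j_inj j_form].
have [h [hl hf hE]] := classify_Esp odd_q Gn.
have h_inj : injective h.
  have [_ Gu _] := Gn; move=> x y e; apply/eqP; rewrite -subr_eq0; apply/eqP.
  have : (x - y) *m G = 0.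
    apply/rowP => l; have := hf (x - y) (delta_mx 0 l).
    have -> : h (x - y) = 0.
      by rewrite addrC -scaleN1r hl e scaleN1r addNr.
    by rewrite form0l /mxform trmx_delta -colE mxE => <-; rewrite mxE.
  by move/(congr1 (mulmxr (invmx G))); rewrite /= mulmxK // mul0mx.
have [x ax] : exists x, a x = h \o mulmxr j.
  apply/a_emb; split=> [c u v|u v /= /h_inj/j_inj //|u v /=].
    by rewrite /= mulmxDl -scalemxAl hl.
  by rewrite hf; apply: j_form.
exists x.
  move=> g gE; apply: a_inj; rewrite a_act ax; apply/funext => v /=.
  by apply: gE; apply/hE; eexists.
have [y0 _] := tsset_trans Y.
pose S := [set M : 'M[F]_(m, r.*2 + par) |
      `[< embedding (mxform BW) (mxform G) (mulmxr M) >] && (i *m M == j)].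
have SP M : M \in S <-> embedding (mxform BW) (mxform G) (mulmxr M) /\ i *m M = j.
  by rewrite inE; split=> [/andP[/asboolP ? /eqP]|[? ->]] //; rewrite eqxx andbT; apply/asboolP.
have yM M : M \in S -> exists y, b y = h \o mulmxr M.
  move=> /SP[[Ml M_inj Mf] _]; apply/b_emb; split=> [c u v|u v /= /h_inj/M_inj //|u v /=].
    by rewrite /= mulmxDl -scalemxAl hl.
  by rewrite hf; apply: Mf.
have yex M : exists y, M \in S -> b y = h \o mulmxr M.
  by have [/yM[y by_]|_] := boolP (M \in S); [exists y|exists y0].
pose t M := projT1 (cid (yex M)).
have tE M : M \in S -> b (t M) = h \o mulmxr M by rewrite /t; case: cid.
apply: (counts_bij (f := t)) (counts_pred (mem S)).
- move=> M MS; have [_ iM] := (proj1 (SP M)) MS; split.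
    apply: a_inj; rewrite abf ax tE //; apply/funext => v /=.
    by rewrite -mulmxA iM.
  move=> g gE; apply: b_inj; rewrite b_act tE //; apply/funext => v /=.
  by apply: gE; apply/hE; eexists.
- move=> M M' MS MS' e; have := tE M MS; rewrite e tE // => e2.
  apply/row_matrixP => l; rewrite !rowE; apply: h_inj.
  by have /(congr1 (fun z => z (delta_mx 0 l))) /= := e2.
move=> y [fy yy].
have [byl by_inj byf] : embedding (mxform BW) B (b y) by apply/b_emb; exists y.
have bE v : exists u, h u = b y v.
  apply/hE; apply: contrapT => /(not_Esp_moved odd_q)[g [gE]]; apply.
  by have := b_act g y; rewrite yy // => e; rewrite [in RHS]e.
pose u v := projT1 (cid (bE v)).
have uE v : h (u v) = b y v by rewrite /u; case: cid.
pose M := \matrix_(l < m) u (delta_mx 0 l).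
have hM v : h (v *m M) = b y v.
  rewrite mulmx_sum_row (linear_row v byl).
  have h0 : h 0 = 0 by have := hl (-1) 0 0; rewrite !scaleN1r !addNr.
  have hD z w : h (z + w) = h z + h w by have := hl 1 z w; rewrite !scale1r.
  rewrite (big_morph h hD h0); apply: eq_bigr => l _.
  by rewrite -[_ *: row _ _]addr0 hl h0 addr0 rowK uE.
have MS : M \in S.
  apply/SP; split.
    split=> [c z w|z w /= e|z w].
    - by rewrite /= mulmxDl -scalemxAl.
    - by apply: by_inj; rewrite -!hM e.
    - by rewrite /= -hf !hM.
  apply/row_matrixP => l; rewrite !rowE mulmxA; apply: h_inj; rewrite hM.
  have /(congr1 (fun z => z (delta_mx 0 l))) /= := ax.
  by rewrite -fy abf.
exists M => //; apply: b_inj; rewrite tE //; apply/funext => v; exact: hM.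
Qed.

Lemma counting_phi_measure : counting_measure par (counting_phi odd_q par).
Proof.
move=> Y X f k m BV BW i _ _ _ ra.
have [r1 h1] := counting_phi_class odd_q par f; have [r2 h2] := nuP odd_q par f.
exists (maxn r1 r2) => r; rewrite geq_max => /andP[/h1 e /h2 ir] G j Gn je.
have [x fx cx] := extensions_counted Gn ra je.
by rewrite e (nu_eq ir fx cx).
Qed.
End Bridge.

(** * Values of a counting measure on the generators *)

Section Values.
Variable F : finFieldType.
Hypothesis odd_q : odd #|F|.
Local Notation q := #|F|.
Local Notation B := (@Vinf_form F).

Lemma orb_head c (g : Orth F) :
  head 0 (orb_val (gact g (pt [:: w_ 0 c]) : orb [:: w_ 0 c])) = g (w_ 0 c).
Proof. by have /= -> := orb_val_act g (orb_pt [:: w_ 0 c]); rewrite orb_val_pt. Qed.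

Lemma orb_nil (x : orb ([::] : seq (Vinf F))) : x = pt [::].
Proof.
have [g <-] := ts_trans (pt [::]) x; by apply: (proj2 (gact_pt [::] g)).
Qed.

(** Nonzero vectors of norm c are the embeddings of a line with Gram matrix
    c, so the map from their orbit to the point is restriction to the zero
    space. *)
Lemma restriction_nzvecs c (f : gmap (orb [:: w_ 0 c]) (orb [::])) :
  restriction_along (0 : 'M[F]_0) (c%:M : 'M[F]_1) 0 f.
Proof.
pose hd (y : orb [:: w_ 0 c]) : Vinf F := head 0 (orb_val y).
have hdE y : exists2 g : Orth F, y = gact g (pt [:: w_ 0 c]) & hd y = g (w_ 0 c).
  by have [g <-] := ts_trans (pt [:: w_ 0 c]) y; exists g; rewrite // /hd orb_head.
have mxf (x y : 'rV[F]_1) : mxform c%:M x y = c * (x 0 0 * y 0 0).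
  by rewrite /mxform mul_mx_scalar -scalemxAl !mxE big_ord1 mxE.
have v1 (v : 'rV[F]_1) : v = v 0 0 *: const_mx 1.
  by apply/matrixP => i j; rewrite !ord1 !mxE mulr1.
exists (fun y v => v 0 0 *: hd y), (fun _ _ => 0); split; last first.
- by move=> y; apply/funext => v /=; rewrite mulmx0 mxE scale0r.
- split=> [x y _|h|g x]; first by rewrite (orb_nil x) (orb_nil y).
    split=> [[hl _ _]|[x <-]].
      exists (pt [::]); apply/funext => v; rewrite [v]thinmx0.
      by have := hl (-1) 0 0; rewrite !scaleN1r !addNr.
    split=> [a u v|u v _|u v]; first by rewrite scaler0 addr0.
      by rewrite [u]thinmx0 [v]thinmx0.
    by rewrite form0l /mxform [u]thinmx0 !mul0mx mxE.
  by apply/funext => v /=; rewrite Orth0.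
split.
- move=> y z /(congr1 (fun k => k (const_mx 1))); rewrite !mxE !scale1r.
  have [g -> ->] := hdE y; have [k -> ->] := hdE z => e.
  by apply/gact_pt_eq; apply: (congr1 (fun v => [:: v]) e).
- move=> h; split=> [[hl h_inj hf]|[y <-]].
    have h0 : h 0 = 0 by have := hl (-1) 0 0; rewrite !scaleN1r !addNr.
    pose v := h (const_mx 1).
    have v0 : v <> 0.
      rewrite -h0 => /h_inj/matrixP/(_ 0 0)/eqP; rewrite !mxE.
      exact/negP/oner_neq0.
    have [||||g [_ gw]] := @witt_full F odd_q [::] (w_ 0 c) v => //.
    + exact: w_neq0.
    + by rewrite form_ww // hf mxf !mxE !mulr1.
    exists (gact g (pt [:: w_ 0 c])); apply/funext => u.
    rewrite /hd orb_head gw [in RHS](v1 u) -[_ *: const_mx 1]addr0 hl h0 addr0 //.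
  have [g _ ->] := hdE y.
  split=> [a u v|u v /eqP|u v].
  + by rewrite !mxE scalerA scalerDl.
  + rewrite -subr_eq0 -scalerBl => /eqP e; apply/matrixP => i j; rewrite !ord1.
    apply/eqP; rewrite -subr_eq0; apply/negPn/negP => n0.
    apply: (@w_neq0 F 0 c); apply: (bij_inj (Orth_bij g)); rewrite Orth0.
    by rewrite -[g _]scale1r -(mulVf n0) -scalerA e scaler0.
  + by rewrite formZl formZr Orth_form form_ww // mxf; ring.
move=> g y; apply/funext => v; change (v 0 0 *: hd (gact g y) = g (v 0 0 *: hd y)).
rewrite OrthZ; congr (_ *: _).
have [k yk ->] := hdE y; rewrite yk.
have -> : gact g (gact k (pt [:: w_ 0 c])) = gact (Orth_mul g k) (pt [:: w_ 0 c]) by rewrite gact_mul.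
exact: orb_head.
Qed.

Lemma prod_signs n : \prod_(i < n) (-1) ^+ i = (-1) ^+ n./2 :> F.
Proof.
have [m] := ubnP n; elim: m n => // m IH [|[|n]] h; first by rewrite big_ord0.
  by rewrite big_ord1.
rewrite !big_ord_recr /= IH; last by move: h; lia.
have s2 : (-1) ^+ n.*2 = 1 :> F by rewrite -signr_odd odd_double.
by rewrite -mulrA -exprD addnS exprS addnn s2 exprS; ring.
Qed.

(** A diagonal form with alternating signs. Without a space of modified
    discriminant 1 the definition of a counting measure would say nothing. *)
Lemma nondeg_ex n : exists G : 'M[F]_n, nondegenerate_space 1 G.
Proof.
exists (diag_mx (\row_i (-1) ^+ i)).
have dE : \det (diag_mx (\row_(i < n) (-1) ^+ i)) = (-1) ^+ n./2 :> F.
  by rewrite det_diag -prod_signs; apply: eq_bigr => i _; rewrite mxE.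
split; first exact: tr_diag_mx.
  by rewrite unitmxE dE unitrX ?unitrN1.
exists 1; first exact: oner_neq0.
have s2 k : (-1) ^+ k.*2 = 1 :> F by rewrite -signr_odd odd_double.
by rewrite /mdisc dE -exprD addnn s2 expr1n mulr1.
Qed.

(** Extensions of the embedding of the zero space to a line with Gram matrix
    c are the nonzero vectors of norm c in E_r. *)
Lemma counting_nzvecs par (phi : {rmorphism Theta F -> {poly Zinv q}}) c :
  counting_measure par phi -> phi (nzvecs 0 c) = sphere_poly par c.
Proof.
move=> cm; have [f [-> [r1 h1]]] := nzvecs_class odd_q par c.
have emb k (G : 'M[F]_k) : embedding (mxform (0 : 'M[F]_0)) (mxform G) (mulmxr 0).
  split=> [a u v|u v _|u v] /=; first by rewrite !mulmx0 scaler0 addr0.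
    by rewrite [u]thinmx0 [v]thinmx0.
  by rewrite /mxform !mulmx0 !mul0mx.
have [r2 h2] := cm _ _ f _ _ _ _ _ (trmx0 _ _ _) (tr_scalar_mx _ _) (emb _ _) (restriction_nzvecs f).
have [r3 h3] := nuP odd_q par f.
apply: (@qval_uniq F _ _ (maxn r1 (maxn r2 r3))) => r.
rewrite !geq_max => /and3P[/h1 e /h2 k /h3 ir].
have [G Gn] := nondeg_ex (r.*2 + par).
have [x fx cx] := extensions_counted odd_q Gn (restriction_nzvecs f) (emb _ G).
rewrite qval_sphere_poly -e (nu_eq ir fx cx) /qval (k _ _ Gn (emb _ G)).
exact: rmorph_nat.
Qed.
End Values.

(** * The pair of counting measures and the node *)

Section Final.
Variable F : finFieldType.
Hypothesis odd_q : odd #|F|.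
Local Notation q := #|F|.
Local Notation C := (Zinv (2 * q)).
Local Notation N := (2 * q)%N.
Local Notation L := (loc (N%:R : Theta F)).
Local Notation iota := (@to_loc (Theta F) N%:R).
Local Notation pairs := ({poly C} * {poly C})%type.

Variables phi_e phi_o : {rmorphism Theta F -> {poly Zinv q}}.
Hypotheses (cme : counting_measure false phi_e) (cmo : counting_measure true phi_o).
Variable eps : F.
Hypothesis eps_ns : nsqrt eps = 0%N.

Local Notation ge := (@gen_e F eps).
Local Notation go := (@gen_o F eps).

Lemma N_gt0 : (0 < N)%N.
Proof. by rewrite muln_gt0 /= (ltnW (finNzRing_gt1 F)). Qed.

Lemma phi_ge (phi : {rmorphism Theta F -> {poly Zinv q}}) :
  phi ge = (phi (nzvecs 0 0) + 1) *+ 2 - phi (nzvecs 0 1) - phi (nzvecs 0 eps).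
Proof. by rewrite /gen_e !rmorphB rmorphMn rmorphD rmorph1. Qed.
Lemma phi_go (phi : {rmorphism Theta F -> {poly Zinv q}}) :
  phi go = phi (nzvecs 0 1) - phi (nzvecs 0 eps).
Proof. by rewrite /gen_o rmorphB. Qed.

Lemma nsqrt1 : nsqrt (1 : F) = 2%N.
Proof. by rewrite -(expr1n _ 2) nsqrt_sq ?oner_neq0. Qed.

Lemma K_false0 : sphere_poly false (0 : F) = 'X + ('X * 'X - 'X) * (qinv F)%:P - 1.
Proof. by rewrite /sphere_poly eqxx /= mulr1n polyC1 mul1r. Qed.
Lemma K_false (c : F) : c != 0 -> sphere_poly false c = ('X * 'X - 'X) * (qinv F)%:P.
Proof. by move=> /negbTE h; rewrite /sphere_poly h /= mulr0n polyC0 mul0r add0r subr0. Qed.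
Lemma K_true0 : sphere_poly true (0 : F) = 'X * 'X - 1.
Proof. by rewrite /sphere_poly eqxx nsqrt0 /= mulr1n polyC1; ring. Qed.
Lemma K_true1 : sphere_poly true (1 : F) = 'X * 'X + 'X.
Proof. by rewrite /sphere_poly oner_eq0 nsqrt1 /= mulr0n polyC0 polyCMn polyC1; ring. Qed.
Lemma K_true_eps : sphere_poly true eps = 'X * 'X - 'X.
Proof. by rewrite /sphere_poly eps_ns (negbTE (eps_neq0 eps_ns)) /= mulr0n polyC0; ring. Qed.

Lemma map_X2 : map_poly (@Zinv_incl 2 q) ('X *+ 2) = 'X *+ 2.
Proof. by rewrite rmorphMn /= map_polyX. Qed.

Lemma pair_ge : counting_pair phi_e phi_o ge = ('X *+ 2, 0).
Proof.
rewrite /counting_pair !phi_ge !(counting_nzvecs odd_q _ cme) !(counting_nzvecs odd_q _ cmo).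
rewrite K_false0 !K_false ?oner_neq0 ?(eps_neq0 eps_ns) // K_true0 K_true1 K_true_eps.
by congr pair; [rewrite -map_X2; congr map_poly; ring|rewrite -[RHS](rmorph0 (map_poly (@Zinv_incl 2 q))); congr map_poly; ring].
Qed.

Lemma pair_go : counting_pair phi_e phi_o go = (0, 'X *+ 2).
Proof.
rewrite /counting_pair !phi_go !(counting_nzvecs odd_q _ cme) !(counting_nzvecs odd_q _ cmo).
rewrite !K_false ?oner_neq0 ?(eps_neq0 eps_ns) // K_true1 K_true_eps.
by congr pair; [rewrite -[RHS](rmorph0 (map_poly (@Zinv_incl 2 q))); congr map_poly; ring|rewrite -map_X2; congr map_poly; ring].
Qed.

Let CL : {rmorphism L -> pairs} := counting_loc phi_e phi_o.

Lemma CL_iota a : CL (iota a) = counting_pair phi_e phi_o a.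
Proof. exact: loc_lift_to_loc. Qed.

Definition inv2q : L := frac N%:R 1 1.

Lemma iota_s : iota N%:R = N%:R :> L.
Proof. exact: rmorph_nat. Qed.

Lemma frac_scale a n : frac N%:R a n * N%:R ^+ n = iota a :> L.
Proof.
rewrite -iota_s -(rmorphXn iota).
have -> : frac N%:R a n * iota (N%:R ^+ n) = frac N%:R (a * N%:R ^+ n) (n + 0).
  exact: fracM.
by apply: frac_eq; rewrite addn0 expr0 mulr1.
Qed.

Lemma inv2q_mulV : N%:R * inv2q = 1.
Proof. exact: etrans (mulrC _ _) (etrans (frac_scale 1 1) (rmorph1 iota)). Qed.

(** The powers of 2q are invertible here, so that every element is a multiple
    of some f(2e) + g(2o). *)
Lemma loc_normal x : exists n f g, x * N%:R ^+ n = ev f (iota ge) + ev g (iota go).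
Proof.
have [a [n ax]] := frac_surj x.
have [_ /(_ a) [k [f [g e]]]] := @node_of_Theta F odd_q L iota inv2q inv2q_mulV eps eps_ns.
exists (n + k)%N, f, g; rewrite exprD mulrA -[x]ax frac_scale; exact: e.
Qed.

Lemma CL_normal f g : CL (ev f (iota ge) + ev g (iota go)) =
  (ev f ('X *+ 2) + (g`_0)%:~R, (f`_0)%:~R + ev g ('X *+ 2)).
Proof.
rewrite rmorphD !rmorph_ev !CL_iota pair_ge pair_go.
have e1 (p : {poly int}) (y : pairs) : ev p y = (ev p y.1, ev p y.2).
  apply: injective_projections => /=.
    exact: (rmorph_ev (fst : {rmorphism pairs -> {poly C}})).
  exact: (rmorph_ev (snd : {rmorphism pairs -> {poly C}})).
have e0 (p : {poly int}) : ev p (0 : {poly C}) = (p`_0)%:~R.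
  by have [w ->] := ev_split0 p (0 : {poly C}); rewrite mul0r add0r.
by rewrite !e1 /= !e0.
Qed.

Lemma CL_N n : CL (N%:R ^+ n) = N%:R ^+ n.
Proof. by rewrite rmorphXn rmorph_nat. Qed.

Lemma coef_ev f i : (ev f ('X *+ 2 : {poly C}))`_i = (f`_i)%:~R *+ 2 ^ i.
Proof.
elim/poly_ind: f i => [|f a IH] i; first by rewrite ev0 !coef0 mulr0z mul0rn.
rewrite ev_cons -(rmorph_int (@polyC C)) !coefD !coefC mulrnAr coefMn !coefMX.
case: i => [|i] /=; first by rewrite mul0rn !add0r mulr1n.
by rewrite IH !addr0 expnSr mulrnA.
Qed.

Lemma int_C_inj (a : int) : (a%:~R : C) = 0 -> a = 0.
Proof.
move=> /(congr1 val); rewrite rmorph_int rmorph0 => /eqP; rewrite intr_eq0 => /eqP //.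
Qed.

Lemma nat_C_cancel n (c : C) : (0 < n)%N -> c *+ n = 0 -> c = 0.
Proof.
move=> n0 /(congr1 val); rewrite rmorphMn rmorph0 => /eqP; rewrite mulrn_eq0.
by rewrite eqn0Ngt n0 => /eqP c0; apply: val_inj; rewrite rmorph0.
Qed.

Lemma ev_C_const f (c : C) : ev f ('X *+ 2 : {poly C}) = c%:P -> f = (f`_0)%:P.
Proof.
move=> e; apply/polyP => i; rewrite coefC; case: eqP => [->//|/eqP i0].
apply: int_C_inj; apply: (@nat_C_cancel (2 ^ i)); first by rewrite expn_gt0.
by rewrite -coef_ev e coefC (negbTE i0).
Qed.

(** Put the element in the form f(2e) + g(2o). If its image vanishes, then f
    and g are constant, and the constants are opposite. *)
Lemma CL_inj0 x : CL x = 0 -> x = 0.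
Proof.
move=> x0; have [n [f [g e]]] := loc_normal x.
have := congr1 CL e; rewrite rmorphM x0 mul0r CL_normal => /esym[e1 e2].
have iC (a : int) : (a%:~R : {poly C}) = (a%:~R)%:P by rewrite rmorph_int.
have fC : f = (f`_0)%:P.
  apply: (@ev_C_const _ (- (g`_0)%:~R)); rewrite polyCN -iC.
  by apply/eqP; rewrite -addr_eq0 e1.
have gC : g = (g`_0)%:P.
  apply: (@ev_C_const _ (- (f`_0)%:~R)); rewrite polyCN -iC.
  by apply/eqP; rewrite -addr_eq0 addrC e2.
have fg0 : f`_0 + g`_0 = 0.
  apply: int_C_inj; apply: (@polyC_inj C); rewrite rmorph0 -e1 fC evC coefC /=.
  by rewrite !iC -polyCD -mulrzDr.
have xN : x * N%:R ^+ n = 0.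
  by rewrite e fC gC !evC -mulrzDr fg0 mulr0z.
have -> : x = x * N%:R ^+ n * inv2q ^+ n by rewrite -mulrA -exprMn inv2q_mulV expr1n mulr1.
by rewrite xN mul0r.
Qed.

Lemma CL_inj : injective CL.
Proof.
move=> x y e; apply/eqP; rewrite -subr_eq0; apply/eqP/CL_inj0.
by rewrite rmorphB e subrr.
Qed.

Lemma CL_image_eq x : (CL x).1.[0] = (CL x).2.[0].
Proof.
have [n [f [g e]]] := loc_normal x.
have := congr1 CL e; rewrite rmorphM CL_N CL_normal => e'.
have ev00 (h : {poly int}) : (ev h ('X *+ 2 : {poly C})).[0] = (h`_0)%:~R.
  by rewrite horner_coef0 coef_ev mulr1n.
have iC (a : int) : (a%:~R : {poly C}).[0] = a%:~R by rewrite -(rmorph_int (@polyC C)) hornerC.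
rewrite -natrX (mulr_natr (CL x)) in e'.
have p1 (p : pairs) k : (p *+ k).1 = p.1 *+ k by exact: (raddfMn fst).
have p2 (p : pairs) k : (p *+ k).2 = p.2 *+ k by exact: (raddfMn snd).
apply/eqP; rewrite -subr_eq0; apply/eqP.
apply: (@nat_C_cancel (N ^ n)); first by rewrite expn_gt0 N_gt0.
by rewrite mulrnBl -!hornerMn -p1 -p2 e' /= !hornerD !ev00 !iC subrr.
Qed.

Let Im (p : pairs) := exists x, CL x = p.
Lemma ImD p p' : Im p -> Im p' -> Im (p + p').
Proof. by move=> [x <-] [y <-]; exists (x + y); rewrite rmorphD. Qed.
Lemma ImM p p' : Im p -> Im p' -> Im (p * p').
Proof. by move=> [x <-] [y <-]; exists (x * y); rewrite rmorphM. Qed.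

Lemma CL_inv2q : CL inv2q = ((Zinv_inv N)%:P, (Zinv_inv N)%:P).
Proof.
apply: etrans (loc_lift_frac _ _ _) _.
by rewrite (rmorph1 (counting_pair phi_e phi_o)) mul1r expr1.
Qed.

Lemma Im_const (c : C) : Im (c%:P, c%:P).
Proof.
have [k] := asboolP _ (valP c); move=> /intrP[z cz].
have cE : c = z%:~R * Zinv_inv N ^+ k.
  apply: val_inj; rewrite rmorphM rmorph_int rmorphXn /= -cz -mulrA -exprMn divff ?expr1n ?mulr1 //.
  by rewrite pnatr_eq0 -lt0n N_gt0.
exists (z%:~R * inv2q ^+ k); rewrite rmorphM rmorph_int rmorphXn CL_inv2q.
apply: injective_projections.
  rewrite (rmorphM (fst : {rmorphism pairs -> {poly C}})).
  rewrite (rmorph_int (fst : {rmorphism pairs -> {poly C}})) (rmorphXn (fst : {rmorphism pairs -> {poly C}})) /=.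
  by rewrite -(rmorph_int (@polyC C)) -(rmorphXn (@polyC C)) -(rmorphM (@polyC C)) cE.
rewrite (rmorphM (snd : {rmorphism pairs -> {poly C}})).
rewrite (rmorph_int (snd : {rmorphism pairs -> {poly C}})) (rmorphXn (snd : {rmorphism pairs -> {poly C}})) /=.
by rewrite -(rmorph_int (@polyC C)) -(rmorphXn (@polyC C)) -(rmorphM (@polyC C)) cE.
Qed.

Lemma half_C : (q%:R * Zinv_inv N) *+ 2 = 1 :> C.
Proof. by rewrite -mulrnAl -mulr_natl -natrM Zinv_mulV ?N_gt0. Qed.

Lemma half_X : 'X *+ 2 * (q%:R * Zinv_inv N)%:P = 'X :> {poly C}.
Proof.
have h : (q%:R * Zinv_inv N)%:P *+ 2 = 1 :> {poly C}.
  exact: etrans (esym (polyCMn _ _)) (congr1 polyC half_C).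
exact: etrans (mulrnAl _ _ _) (etrans (esym (mulrnAr 'X _ 2)) (etrans (congr1 _ h) (mulr1 _))).
Qed.

Lemma Im_X0 : Im ('X, 0).
Proof.
have -> : ('X, 0) = ('X *+ 2, 0) * ((q%:R * Zinv_inv N)%:P, (q%:R * Zinv_inv N)%:P) :> pairs.
  apply: injective_projections => /=; last by rewrite mul0r.
  exact/esym/half_X.
by apply: ImM (Im_const _); exists (iota ge); rewrite CL_iota pair_ge.
Qed.

Lemma Im_0X : Im (0, 'X).
Proof.
have -> : (0, 'X) = (0, 'X *+ 2) * ((q%:R * Zinv_inv N)%:P, (q%:R * Zinv_inv N)%:P) :> pairs.
  apply: injective_projections => /=; first by rewrite mul0r.
  exact/esym/half_X.
by apply: ImM (Im_const _); exists (iota go); rewrite CL_iota pair_go.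
Qed.

Lemma Im_fX f : Im (f * 'X, 0) /\ Im (0, f * 'X).
Proof.
elim/poly_ind: f => [|f c [h1 h2]].
  by rewrite mul0r; split; exists 0; rewrite rmorph0.
have h := Im_const c; split.
  have -> : ((f * 'X + c%:P) * 'X, 0) = ((f * 'X, 0) + (c%:P, c%:P)) * ('X, 0) :> pairs.
    by apply: injective_projections => //=; rewrite mulr0.
  exact: ImM (ImD h1 h) Im_X0.
have -> : (0, (f * 'X + c%:P) * 'X) = ((0, f * 'X) + (c%:P, c%:P)) * (0, 'X) :> pairs.
  by apply: injective_projections => //=; rewrite mulr0.
exact: ImM (ImD h2 h) Im_0X.
Qed.

(** The image contains the constants and the pairs (t, 0) and (0, t), because
    2q is invertible; these generate the ring of pairs with equal values at 0. *)
Lemma image_CL (p : pairs) : Im p <-> p.1.[0] = p.2.[0].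
Proof.
split=> [[x <-]|]; first exact: CL_image_eq.
case: p => f g /=; elim/poly_ind: f => [|f c _]; elim/poly_ind: g => [|g d _];
  rewrite !hornerE.
- by move=> _; exists 0; rewrite rmorph0.
- move=> <-; rewrite polyC0 addr0; exact: (Im_fX g).2.
- move=> ->; rewrite polyC0 addr0; exact: (Im_fX f).1.
move=> ->; have -> : (f * 'X + d%:P, g * 'X + d%:P) =
    (f * 'X, 0) + (0, g * 'X) + (d%:P, d%:P) :> pairs.
  by apply: injective_projections => /=; rewrite ?addr0 ?add0r.
by apply: ImD (Im_const d); apply: ImD; [exact: (Im_fX f).1|exact: (Im_fX g).2].
Qed.

Local Notation node_rel := (fun x : {poly {poly C}} => x = 'X * ('X)%:P).
Local Notation R := (node_ring F).
Local Notation rqn := (@rq _ node_rel).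

(** The polynomial f(t) + g(t') - f(0), with t = 'X%:P and t' = 'X. *)
Definition node_lift (p : pairs) : {poly {poly C}} :=
  p.1%:P + map_poly polyC p.2 - (p.1.[0])%:P%:P.

Definition node_psi (x : L) : R := rqn (node_lift (CL x)).

Lemma node_rel0 : rqn ('X * ('X)%:P) = 0.
Proof.
rewrite -(rmorph0 rqn); apply/rqP/asboolP.
by exists 1%N, (fun=> 1), (fun=> 'X * ('X)%:P); split=> //; rewrite big_ord1 mul1r subr0.
Qed.

(** Each factor has no constant term, so the product is divisible by
    t t'. *)
Lemma node_cross (f g : {poly C}) :
  rqn ((f%:P - (f.[0])%:P%:P) * (map_poly polyC g - (g.[0])%:P%:P)) = 0.
Proof.
have fac (h : {poly C}) : exists h1, h - (h.[0])%:P = h1 * 'X.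
  have /factor_theorem[h1 e] : root (h - (h.[0])%:P) 0 by rewrite /root !hornerE subrr.
  by exists h1; rewrite e polyC0 subr0.
have [f1 ef] := fac f; have [g1 eg] := fac g.
have -> : (f%:P - (f.[0])%:P%:P) * (map_poly polyC g - (g.[0])%:P%:P) =
    f1%:P * map_poly polyC g1 * ('X * ('X)%:P) :> {poly {poly C}}.
  have -> : f%:P - (f.[0])%:P%:P = f1%:P * ('X)%:P :> {poly {poly C}}.
    by rewrite -polyCB ef polyCM.
  have -> : map_poly polyC g - (g.[0])%:P%:P = map_poly polyC g1 * 'X.
    rewrite -(map_polyC (@polyC C)) -rmorphB eg.
    by rewrite (rmorphM (map_poly (@polyC C))) /= map_polyX.
  by ring.
exact: etrans (rmorphM rqn _ _) (etrans (congr1 _ node_rel0) (mulr0 _)).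
Qed.

Lemma node_liftB (p p' : pairs) : node_lift (p - p') = node_lift p - node_lift p'.
Proof.
rewrite /node_lift hornerD hornerN !polyCB (rmorphB (map_poly (@polyC C))) /=.
ring.
Qed.

(** For f(0) = g(0), multiplicativity fails only by multiples of the crossed
    products, which vanish on the node. *)
Lemma node_liftM (p p' : pairs) : p.1.[0] = p.2.[0] -> p'.1.[0] = p'.2.[0] ->
  rqn (node_lift (p * p')) = rqn (node_lift p * node_lift p').
Proof.
move=> e e'.
have n1 := node_cross p.1 p'.2; have n2 := node_cross p'.1 p.2.
rewrite -e' in n1; rewrite -e in n2.
have -> : node_lift p * node_lift p' = node_lift (p * p') +
    (p.1%:P - (p.1.[0])%:P%:P) * (map_poly polyC p'.2 - (p'.1.[0])%:P%:P) +
    (p'.1%:P - (p'.1.[0])%:P%:P) * (map_poly polyC p.2 - (p.1.[0])%:P%:P).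
  rewrite /node_lift hornerM !polyCM (rmorphM (map_poly (@polyC C))) /=; ring.
apply/esym; apply: etrans (rqD _ _ _) _.
apply: etrans (congr1 _ n2) _; apply: etrans (addr0 _) _.
apply: etrans (rqD _ _ _) _.
by apply: etrans (congr1 _ n1) _; exact: addr0.
Qed.

Lemma node_psiB : {morph node_psi : x y / x - y}.
Proof.
move=> x y; apply: etrans _ (rqB _ _ _).
exact: (congr1 (rqn) (etrans (congr1 node_lift (rmorphB CL x y)) (node_liftB _ _))).
Qed.

Lemma node_psiM : monoid_morphism node_psi.
Proof.
split=> [|x y].
  apply: (congr1 rqn); apply: etrans (congr1 node_lift (rmorph1 CL)) _.
  by rewrite /node_lift /= hornerC map_polyC /= polyC1 addrK.
apply: etrans (congr1 (fun p => rqn (node_lift p)) (rmorphM CL x y)) _.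
apply: etrans (node_liftM (CL_image_eq x) (CL_image_eq y)) _.
exact: (rmorphM rqn).
Qed.

Definition node_psi_morph : {rmorphism L -> R} :=
  let psiB := GRing.isZmodMorphism.Build L R node_psi node_psiB in
  let psiM := GRing.isMonoidMorphism.Build L R node_psi node_psiM in
  HB.pack node_psi psiB psiM.

Lemma node_lift_at0 z : (node_lift (CL z)).[0] = (CL z).1.
Proof.
rewrite /node_lift CL_image_eq hornerD hornerN hornerD !hornerC.
by rewrite !horner_coef0 coef_map addrK.
Qed.

Lemma node_lift_coef0 z :
  map_poly (horner_eval (0 : C)) (node_lift (CL z)) = (CL z).2.
Proof.
have hC (c : C) : horner_eval 0 c%:P = c by exact: hornerC.
rewrite /node_lift rmorphB rmorphD /= !map_polyC /= hC.
rewrite addrAC subrr add0r; apply/polyP => i.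
by rewrite !coef_map /= hC.
Qed.

(** Setting t' = 0 recovers f and setting t = 0 recovers g; both substitutions
    kill the multiples of t t'. *)
Lemma node_psi_inj : injective node_psi.
Proof.
move=> x y; rewrite /node_psi => /rqP/asboolP[n [c [s [sE e]]]].
apply: CL_inj.
pose ev0 := map_poly (horner_eval (0 : C)).
have e0 : (node_lift (CL x)).[0] = (node_lift (CL y)).[0].
  apply/eqP; rewrite -subr_eq0 -hornerN -hornerD e horner_sum big1 // => i _.
  by rewrite sE !hornerM hornerX mul0r mulr0.
have e1 : ev0 (node_lift (CL x)) = ev0 (node_lift (CL y)).
  apply/eqP; rewrite -subr_eq0 -rmorphB e rmorph_sum big1 // => i _.
  rewrite sE !rmorphM /= map_polyC /= /horner_eval hornerX polyC0.
  by rewrite !mulr0.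
apply: injective_projections; first by rewrite -!node_lift_at0.
by rewrite -!node_lift_coef0.
Qed.

Lemma node_psi_surj z : exists x, node_psi x = z.
Proof.
pose I z := exists x, node_psi x = z.
have ID a b : I a -> I b -> I (a + b).
  by move=> [x <-] [y <-]; exists (x + y); exact: (rmorphD node_psi_morph).
have IM a b : I a -> I b -> I (a * b).
  by move=> [x <-] [y <-]; exists (x * y); exact: (rmorphM node_psi_morph).
have IC c : I (rqn c%:P%:P).
  have [x e] := Im_const c; exists x; rewrite /node_psi e; congr rq.
  by rewrite /node_lift /= hornerC map_polyC addrK.
have IX' : I (rqn ('X)%:P).
  have [x e] := Im_X0; exists x; rewrite /node_psi e; congr rq.
  by rewrite /node_lift /= hornerX map_poly0 !polyC0 addr0 subr0.
have IX : I (rqn 'X).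
  have [x e] := Im_0X; exists x; rewrite /node_psi e; congr rq.
  by rewrite /node_lift /= hornerC map_polyX !polyC0 add0r subr0.
have [P <-] := rq_surj z.
elim/poly_ind: P => [|P f IP]; first by rewrite -[0]polyC0 -polyC0; exact: IC.
rewrite (rmorphD rqn) (rmorphM rqn); apply: (ID); first exact: (IM).
elim/poly_ind: f => [|f c If]; first by rewrite -polyC0; exact: IC.
rewrite polyCD polyCM (rmorphD rqn) (rmorphM rqn).
exact: (ID _ _ (IM _ _ If IX') (IC c)).
Qed.

Lemma node_psi_bij : bijective node_psi.
Proof.
pose inv z := projT1 (cid (node_psi_surj z)).
have invK z : node_psi (inv z) = z by rewrite /inv; case: cid.
by exists inv => x; [apply: node_psi_inj; rewrite invK|].
Qed.
End Final.

Theorem theorem9p12 (F : finFieldType) (q_odd : odd #|F|) :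
  [/\ exists phi_e : {rmorphism Theta F -> {poly Zinv #|F|}},
        counting_measure false phi_e,
      exists phi_o : {rmorphism Theta F -> {poly Zinv #|F|}},
        counting_measure true phi_o,
      forall phi_e phi_o : {rmorphism Theta F -> {poly Zinv #|F|}},
        counting_measure false phi_e -> counting_measure true phi_o ->
        injective (counting_loc phi_e phi_o) /\
        (forall p : {poly Zinv (2 * #|F|)} * {poly Zinv (2 * #|F|)},
          (exists x, counting_loc phi_e phi_o x = p) <-> p.1.[0] = p.2.[0])
    & exists psi : {rmorphism loc ((2 * #|F|)%:R : Theta F) -> node_ring F},
        bijective psi].
Proof.
have [eps eps_ns] := nonsq_ex q_odd.
have cme := counting_phi_measure q_odd false; have cmo := counting_phi_measure q_odd true.
split.
- by exists (counting_phi q_odd false).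
- by exists (counting_phi q_odd true).
- move=> phi_e phi_o ce co; split; first exact: (CL_inj q_odd ce co eps_ns).
  exact: (image_CL q_odd ce co eps_ns).
exists (node_psi_morph q_odd cme cmo eps_ns); exact: (node_psi_bij q_odd cme cmo eps_ns).
Qed.
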